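(* Let $n\ge 1$ and let $m_i$ ($1\le i\le n$) and $m_{ij}=m_{ji}$ ($1\le i<j\le n$) be real numbers for which the series defining $\mathrm{F}_-\big((m_i,m_{ij})_{ij}\big)$ converges and all the generalized Selberg integrals occurring below converge (for instance all $m_i,m_{ij}\ge 0$). Then $$\mathrm{F}_-\big((m_i,m_{ij})_{ij}\big)=\sum_{\sigma\in S_n} q(\sigma)\;\tilde{\mathrm{F}}_-\big((m_{\sigma^{-1}(i)},\,m_{\sigma^{-1}(i)\sigma^{-1}(j)})_{ij}\big),$$ where $q(\sigma)$ is the braiding factor for the braiding matrix $q_{ij}=e^{\pi i\, m_{ij}}$, and where the reduced quantum monodromy number is $$\tilde{\mathrm{F}}_-\big((m_i,m_{ij})_{ij}\big):=\frac{1}{(2\pi i)^n}\sum_{k=0}^n(-1)^k\Big(\prod_{i=k+1}^n e^{2\pi i\, m_i}\Big)\sum_{\eta\in S_{k,\overline{n-k}}}\Big(\prod_{i<j,\ \eta(i)>\eta(j)}e^{\pi i\, m_{ij}}\Big)\,\mathrm{Sel}\big((m_{\eta^{-1}(i)};0;m_{\eta^{-1}(i)\eta^{-1}(j)})_{ij}\big).$$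
   Context: Throughout $i=\sqrt{-1}$ when used as a scalar and $m_{ji}:=m_{ij}$. For real $m$ define $r(m):=0$ if $m\in\mathbb{Z}\setminus\{-1\}$, $r(-1):=1$, and $r(m):=\frac{e^{2\pi i (m+1)}-1}{2\pi i\,(m+1)}$ if $m\notin\mathbb{Z}$ (the formal residue of $z^m$ along the lift of the unit circle starting in the principal branch). The quantum monodromy number is the series $$\mathrm{F}_-\big((m_i,m_{ij})_{ij}\big):=\sum_{(k_{ij})_{i<j}\in\mathbb{N}_0^{\binom n2}}\ \prod_{i=1}^n r\Big(m_i+\sum_{j>i}(m_{ij}-k_{ij})+\sum_{j<i}k_{ji}\Big)\prod_{i<j}(-1)^{k_{ij}}\binom{m_{ij}}{k_{ij}},$$ with generalized binomial coefficients. The generalized Selberg integral is $$\mathrm{Sel}\big((m_i;\bar m_i;m_{ij})_{i<j}\big):=\int_{1\ge z_1>z_2>\dots>z_n\ge 0}\prod_i z_i^{m_i}\prod_i(1-z_i)^{\bar m_i}\prod_{i<j}(z_i-z_j)^{m_{ij}}\,dz_1\cdots dz_n .$$ The braiding factor $q:S_n\to\mathbb{C}^\times$ is defined by $q(\mathrm{id})=1$ and $q((k,k+1)\sigma)=e^{\pi i\, m_{\sigma^{-1}(k)\sigma^{-1}(k+1)}}\,q(\sigma)$ whenever the length satisfies $\ell((k,k+1)\sigma)=\ell(\sigma)+1$ (here $(k,k+1)$ is the simple transposition and $\ell$ the Coxeter length). For $0\le k\le n$, $S_{k,\overline{n-k}}:=\{\eta\in S_n:\ \eta(i)<\eta(j)\text{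 for all }i<j\le k,\ \eta(i)>\eta(j)\text{ for all }k<i<j\}$, a set of $\binom nk$ permutations. *)

(* Defs.v *)
From HB Require Import structures.
From mathcomp Require Import all_boot all_order all_algebra all_fingroup.
From mathcomp Require Import finmap.
From mathcomp Require Import all_classical all_reals all_analysis.
From mathcomp Require Import complex.

Set Implicit Arguments.
Unset Strict Implicit.
Unset Printing Implicit Defensive.

Import Order.TTheory GRing.Theory Num.Theory.
Import numFieldNormedType.Exports.
Local Open Scope classical_set_scope.
Local Open Scope ring_scope.
Local Open Scope complex_scope.

Definition expi {R : realType} (x : R) : R[i] := cos x +i* sin x.

Definition twopii {R : realType} : R[i] := 0 +i* (2 * pi).

(* r(m): formal residue of z^m along the lifted unit circle *)
Definition resid {R : realType} (m : R) : R[i] :=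
  if m == -1 then 1
  else if `[< exists z : int, m = z%:~R >] then 0
  else (expi (2 * pi * (m + 1)) - 1) / (twopii * (m + 1)%:C).

Definition gbinom {R : realType} (m : R) (k : nat) : R :=
  (\prod_(l < k) (m - l%:R)) / (k`!)%:R.

Definition upairs (n : nat) := {p : 'I_n * 'I_n | (p.1 < p.2)%N}.

Definition kval (n : nat) (k : {ffun upairs n -> nat}) (i j : 'I_n) : nat :=
  if @insub _ (fun p : 'I_n * 'I_n => (p.1 < p.2)%N) (upairs n) (i, j) is Some p
  then k p else 0%N.

Definition Fterm {R : realType} (n : nat) (m : 'I_n -> R)
    (mm : 'I_n -> 'I_n -> R) (k : {ffun upairs n -> nat}) : R[i] :=
  (\prod_(i < n)
     resid (m i + \sum_(j < n | (i < j)%N) (mm i j - (kval k i j)%:R)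
                + \sum_(j < n | (j < i)%N) (kval k j i)%:R))
  * \prod_(p : upairs n)
      ((-1) ^+ (k p) * gbinom (mm (val p).1 (val p).2) (k p))%:C.

Definition totally {I : choiceType} : set_system {fset I} :=
  filter_from setT (fun A => [set B | (A `<=` B)%fset]).

#[global] Instance totally_filter {I : choiceType} : ProperFilter (@totally I).
Proof.
eapply filter_from_proper; last by move=> A _; exists A; rewrite /= fsubset_refl.
apply: filter_fromT_filter; first by exists fset0.
by move=> A B /=; exists (A `|` B)%fset => P /=; rewrite fsubUset => /andP[].
Qed.

Definition partial_sum {I : choiceType} {R : realType} (t : I -> R[i])
    (A : {fset I}) : R[i] := \sum_(i <- A) t i.

Definition series_to {I : choiceType} {R : realType} (t : I -> R[i])
    (L : R[i]) : Prop :=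
  ((fun A => complex.Re (partial_sum t A)) @ totally --> complex.Re L) /\
  ((fun A => complex.Im (partial_sum t A)) @ totally --> complex.Im L).

(* iterated Lebesgue integral: variable z_j runs over [0, up], the next
   one over [0, z_j], etc.; k variables remain to be integrated *)
Fixpoint iint {R : realType} (j k : nat) (up : R) (z : nat -> R)
    (F : (nat -> R) -> \bar R) : \bar R :=
  match k with
  | 0%N => F z
  | k'.+1 => (\int[@lebesgue_measure R]_(t in `[0%R, up]%classic) 
               iint j.+1 k' t (fun i => if i == j then t else z i) F)%E
  end.

(* Sel((m_i; mbar_i; m_ij)_{i<j}) over 1 >= z_1 >= ... >= z_n >= 0
   (integrand is nonnegative; the value lives in \bar R, and
   "converges" means "< +oo") *)
Definition Sel {R : realType} (n : nat) (a abar : 'I_n -> R)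
    (b : 'I_n -> 'I_n -> R) : \bar R :=
  iint 0 n 1 (fun _ => 0)
    (fun z => ((\prod_(i < n) (z i `^ a i * (1 - z i) `^ abar i))
               * \prod_(i < n) \prod_(j < n | (i < j)%N) (z i - z j) `^ b i j)%:E).

Definition perm_length (n : nat) (s : {perm 'I_n}) : nat :=
  #|[set p : 'I_n * 'I_n | ((p.1 < p.2) && (s p.2 < s p.1))%N]|.

Definition stransp (n k : nat) (Hk : (k.+1 < n)%N) : {perm 'I_n} :=
  tperm (Ordinal (ltnW Hk)) (Ordinal Hk).

(* q is the braiding factor for the braiding matrix q_ij = e^{pi i m_ij}:
   q(id) = 1 and q((k,k+1) sigma) = e^{pi i m_{s^-1(k) s^-1(k+1)}} q(sigma)
   whenever l((k,k+1) sigma) = l(sigma) + 1.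
   In mathcomp, (s * t) x = t (s x), so (k,k+1) o sigma is  sigma * stransp. *)
Definition is_braiding_factor {R : realType} (n : nat)
    (mm : 'I_n -> 'I_n -> R) (q : {perm 'I_n} -> R[i]) : Prop :=
  q 1%g = 1 /\
  forall (k : nat) (Hk : (k.+1 < n)%N) (s : {perm 'I_n}),
    perm_length (s * stransp Hk)%g = (perm_length s).+1 ->
    q (s * stransp Hk)%g =
      expi (pi * mm ((s^-1)%g (Ordinal (ltnW Hk))) ((s^-1)%g (Ordinal Hk)))
      * q s.

Definition shuffle (n k : nat) (eta : {perm 'I_n}) : bool :=
  [forall i : 'I_n, forall j : 'I_n,
     ((i < j) && (j < k))%N ==> (eta i < eta j)%N] &&
  [forall i : 'I_n, forall j : 'I_n,
     ((k <= i) && (i < j))%N ==> (eta j < eta i)%N].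

Definition Sel_eta {R : realType} (n : nat) (m : 'I_n -> R)
    (mm : 'I_n -> 'I_n -> R) (eta : {perm 'I_n}) : \bar R :=
  Sel (fun i => m ((eta^-1)%g i)) (fun _ => 0)
      (fun i j => mm ((eta^-1)%g i) ((eta^-1)%g j)).

Definition Ftilde {R : realType} (n : nat) (m : 'I_n -> R)
    (mm : 'I_n -> 'I_n -> R) : R[i] :=
  (twopii ^- n) *
  \sum_(k < n.+1)
    ((-1) ^+ k * (\prod_(i < n | (k <= i)%N) expi (2 * pi * m i))
     * \sum_(eta : {perm 'I_n} | shuffle k eta)
         ((\prod_(i < n) \prod_(j < n | ((i < j) && (eta j < eta i))%N)
              expi (pi * mm i j))
          * (fine (Sel_eta m mm eta))%:C)).

(* Main.v *)
(* Each residue r(m) is the mean of z^(m+1) over the lifted unit circle. Hence, for 0 < x < 1,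
   the series weighted by x^(sum of (j - i) k_ij) is, through the binomial series, the integral
   of prod z_i^(m_i) prod (z_i - z_j)^(m_ij) over the nested circles |z_i| = x^i. Contracting
   these circles one after the other onto the two sides of the segments [0, x^i] (a keyhole
   contour) turns it into 1/(2 pi i)^n times an integral over a cube, with phases that depend
   only on the relative order of the z_i. On each chamber z_(s(1)) > ... > z_(s(n)) the product
   of the phases expands into the coefficients of the reduced monodromy numbers. Letting x -> 1
   concludes: Abel summation for the series, dominated convergence for the integrals. *)
Require Import Defs.
From HB Require Import structures.
From mathcomp Require Import all_boot all_order all_algebra all_fingroup.
From mathcomp Require Import finmap.
From mathcomp Require Import all_classical all_reals all_analysis.
From mathcomp Require Import measurable_realfun complex.
From mathcomp Require Import ring lra zify.

Set Implicit Arguments.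
Unset Strict Implicit.
Unset Printing Implicit Defensive.

Import Order.TTheory GRing.Theory Num.Theory.
Import numFieldNormedType.Exports.
Local Open Scope classical_set_scope.
Local Open Scope ring_scope.
Local Open Scope complex_scope.

(** On a common circle the binomial series would be needed at their radius of convergence; distinct
    radii bound every ratio [|z_j / z_i|] by [x], and the expansion can be integrated term by term.
    The circles are contracted from the innermost outwards: when [z_i] is contracted, the branch
    points inside its circle, namely 0 and the later variables, already lie on the segment
    [[0, x ^ i]], while the earlier variables stay on larger circles. Cauchy's theorem is replaced
    by Fubini on a rectangle in polar coordinates, for a form whose closedness is one identity of
    real partial derivatives. The obstacle is negative exponents: only the finiteness of the Selberg
    integrals is known. It gives integrability of the density on the cube; this is passed on to the
    product of the factors of the later variables, and to almost every fibre. There it forces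
    [m_i > -1], the condition under which the small circle around 0 contributes nothing. The
    independent uniform coordinates live on an abstract probability space, and one coordinate at a
    time is resampled. *)

Local Notation Re := complex.Re.
Local Notation Im := complex.Im.

(** * Complex numbers through real and imaginary parts *)

Section complex_numbers.
Context {R : realType}.
Implicit Types (z w : R[i]) (x y : R).

Lemma complex_ReIm z w : Re z = Re w -> Im z = Im w -> z = w.
Proof. by case: z => a b; case: w => c d /= -> ->. Qed.

Lemma cReD z w : Re (z + w) = Re z + Re w. Proof. by case: z; case: w. Qed.
Lemma cImD z w : Im (z + w) = Im z + Im w. Proof. by case: z; case: w. Qed.
Lemma cReN z : Re (- z) = - Re z. Proof. by case: z. Qed.
Lemma cImN z : Im (- z) = - Im z. Proof. by case: z. Qed.
Lemma cReB z w : Re (z - w) = Re z - Re w. Proof. by rewrite cReD cReN. Qed.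
Lemma cImB z w : Im (z - w) = Im z - Im w. Proof. by rewrite cImD cImN. Qed.
Lemma cReM z w : Re (z * w) = Re z * Re w - Im z * Im w.
Proof. by case: z; case: w. Qed.
Lemma cImM z w : Im (z * w) = Re z * Im w + Im z * Re w.
Proof. by case: z; case: w. Qed.
Lemma cReV z : Re (z^-1) = Re z / (Re z ^+ 2 + Im z ^+ 2). Proof. by case: z. Qed.
Lemma cImV z : Im (z^-1) = - (Im z / (Re z ^+ 2 + Im z ^+ 2)). Proof. by case: z. Qed.

Lemma Re_sum (I : Type) (s : seq I) (P : pred I) (F : I -> R[i]) :
  Re (\sum_(i <- s | P i) F i) = \sum_(i <- s | P i) Re (F i).
Proof. by elim/big_rec2 : _ => [//|i a b _ <-]; rewrite cReD. Qed.
Lemma Im_sum (I : Type) (s : seq I) (P : pred I) (F : I -> R[i]) :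
  Im (\sum_(i <- s | P i) F i) = \sum_(i <- s | P i) Im (F i).
Proof. by elim/big_rec2 : _ => [//|i a b _ <-]; rewrite cImD. Qed.

(** The norm of [R[i]] takes its values in [R[i]]; estimates and integrals need the modulus as a
    real number. *)
Definition cn z : R := Num.sqrt (Re z ^+ 2 + Im z ^+ 2).

Lemma cnE z : `|z| = (cn z)%:C. Proof. exact: normc_def. Qed.

Lemma cn_ge0 z : 0 <= cn z. Proof. exact: sqrtr_ge0. Qed.

Lemma cn_sqr z : cn z ^+ 2 = Re z ^+ 2 + Im z ^+ 2.
Proof. by rewrite sqr_sqrtr// addr_ge0 ?sqr_ge0. Qed.

Lemma cnM z w : cn (z * w) = cn z * cn w.
Proof. by apply: complexI; rewrite -cnE normrM !cnE -rmorphM. Qed.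

Lemma cn_eq0 z : (cn z == 0) = (z == 0).
Proof. by rewrite -[RHS]normr_eq0 cnE eq_complex /= eqxx andbT. Qed.

Lemma cn_gt0 z : (0 < cn z) = (z != 0).
Proof. by rewrite lt_neqAle cn_ge0 andbT eq_sym cn_eq0. Qed.

Lemma cnV z : cn z^-1 = (cn z)^-1.
Proof.
have [->|z0] := eqVneq z 0; first by rewrite invr0 /cn /= expr0n addr0 sqrtr0 invr0.
apply: (@mulfI _ (cn z)); first by rewrite cn_eq0.
rewrite -cnM !mulfV ?cn_eq0 //; first by rewrite /cn /= expr0n addr0 expr1n sqrtr1.
Qed.

Lemma cnN z : cn (- z) = cn z.
Proof. by rewrite /cn cReN cImN !sqrrN. Qed.

Lemma cnD z w : cn (z + w) <= cn z + cn w.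
Proof. by rewrite -lecR -cnE rmorphD /= -!cnE ler_normD. Qed.

Lemma cn_real x : cn x%:C = `|x|.
Proof. by rewrite /cn /= expr0n addr0 sqrtr_sqr. Qed.

Lemma cn0 : cn 0 = 0. Proof. by rewrite -[0]/((0:R)%:C) cn_real normr0. Qed.

Lemma cn1 : cn 1 = 1. Proof. by rewrite -[1]/((1:R)%:C) cn_real normr1. Qed.

Lemma cn_Re z : `|Re z| <= cn z.
Proof. by rewrite -sqrtr_sqr ler_wsqrtr// lerDl sqr_ge0. Qed.

Lemma cn_Im z : `|Im z| <= cn z.
Proof. by rewrite -sqrtr_sqr ler_wsqrtr// lerDr sqr_ge0. Qed.

Lemma cnX z k : cn (z ^+ k) = cn z ^+ k.
Proof. by elim: k => [|k IH]; rewrite ?cn1// !exprS cnM IH. Qed.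

Lemma cn_prod (I : Type) (s : seq I) (P : pred I) (F : I -> R[i]) :
  cn (\prod_(i <- s | P i) F i) = \prod_(i <- s | P i) cn (F i).
Proof. by elim/big_rec2 : _ => [|i a b _ <-]; rewrite ?cn1 ?cnM. Qed.

Lemma cn_sum (I : Type) (s : seq I) (P : pred I) (F : I -> R[i]) :
  cn (\sum_(i <- s | P i) F i) <= \sum_(i <- s | P i) cn (F i).
Proof.
elim/big_rec2 : _ => [|i a b _ h]; first by rewrite cn0.
by apply: (le_trans (cnD _ _)); rewrite lerD2l.
Qed.

Lemma expiD x y : expi (x + y) = expi x * expi y.
Proof.
apply: complex_ReIm; rewrite !(cReM, cImM) /=; first by rewrite cosD.
by rewrite sinD addrC; ring.
Qed.

Lemma expi0 : expi (0 : R) = 1.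
Proof. by rewrite /expi cos0 sin0. Qed.

Lemma cn_expi x : cn (expi x) = 1.
Proof. by rewrite /cn /= cos2Dsin2 sqrtr1. Qed.

Lemma expi_neq0 x : expi x != 0.
Proof. by rewrite -cn_eq0 cn_expi oner_neq0. Qed.

Lemma expiN x : expi (- x) = (expi x)^-1.
Proof.
by apply: (@mulfI _ (expi x)); rewrite ?expi_neq0// -expiD subrr expi0 mulfV ?expi_neq0.
Qed.

Lemma expiX x k : expi x ^+ k = expi (k%:R * x).
Proof.
elim: k => [|k IH]; first by rewrite mul0r expi0.
by rewrite exprS IH -expiD -natr1 mulrDl mul1r addrC.
Qed.

Lemma expi_sum (I : Type) (s : seq I) (P : pred I) (F : I -> R) :
  expi (\sum_(i <- s | P i) F i) = \prod_(i <- s | P i) expi (F i).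
Proof. by elim/big_rec2 : _ => [|i a b _ <-]; rewrite ?expi0 ?expiD. Qed.

Lemma expi_2pi : expi (2 * pi : R) = 1.
Proof. by rewrite /expi mulr_natl cos2pi sin2pi. Qed.

Lemma expi_2pi_nat k : expi (2 * pi * k%:R : R) = 1.
Proof. by rewrite mulrC -expiX expi_2pi expr1n. Qed.

End complex_numbers.

(** * Complex-valued functions of a real variable and the principal power *)

Section complex_derivatives.
Context {R : realType}.
Implicit Types (f g : R -> R[i]) (x : R) (d e : R[i]).

Definition cder f x d :=
  is_derive x 1 (fun t => Re (f t)) (Re d) /\ is_derive x 1 (fun t => Im (f t)) (Im d).

Lemma cder_cst c x : cder (fun=> c) x 0.
Proof. by split; exact: is_derive_cst. Qed.

Lemma cderD f g x d e : cder f x d -> cder g x e -> cder (fun t => f t + g t) x (d + e).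
Proof.
move=> [f1 f2] [g1 g2]; split; rewrite ?cReD ?cImD.
- rewrite [X in is_derive _ _ X _](_ : _ = (fun t => Re (f t)) + (fun t => Re (g t))).
    exact: is_deriveD.
  by apply/funext => t; rewrite cReD.
- rewrite [X in is_derive _ _ X _](_ : _ = (fun t => Im (f t)) + (fun t => Im (g t))).
    exact: is_deriveD.
  by apply/funext => t; rewrite cImD.
Qed.

Lemma is_derive_mul (u v : R -> R) x a b : is_derive x 1 u a -> is_derive x 1 v b ->
  is_derive x 1 (fun t => u t * v t) (u x * b + v x * a).
Proof. exact: is_deriveM. Qed.

Lemma is_derive_addf (u v : R -> R) x a b : is_derive x 1 u a -> is_derive x 1 v b ->
  is_derive x 1 (fun t => u t + v t) (a + b).
Proof. exact: is_deriveD. Qed.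

Lemma is_derive_oppf (u : R -> R) x a : is_derive x 1 u a ->
  is_derive x 1 (fun t => - u t) (- a).
Proof. exact: is_deriveN. Qed.

Lemma is_derive_compf (u v : R -> R) x a b : is_derive x 1 v b ->
  is_derive (v x) 1 u a -> is_derive x 1 (fun t => u (v t)) (b * a).
Proof.
move=> h k; rewrite mulrC; exact: (@is_derive1_comp R u v x a b k h).
Qed.

Lemma is_derive_invf (u : R -> R) x a : u x != 0 -> is_derive x 1 u a ->
  is_derive x 1 (fun t => (u t)^-1) (- (u x) ^- 2 * a).
Proof. by move=> h k; exact: is_deriveV. Qed.

Lemma cderM f g x d e : cder f x d -> cder g x e ->
  cder (fun t => f t * g t) x (d * g x + f x * e).
Proof.
move=> [f1 f2] [g1 g2]; split.
- rewrite (_ : (fun t => _) = (fun t => Re (f t) * Re (g t) + - (Im (f t) * Im (g t)))); last first.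
    by apply/funext => t; rewrite cReM.
  have := is_derive_addf (is_derive_mul f1 g1) (is_derive_oppf (is_derive_mul f2 g2)).
  by move=> h; apply: is_derive_eq h _; rewrite cReD !cReM; ring.
- rewrite (_ : (fun t => _) = (fun t => Re (f t) * Im (g t) + Im (f t) * Re (g t))); last first.
    by apply/funext => t; rewrite cImM.
  have := is_derive_addf (is_derive_mul f1 g2) (is_derive_mul f2 g1).
  by move=> h; apply: is_derive_eq h _; rewrite cImD !cImM; ring.
Qed.

Lemma cder_real (u : R -> R) x a : is_derive x 1 u a -> cder (fun t => (u t)%:C) x a%:C.
Proof. by move=> h; split => //=; exact: is_derive_cst. Qed.

Lemma cder_expi (u : R -> R) x a : is_derive x 1 u a ->
  cder (fun t => expi (u t)) x ((0 +i* a) * expi (u x)).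
Proof.
move=> h; split; rewrite ?cReM ?cImM /=.
- have := is_derive_compf h (is_derive_cos (u x)).
  by move=> k; apply: is_derive_eq k _; ring.
- have := is_derive_compf h (is_derive_sin (u x)).
  by move=> k; apply: is_derive_eq k _; ring.
Qed.

(** Half-angle formula for the principal argument, smooth on the whole slit plane, where the
    denominator is positive. On the nonpositive reals the denominator vanishes and the value is the
    default 0. *)
Definition carg (z : R[i]) : R := 2 * atan (Im z / (cn z + Re z)).

Definition ppow (b : R) (z : R[i]) : R[i] := ((cn z) `^ b)%:C * expi (b * carg z).

(* The plane slit along the nonpositive reals. *)
Definition slit (z : R[i]) := 0 < cn z + Re z.

Lemma slit_cn z : slit z -> 0 < cn z.
Proof.
rewrite /slit => h; have := cn_Re z; have := ler_norm (Re z).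
by have := cn_ge0 z; lra.
Qed.

Lemma is_derive_cn f x d : 0 < cn (f x) -> cder f x d ->
  is_derive x 1 (fun t => cn (f t)) ((Re (f x) * Re d + Im (f x) * Im d) / cn (f x)).
Proof.
move=> h [f1 f2].
have k : 0 < Re (f x) ^+ 2 + Im (f x) ^+ 2 by rewrite -cn_sqr exprn_gt0.
have := is_derive_compf (is_derive_addf (is_derive_mul f1 f1) (is_derive_mul f2 f2)) (is_derive1_sqrt k).
move=> D; apply: is_derive_eq D _.
have -> : Num.sqrt (Re (f x) ^+ 2 + Im (f x) ^+ 2) = cn (f x) by [].
by field; rewrite gt_eqF.
Qed.

Lemma is_derive_carg f x d : slit (f x) -> cder f x d ->
  is_derive x 1 (fun t => carg (f t)) ((Re (f x) * Im d - Im (f x) * Re d) / cn (f x) ^+ 2).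
Proof.
move=> s fd; have [f1 f2] := fd; have c0 := slit_cn s.
have D1 := is_derive_addf (is_derive_cn c0 fd) f1.
have n0 : cn (f x) + Re (f x) != 0 by rewrite gt_eqF.
have D2 := is_derive_mul f2 (@is_derive_invf (fun t => cn (f t) + Re (f t)) x _ n0 D1).
have D3 := is_derive_compf D2 (is_derive1_atan _).
have D4 := is_derive_mul (is_derive_cst (2:R) x 1) D3.
apply: is_derive_eq D4 _ => /=.
rewrite mulr0 addr0.
have := cn_sqr (f x); move: c0 s; rewrite /slit.
set c := cn _; set X := Re (f x); set Y := Im (f x); set X' := Re d; set Y' := Im d.
move=> c0 s cE.
(* Since [Y ^ 2 = (c - X) (c + X)], the [1 + u ^ 2] coming from [atan] becomes a simple quotient
   that cancels. *)
have -> : 1 + (Y / (c + X)) ^+ 2 = 2 * c / (c + X).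
  rewrite expr_div_n; have -> : Y ^+ 2 = c ^+ 2 - X ^+ 2 by rewrite cE; ring.
  by field; rewrite gt_eqF.
have cX : c + X != 0 by rewrite gt_eqF.
have c1 : c != 0 by rewrite gt_eqF.
have -> : 2 * ((Y * (- (c + X) ^- 2 * ((X * X' + Y * Y') / c + X')) + (c + X)^-1 * Y') / (2 * c / (c + X))) =
  ((X * Y' - Y * X') * (c + X) + Y' * (c ^+ 2 - X ^+ 2 - Y ^+ 2)) / (c ^+ 2 * (c + X)).
  by field; rewrite c1 cX.
rewrite cE (_ : _ - _ - _ = 0); last by ring.
by rewrite mulr0 addr0 -cE; field; rewrite c1 cX.
Qed.

(** In polar form the modulus contributes the real part of [d / f x] and the argument its imaginary
    part; together they are the logarithmic derivative. *)
Lemma cder_ppow b f x d : slit (f x) -> cder f x d ->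
  cder (fun t => ppow b (f t)) x (b%:C * d / f x * ppow b (f x)).
Proof.
move=> s fd; have c0 := slit_cn s.
have D1 := cder_real (is_derive_compf (is_derive_cn c0 fd) (is_derive1_powR b c0)).
have D2 := cder_expi (is_derive_mul (is_derive_cst (b:R) x 1) (is_derive_carg s fd)).
have [E1 E2] := cderM D1 D2.
suff E : b%:C * d / f x * ppow b (f x) =
  ((Re (f x) * Re d + Im (f x) * Im d) / cn (f x) * (b * cn (f x) `^ (b - 1)))%:C *
  expi (b * carg (f x)) +
  (cn (f x) `^ b)%:C * ((0 +i* (b * ((Re (f x) * Im d - Im (f x) * Re d) / cn (f x) ^+ 2) + carg (f x) * 0)) *
  expi (b * carg (f x))).
  by split; rewrite E.
have pE : cn (f x) `^ (b - 1) = cn (f x) `^ b / cn (f x).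
  apply: (@mulIf _ (cn (f x))); first by rewrite gt_eqF.
  rewrite divfK ?gt_eqF// -{2}(powRr1 (ltW c0)) -powRD ?subrK//.
  by rewrite (gt_eqF c0) implybT.
rewrite mulr0 addr0 pE.
rewrite /ppow mulrA [X in _ + X]mulrA -mulrDl; congr (_ * _).
have c1 : cn (f x) != 0 by rewrite gt_eqF.
have -> : (f x)^-1 = ((Re (f x)) -i* (Im (f x))) * (((cn (f x)) ^+ 2)^-1)%:C.
  by apply: complex_ReIm; rewrite ?cReV ?cImV cn_sqr !(cReM, cImM) /=; ring.
by apply: complex_ReIm; rewrite !(cReD, cImD, cReM, cImM) /=; field.
Qed.

End complex_derivatives.

(** * Limits of complex-valued functions *)

Section complex_limits.
Context {R : realType}.

Definition ccvg {T : Type} (F : set_system T) (f : T -> R[i]) (z : R[i]) :=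
  (Re (f t) @[t --> F] --> Re z) /\ (Im (f t) @[t --> F] --> Im z).

Section filter.
Context {T : Type} {F : set_system T} {FF : ProperFilter F}.
Implicit Types (f g : T -> R[i]) (z w : R[i]).

Lemma ccvg_cst z : ccvg F (fun=> z) z.
Proof. by split; exact: cvg_cst. Qed.

Lemma ccvgD f g z w : ccvg F f z -> ccvg F g w -> ccvg F (fun t => f t + g t) (z + w).
Proof.
move=> [f1 f2] [g1 g2]; split.
- rewrite cReD; under eq_fun do rewrite cReD; exact: cvgD.
- rewrite cImD; under eq_fun do rewrite cImD; exact: cvgD.
Qed.

Lemma ccvgM f g z w : ccvg F f z -> ccvg F g w -> ccvg F (fun t => f t * g t) (z * w).
Proof.
move=> [f1 f2] [g1 g2]; split.
- rewrite cReM; under eq_fun do rewrite cReM; by apply: cvgB; apply: cvgM.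
- rewrite cImM; under eq_fun do rewrite cImM; by apply: cvgD; apply: cvgM.
Qed.

Lemma ccvgB f g z w : ccvg F f z -> ccvg F g w -> ccvg F (fun t => f t - g t) (z - w).
Proof.
move=> [f1 f2] [g1 g2]; split.
- rewrite cReB; under eq_fun do rewrite cReB; exact: cvgB.
- rewrite cImB; under eq_fun do rewrite cImB; exact: cvgB.
Qed.

Lemma ccvg_1B f z : ccvg F f z -> ccvg F (fun t => 1 - f t) (1 - z).
Proof. by apply: ccvgB; exact: ccvg_cst. Qed.

Lemma ccvg_prod (I : Type) (s : seq I) (P : pred I) (f : I -> T -> R[i]) (z : I -> R[i]) :
  (forall i, P i -> ccvg F (f i) (z i)) ->
  ccvg F (fun t => \prod_(i <- s | P i) f i t) (\prod_(i <- s | P i) z i).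
Proof.
move=> h; elim: s => [|i s IH].
  rewrite big_nil; under eq_fun do rewrite big_nil; exact: ccvg_cst.
rewrite big_cons; under eq_fun do rewrite big_cons.
by case Pi : (P i) => //; apply: ccvgM => //; exact: h.
Qed.

Lemma ccvg_sum (I : Type) (s : seq I) (P : pred I) (f : I -> T -> R[i]) (z : I -> R[i]) :
  (forall i, P i -> ccvg F (f i) (z i)) ->
  ccvg F (fun t => \sum_(i <- s | P i) f i t) (\sum_(i <- s | P i) z i).
Proof.
move=> h; elim: s => [|i s IH].
  rewrite big_nil; under eq_fun do rewrite big_nil; exact: ccvg_cst.
rewrite big_cons; under eq_fun do rewrite big_cons.
by case Pi : (P i) => //; apply: ccvgD => //; exact: h.
Qed.

Lemma ccvg_unique f z w : ccvg F f z -> ccvg F f w -> z = w.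
Proof.
by move=> [a b] [c d]; apply: complex_ReIm;
  [exact: (cvg_unique _ a c)|exact: (cvg_unique _ b d)].
Qed.

Lemma ccvg_real (f : T -> R) (x : R) : f t @[t --> F] --> x ->
  ccvg F (fun t => (f t)%:C) x%:C.
Proof. by move=> h; split => //=; exact: cvg_cst. Qed.

Lemma ccvg_expi (f : T -> R) (x : R) : f t @[t --> F] --> x ->
  ccvg F (fun t => expi (f t)) (expi x).
Proof.
move=> h; split => /=.
- by apply: continuous_cvg => //; exact: continuous_cos.
- by apply: continuous_cvg => //; exact: continuous_sin.
Qed.

Lemma ccvg_cn f z : ccvg F f z -> cn (f t) @[t --> F] --> cn z.
Proof.
move=> [a b]; apply: continuous_cvg; first exact: sqrt_continuous.
by apply: cvgD; apply: cvgM.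
Qed.

Lemma ccvg_eq f g z : (\forall t \near F, f t = g t) -> ccvg F g z -> ccvg F f z.
Proof.
move=> e [a b]; split.
- by apply: cvg_trans a; apply: near_eq_cvg; near do by rewrite (near e).
- by apply: cvg_trans b; apply: near_eq_cvg; near do by rewrite (near e).
Unshelve. all: by end_near. Qed.

Lemma ccvgV f z : z != 0 -> ccvg F f z -> ccvg F (fun t => (f t)^-1) z^-1.
Proof.
move=> z0 [a b].
have n0 : Re z ^+ 2 + Im z ^+ 2 != 0 by rewrite -cn_sqr sqrf_eq0 cn_eq0.
have c : Re (f t) ^+ 2 + Im (f t) ^+ 2 @[t --> F] --> Re z ^+ 2 + Im z ^+ 2.
  by apply: cvgD; apply: cvgM.
split.
- rewrite cReV; under eq_fun do rewrite cReV.
  by apply: cvgM => //; exact: cvgV.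
- rewrite cImV; under eq_fun do rewrite cImV.
  by apply: cvgN; apply: cvgM => //; exact: cvgV.
Qed.

Lemma ccvg_ppow b f z : slit z -> ccvg F f z -> ccvg F (fun t => ppow b (f t)) (ppow b z).
Proof.
move=> s fz; have [c d] := fz; have z0 := slit_cn s; apply: ccvgM.
- apply: ccvg_real.
  have [/derivable1_diffP/differentiable_continuous h _] := is_derive1_powR b z0.
  exact: (cvg_comp _ _ (ccvg_cn fz) h).
- apply: ccvg_expi; apply: cvgM; first exact: cvg_cst.
  apply: cvgM; first exact: cvg_cst.
  apply: continuous_cvg; first exact: continuous_atan.
  apply: cvgM => //; apply: cvgV; first by rewrite gt_eqF.
  by apply: cvgD => //; exact: ccvg_cn.
Qed.

End filter.

Lemma cder_ccvg f (x : R) d : cder f x d -> ccvg (nbhs x) f (f x).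
Proof.
move=> [[a _] [b _]].
by split; apply: differentiable_continuous; exact/derivable1_diffP.
Qed.

(** The mean value theorem concerns real functions, so it is applied to each component. *)
Lemma cder0_cst (f : R -> R[i]) a b : a <= b ->
  (forall x, a <= x -> x <= b -> cder f x 0) -> f b = f a.
Proof.
move=> ab fd.
have cst0 (u : R -> R) : (forall x : R, a <= x -> x <= b -> is_derive x 1 u 0) -> u b = u a.
  move=> hu; have [||c _] := @MVT_segment R u (cst 0) a b ab.
  - by move=> x; rewrite in_itv /= => /andP[x0 xr]; apply: hu; exact: ltW.
  - apply: derivable_within_continuous => x; rewrite in_itv /= => /andP[x0 xr].
    by have [] := hu x x0 xr.
  - by rewrite mul0r => /subr0_eq.
apply: complex_ReIm.
- by apply: (cst0 (fun t => Re (f t))) => x ? ?; have [] := fd x.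
- by apply: (cst0 (fun t => Im (f t))) => x ? ?; have [] := fd x.
Qed.

Lemma slit_Re z : 0 < Re z -> slit (z : R[i]).
Proof. by rewrite /slit; have := cn_ge0 z; lra. Qed.

Lemma slit_Im z : Im z != 0 -> slit (z : R[i]).
Proof.
move=> h; have [r0|r0] := ltP 0 (Re z); first exact: slit_Re.
rewrite /slit -ltrBlDr sub0r -[X in X < _]ger0_norm ?oppr_ge0// normrN.
rewrite -sqrtr_sqr ltr_sqrt; first by rewrite ltrDl exprn_even_gt0.
by rewrite ltr_wpDl ?sqr_ge0// exprn_even_gt0.
Qed.

Lemma ppow_mulN b z : slit z -> ppow b z * ppow (- b) z = 1 :> R[i].
Proof.
move=> s; rewrite /ppow mulrACA -expiD -mulrDl subrr mul0r expi0 mulr1 -rmorphM /=.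
by rewrite -powRD ?subrr ?powRr0// (gt_eqF (slit_cn s)) implybT.
Qed.

Lemma ppow1 b : ppow b 1 = 1 :> R[i].
Proof. by rewrite /ppow /carg cn1 powR1 /= mul0r atan0 !mulr0 expi0 mulr1. Qed.

Lemma cn_ppow b z : cn (ppow b z) = cn z `^ b :> R.
Proof. by rewrite /ppow cnM cn_expi mulr1 cn_real ger0_norm ?powR_ge0. Qed.

End complex_limits.

(** * The binomial series inside the unit disc *)

Section binomial_series.
Context {R : realType}.
Implicit Types (c : nat -> R) (b r : R).

(** The coefficient of [u ^ k] in [(1 - u) ^ b], which is also the factor attached to each [k_ij] in
    [Fterm]. *)
Definition bcoef b k : R := (-1) ^+ k * gbinom b k.

Lemma bcoef0 b : bcoef b 0 = 1.
Proof. by rewrite /bcoef /gbinom big_ord0 fact0 divr1 mulr1. Qed.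

Lemma bcoefS b k : k.+1%:R * bcoef b k.+1 = - (b - k%:R) * bcoef b k.
Proof.
rewrite /bcoef /gbinom big_ord_recr /= factS natrM exprS.
have : (k.+1%:R : R) != 0 by rewrite pnatr_eq0.
have : (k`!%:R : R) != 0 by rewrite pnatr_eq0 -lt0n fact_gt0.
move: (k.+1%:R) (k`!%:R) => x y y0 x0.
by field; rewrite x0 y0.
Qed.

(** Radius of convergence at least 1, phrased through bounded terms: in this form it passes to the
    termwise derivative by an elementary estimate. *)
Definition subunit_radius c := forall r, 0 <= r -> r < 1 -> exists C, forall k, `|c k| * r ^+ k <= C.

(** The ratio of consecutive terms is [|b - k| / k.+1 * r], which is at most 1 from the index [N]
    on; the sum [C] of the terms up to [N] bounds all earlier ones. *)
Lemma subunit_radius_bcoef b : subunit_radius (bcoef b).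
Proof.
move=> r r0 r1.
pose N := Num.bound (`|b| * r / (1 - r)).
pose C := \sum_(j < N.+1) `|bcoef b j| * r ^+ j.
have t0 j : 0 <= `|bcoef b j| * r ^+ j by rewrite mulr_ge0// exprn_ge0.
exists C; elim=> [|k IH].
  by rewrite /C big_ord_recl lerDl sumr_ge0.
have [kN|Nk] := leqP k.+1 N.
  rewrite /C (bigD1 (Ordinal (kN : k.+1 < N.+1)%N)) //= lerDl.
  by rewrite sumr_ge0.
apply: le_trans IH.
have e : `|bcoef b k.+1| = `|b - k%:R| / k.+1%:R * `|bcoef b k|.
  have k0 : (k.+1%:R : R) != 0 by rewrite pnatr_eq0.
  apply: (mulfI k0); rewrite -{1}(@ger0_norm _ k.+1%:R)// -normrM bcoefS normrM normrN.
  by rewrite mulrA; congr (_ * _); field.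
rewrite e exprS (_ : _ * _ * _ = (`|b - k%:R| / k.+1%:R * r) * (`|bcoef b k| * r ^+ k)); last by ring.
rewrite -[leRHS]mul1r; apply: ler_wpM2r => //.
rewrite mulrAC ler_pdivrMr// mul1r.
apply: (@le_trans _ _ ((`|b| + k%:R) * r)).
  rewrite ler_wpM2r//; apply: (le_trans (ler_normB _ _)).
  by rewrite lerD2l ger0_norm.
rewrite mulrDl -natr1.
have : `|b| * r / (1 - r) <= k%:R.
  apply: (@le_trans _ _ N%:R); last by rewrite ler_nat.
  apply/ltW/archi_boundP; rewrite divr_ge0 ?mulr_ge0// subr_ge0; exact: ltW.
rewrite ler_pdivrMr ?subr_gt0//; lra.
Qed.

(** [r ^+ k] is the smallest of the [k.+1] powers in the geometric sum up to [k]. *)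
Lemma natr_expr_bound r k : 0 <= r -> r < 1 -> k.+1%:R * r ^+ k <= (1 - r)^-1.
Proof.
move=> r0 r1.
rewrite -[leRHS]mul1r ler_pdivlMr ?subr_gt0//.
have -> : k.+1%:R * r ^+ k = \sum_(i < k.+1) r ^+ k.
  by rewrite sumr_const card_ord mulr_natl.
apply: (@le_trans _ _ ((\sum_(i < k.+1) r ^+ i) * (1 - r))).
  apply: ler_wpM2r; first by rewrite subr_ge0 ltW.
  apply: ler_sum => i _.
  by apply: ler_wiXn2l => //; [exact: ltW|rewrite -ltnS].
by rewrite -[1 - _]opprB mulrN mulrC -subrX1 opprB lerBlDr lerDl exprn_ge0.
Qed.

(** At the intermediate radius [s = (1 + r) / 2] the terms are bounded, and the geometric factor
    [(r / s) ^+ k] absorbs the factor [k.+1] of the derivative. *)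
Lemma subunit_radius_diffs c : subunit_radius c -> subunit_radius (pseries_diffs c).
Proof.
move=> h r r0 r1; pose s := (1 + r) / 2.
have s0 : 0 < s by rewrite /s; lra.
have s1 : s < 1 by rewrite /s; lra.
have rs : r / s < 1 by rewrite ltr_pdivrMr// mul1r /s; lra.
have [C hC] := h s (ltW s0) s1.
exists ((1 - r / s)^-1 * (C / s)) => k; rewrite /pseries_diffs normrM ger0_norm//.
have -> : k.+1%:R * `|c k.+1| * r ^+ k =
   (k.+1%:R * (r / s) ^+ k) * ((`|c k.+1| * s ^+ k.+1) / s).
  rewrite expr_div_n exprS; field.
  by rewrite expf_neq0// gt_eqF.
apply: ler_pM.
- by rewrite mulr_ge0// exprn_ge0// divr_ge0// ltW.
- apply: divr_ge0; last exact: ltW.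
  by apply: mulr_ge0 => //; apply: exprn_ge0; exact: ltW.
- by apply: natr_expr_bound => //; rewrite divr_ge0// ltW.
- by rewrite ler_pM2r ?invr_gt0.
Qed.

Lemma subunit_radius_sum c r : subunit_radius c -> 0 <= r -> r < 1 ->
  exists M, forall N, \sum_(k < N) `|c k| * r ^+ k <= M.
Proof.
move=> h r0 r1; pose s := (1 + r) / 2.
have s0 : 0 < s by rewrite /s; lra.
have s1 : s < 1 by rewrite /s; lra.
have rs : r / s < 1 by rewrite ltr_pdivrMr// mul1r /s; lra.
have rs0 : 0 <= r / s by rewrite divr_ge0// ltW.
have [C hC] := h s (ltW s0) s1.
have C0 : 0 <= C by apply: le_trans (hC 0%N); rewrite mulr_ge0// exprn_ge0// ltW.
exists (C / (1 - r / s)) => N.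
apply: (@le_trans _ _ (\sum_(k < N) C * (r / s) ^+ k)).
  apply: ler_sum => k _.
  have -> : `|c k| * r ^+ k = `|c k| * s ^+ k * (r / s) ^+ k.
    by rewrite -mulrA -exprMn [s * _]mulrC divfK ?gt_eqF.
  by rewrite ler_wpM2r// exprn_ge0.
rewrite -mulr_sumr ler_wpM2l// -[leRHS]mul1r ler_pdivlMr ?subr_gt0//.
by rewrite -[1 - _]opprB mulrN mulrC -subrX1 opprB lerBlDr lerDl exprn_ge0.
Qed.

Lemma subunit_radius_cvg c r : subunit_radius c -> `|r| < 1 -> cvgn (pseries c r).
Proof.
move=> h r1; apply: normed_cvg.
have [M hM] := subunit_radius_sum h (normr_ge0 r) r1.
apply: nondecreasing_is_cvgn.
  apply/nondecreasing_seqP => n.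
  rewrite -[leRHS]/(\sum_(0 <= k < n.+1) `|c k * r ^+ k|) big_nat_recr//=.
  by rewrite lerDl.
exists M => _ [N _ <-]; rewrite /normed_series_of /series /= big_mkord; apply: le_trans (hM N).
by apply: ler_sum => k _; rewrite normrM normrX.
Qed.

Lemma subunit_radius_deriv c r : subunit_radius c -> `|r| < 1 ->
  is_derive r 1 (fun x => limn (pseries c x)) (limn (pseries (pseries_diffs c) r)).
Proof.
move=> h r1; have r0 := normr_ge0 r.
have K1 : `|(1 + `|r|) / 2| < 1 by rewrite ger0_norm; lra.
apply: (@pseries_snd_diffs _ c ((1 + `|r|) / 2)).
- exact: subunit_radius_cvg.
- by apply: subunit_radius_cvg => //; exact: subunit_radius_diffs.
- by apply: subunit_radius_cvg => //; do 2 apply: subunit_radius_diffs.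
- by rewrite [ltRHS]ger0_norm; lra.
Qed.

Lemma subunit_radius_mul c (e : nat -> R) : subunit_radius c -> (forall k, `|e k| <= 1) ->
  subunit_radius (fun k => c k * e k).
Proof.
move=> h he r r0 r1; have [C hC] := h r r0 r1; exists C => k.
apply: le_trans (hC k); rewrite normrM ler_wpM2r ?exprn_ge0//.
by rewrite -[leRHS]mulr1 ler_wpM2l.
Qed.

(** Uniformity in the truncation [N] supplies the dominating constant when products of truncated
    series are integrated. *)
Lemma bcoef_sum_bound b r : 0 <= r -> r < 1 ->
  exists M, 0 <= M /\ forall N (u : R[i]), cn u <= r ->
    cn (\sum_(k < N) (bcoef b k)%:C * u ^+ k) <= M.
Proof.
move=> r0 r1; have [M hM] := subunit_radius_sum (subunit_radius_bcoef b) r0 r1.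
exists M; split; first by have := hM 0%N; rewrite big_ord0.
move=> N u ur; apply: le_trans (hM N); apply: (le_trans (cn_sum _ _ _)).
apply: ler_sum => k _; rewrite cnM cn_real cnX ler_wpM2l//.
by rewrite lerXn2r// nnegrE ?cn_ge0.
Qed.

(* Both sides solve (1 - r e^{i phi}) f' = - b e^{i phi} f in r, with f(0) = 1. *)
Lemma cbinomial_series b phi r : 0 <= r -> r < 1 ->
  ccvg \oo (fun N => \sum_(k < N) (bcoef b k)%:C * (r%:C * expi phi) ^+ k)
    (ppow b (1 - r%:C * expi phi)).
Proof.
move=> r0 r1.
(* Along the ray of angle [phi] the real and imaginary parts of the series are real power series in
   [r]. *)
pose A k := bcoef b k * cos (k%:R * phi).
pose B k := bcoef b k * sin (k%:R * phi).
have hA : subunit_radius A.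
  by apply: subunit_radius_mul (subunit_radius_bcoef b) _ => k; rewrite cos_max.
have hB : subunit_radius B.
  by apply: subunit_radius_mul (subunit_radius_bcoef b) _ => k; rewrite sin_max.
pose f x := limn (pseries A x) +i* limn (pseries B x).
pose S x N := \sum_(k < N) (bcoef b k)%:C * (x%:C * expi phi) ^+ k.
pose D x N := \sum_(k < N) (k.+1%:R * bcoef b k.+1)%:C * expi phi * (x%:C * expi phi) ^+ k.
pose f' x := limn (pseries (pseries_diffs A) x) +i* limn (pseries (pseries_diffs B) x).
have Re_ (x : R) k : (x%:C * expi phi) ^+ k = (x ^+ k * cos (k%:R * phi)) +i* (x ^+ k * sin (k%:R * phi)).
  by rewrite exprMn expiX -rmorphXn; apply: complex_ReIm; rewrite ?cReM ?cImM /= mul0r ?subr0 ?addr0.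
have SE x : `|x| < 1 -> ccvg \oo (S x) (f x).
  move=> x1; split => /=.
  - rewrite (_ : (fun N => _) = pseries A x); first exact: subunit_radius_cvg.
    apply/funext => N; rewrite Re_sum /pseries /series /= big_mkord; apply: eq_bigr => k _.
    by rewrite Re_ cReM /= /A; ring.
  - rewrite (_ : (fun N => _) = pseries B x); first exact: subunit_radius_cvg.
    apply/funext => N; rewrite Im_sum /pseries /series /= big_mkord; apply: eq_bigr => k _.
    by rewrite Re_ cImM /= /B; ring.
have DE x : `|x| < 1 -> ccvg \oo (D x) (f' x).
  move=> x1; split => /=.
  - rewrite (_ : (fun N => _) = pseries (pseries_diffs A) x).
      by apply: subunit_radius_cvg => //; exact: subunit_radius_diffs.
    apply/funext => N; rewrite Re_sum /pseries /series /= big_mkord; apply: eq_bigr => k _.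
    rewrite Re_ !(cReM, cImM) /= /pseries_diffs /A -natr1 (mulrDl _ _ phi) mul1r cosD; ring.
  - rewrite (_ : (fun N => _) = pseries (pseries_diffs B) x).
      by apply: subunit_radius_cvg => //; exact: subunit_radius_diffs.
    apply/funext => N; rewrite Im_sum /pseries /series /= big_mkord; apply: eq_bigr => k _.
    rewrite Re_ !(cReM, cImM) /= /pseries_diffs /B -natr1 (mulrDl _ _ phi) mul1r sinD; ring.
have fd x : `|x| < 1 -> cder f x (f' x).
  by move=> x1; split; apply: subunit_radius_deriv.
(* The recursion of the coefficients gives the differential equation exactly for partial sums, up to
   a shift of [N] and without remainder. *)
have rec x N : D x N.+1 = - b%:C * expi phi * S x N.+1 + x%:C * expi phi * D x N.
  rewrite /D /S !mulr_sumr.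
  have -> : \sum_(i < N) x%:C * expi phi * ((i.+1%:R * bcoef b i.+1)%:C * expi phi * (x%:C * expi phi) ^+ i) =
    \sum_(i < N.+1) (i%:R * bcoef b i)%:C * expi phi * (x%:C * expi phi) ^+ i.
    rewrite big_ord_recl mul0r mul0r mul0r add0r; apply: eq_bigr => i _.
    by rewrite /= /bump leq0n add1n exprS; ring.
  rewrite -big_split; apply: eq_bigr => i _ /=.
  rewrite bcoefS mulNr mulrBl !(rmorphN, rmorphB, rmorphM) /=; ring.
have ode x : `|x| < 1 -> (1 - x%:C * expi phi) * f' x = - b%:C * expi phi * f x.
  move=> x1; have l1 : ccvg \oo (fun N => D x N.+1) (f' x).
    by have [d1 d2] := DE x x1; split; [rewrite -cvg_shiftS in d1|rewrite -cvg_shiftS in d2].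
  have l2 : ccvg \oo (fun N => S x N.+1) (f x).
    by have [d1 d2] := SE x x1; split; [rewrite -cvg_shiftS in d1|rewrite -cvg_shiftS in d2].
  have l3 := ccvgD (ccvgM (ccvg_cst (- b%:C * expi phi)) l2) (ccvgM (ccvg_cst (x%:C * expi phi)) (DE x x1)).
  have l4 : ccvg \oo (fun N => D x N.+1) (- b%:C * expi phi * f x + x%:C * expi phi * f' x).
    by under eq_fun do rewrite rec; exact: l3.
  by rewrite mulrBl mul1r {1}(ccvg_unique l1 l4) addrK.
have sl x : 0 <= x < 1 -> slit (1 - x%:C * expi phi).
  move=> /andP[x0 x1]; apply: slit_Re; rewrite cReD cReN cReM /= mul0r subr0 subr_gt0.
  by apply: (le_lt_trans _ x1); rewrite -[leRHS]mulr1 ler_wpM2l.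
(* By the differential equation the product with the inverse power has derivative 0, hence keeps the
   value 1 that it has at 0. *)
pose G x := f x * ppow (- b) (1 - x%:C * expi phi).
have G0 x : 0 <= x < 1 -> cder G x 0.
  move=> x01; have x1 : `|x| < 1 by move: x01 => /andP[? ?]; rewrite ger0_norm.
  have cx : cder (fun t => 1 - t%:C * expi phi) x (- expi phi).
    have := cderD (cder_cst 1 x) (cderM (cderM (cder_cst (-1) x) (cder_real (is_derive_id x 1))) (cder_cst (expi phi) x)).
    rewrite mul0r mulr0 !add0r addr0 mulN1r rmorph1 mulN1r => h.
    by rewrite (_ : (fun t => _) = (fun t => 1 + -1 * t%:C * expi phi))//; apply/funext => t; rewrite mulN1r mulNr.
  have := cderM (fd x x1) (cder_ppow (- b) (sl x x01) cx).
  set P := ppow _ _; set z := 1 - x%:C * expi phi => h.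
  have z0 : z != 0 by rewrite -cn_gt0; apply: slit_cn; exact: sl.
  rewrite (_ : 0 = f' x * P + f x * ((- b)%:C * - expi phi / z * P))//.
  have -> : f' x = (- b%:C * expi phi * f x) / z by rewrite -(ode x x1) mulrC mulKf.
  by rewrite rmorphN /=; ring.
have Gr : G r = G 0.
  by apply: (cder0_cst r0) => x x0 xr; apply: G0; rewrite x0 (le_lt_trans xr).
have f0 : f 0 = 1.
  apply: (ccvg_unique (SE 0 _)); first by rewrite normr0.
  apply: (@ccvg_eq _ _ _ _ _ (fun=> 1)); last exact: ccvg_cst.
  near=> N; have N0 : (0 < N)%N by near: N; exact: nbhs_infty_gt.
  rewrite /S -(prednK N0) big_ord_recl bcoef0 expr0 mulr1 big1 ?addr0// => i _.
  by rewrite mul0r expr0n /= mulr0.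
have : G r * ppow b (1 - r%:C * expi phi) = ppow b (1 - r%:C * expi phi).
  rewrite Gr /G f0 mul1r mul0r subr0 ppow1 mul1r//.
rewrite /G -mulrA [ppow (- b) _ * _]mulrC ppow_mulN; last by apply: sl; rewrite r0.
by rewrite mulr1 => <-; apply: SE; rewrite ger0_norm.
Unshelve. all: by end_near. Qed.

End binomial_series.

(** * Integration of complex-valued functions *)

Section complex_integral.
Context {R : realType} d (T : measurableType d) (mu : {measure set T -> \bar R}).
Implicit Types (f g : T -> R[i]) (h : T -> R).

Definition cmeas f := measurable_fun setT (fun x => Re (f x)) /\
                      measurable_fun setT (fun x => Im (f x)).

Definition Cint f : R[i] := (\int[mu]_x Re (f x)) +i* (\int[mu]_x Im (f x)).

Definition cintegrable f := mu.-integrable setT (fun x => (Re (f x))%:E) /\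
                            mu.-integrable setT (fun x => (Im (f x))%:E).

Lemma integrable_dom h h' : measurable_fun setT h -> mu.-integrable setT (EFin \o h') ->
  (forall x, `|h x| <= h' x) -> mu.-integrable setT (EFin \o h).
Proof.
move=> mh ih hh; apply: (le_integrable _ _ _ ih) => //; first exact/measurable_EFinP.
by move=> x _ /=; rewrite lee_fin (le_trans (hh x))// ler_norm.
Qed.

Lemma cintegrable_dom f h : cmeas f -> mu.-integrable setT (EFin \o h) ->
  (forall x, cn (f x) <= h x) -> cintegrable f.
Proof.
move=> [m1 m2] ih hh; split.
- by apply: (integrable_dom m1 ih) => x; exact: le_trans (cn_Re _) (hh x).
- by apply: (integrable_dom m2 ih) => x; exact: le_trans (cn_Im _) (hh x).
Qed.

Lemma cmeas_cst c : cmeas (fun=> c).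
Proof. by split; exact: measurable_cst. Qed.

Lemma cmeasD f g : cmeas f -> cmeas g -> cmeas (fun x => f x + g x).
Proof.
move=> [a b] [c e]; split.
- by under eq_fun do rewrite cReD; exact: measurable_funD.
- by under eq_fun do rewrite cImD; exact: measurable_funD.
Qed.

Lemma cmeasM f g : cmeas f -> cmeas g -> cmeas (fun x => f x * g x).
Proof.
move=> [a b] [c e]; split.
- by under eq_fun do rewrite cReM; apply: measurable_funB; exact: measurable_funM.
- by under eq_fun do rewrite cImM; apply: measurable_funD; exact: measurable_funM.
Qed.

Lemma cmeasB f g : cmeas f -> cmeas g -> cmeas (fun x => f x - g x).
Proof.
move=> [a b] [c e]; split.
- by under eq_fun do rewrite cReB; exact: measurable_funB.
- by under eq_fun do rewrite cImB; exact: measurable_funB.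
Qed.

Lemma cmeas_real h : measurable_fun setT h -> cmeas (fun x => (h x)%:C).
Proof. by move=> mh; split => //=; exact: measurable_cst. Qed.

Lemma cmeas_prod (I : Type) (s : seq I) (P : pred I) (F : I -> T -> R[i]) :
  (forall i, P i -> cmeas (F i)) -> cmeas (fun x => \prod_(i <- s | P i) F i x).
Proof.
move=> mF; elim: s => [|i s IH].
  by under eq_fun do rewrite big_nil; exact: cmeas_cst.
under eq_fun do rewrite big_cons.
by case Pi : (P i) => //; apply: cmeasM => //; exact: mF.
Qed.

Lemma cmeas_sum (I : Type) (s : seq I) (P : pred I) (F : I -> T -> R[i]) :
  (forall i, P i -> cmeas (F i)) -> cmeas (fun x => \sum_(i <- s | P i) F i x).
Proof.
move=> mF; elim: s => [|i s IH].
  by under eq_fun do rewrite big_nil; exact: cmeas_cst.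
under eq_fun do rewrite big_cons.
by case Pi : (P i) => //; apply: cmeasD => //; exact: mF.
Qed.

Lemma cmeas_expi h : measurable_fun setT h -> cmeas (fun x => expi (h x)).
Proof.
move=> mh; split => /=; apply: measurableT_comp => //.
- by apply: continuous_measurable_fun; exact: continuous_cos.
- by apply: continuous_measurable_fun; exact: continuous_sin.
Qed.

Lemma cmeas_if (b : T -> bool) f g : measurable_fun setT b -> cmeas f -> cmeas g ->
  cmeas (fun x => if b x then f x else g x).
Proof.
move=> mb [a1 a2] [b1 b2]; split.
- by under eq_fun do rewrite (fun_if (@complex.Re R)); exact: measurable_fun_ifT.
- by under eq_fun do rewrite (fun_if (@complex.Im R)); exact: measurable_fun_ifT.
Qed.

(** Inversion is discontinuous at 0: on each sign it is the measurable power of exponent -1, and at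
    0 the default value is 0. *)
Lemma measurable_invf h : measurable_fun setT h -> measurable_fun setT (fun x => (h x)^-1).
Proof.
move=> mh.
rewrite (_ : (fun x => _) = (fun x => if 0 < h x then h x `^ (-1) else
   if h x < 0 then - ((- h x) `^ (-1)) else 0)); last first.
  apply/funext => x; case: ltgtP => [h0|h0|<-]; last by rewrite invr0.
  - by rewrite powR_inv1 ?ltW.
  - by rewrite powR_inv1 ?oppr_ge0 ?ltW// invrN opprK.
have mp (k : T -> R) : measurable_fun setT k -> measurable_fun setT (fun x => k x `^ (-1)).
  by move=> mk; apply: (measurableT_comp (measurable_powR _)).
apply: measurable_fun_ifT; first exact: measurable_fun_ltr.
- exact: mp.
- apply: measurable_fun_ifT; first exact: measurable_fun_ltr.
  + by apply: measurableT_comp => //; apply: mp; exact: measurableT_comp.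
  + exact: measurable_cst.
Qed.

Lemma measurable_powf b h : measurable_fun setT h -> measurable_fun setT (fun x => h x `^ b).
Proof. by move=> mh; exact: (measurableT_comp (measurable_powR b)). Qed.

Lemma measurable_cn f : cmeas f -> measurable_fun setT (fun x => cn (f x)).
Proof.
move=> [a b]; apply: (@measurableT_comp _ _ _ _ _ _ (@Num.sqrt R)).
  by apply: continuous_measurable_fun; exact: sqrt_continuous.
by apply: measurable_funD; exact: measurable_funX.
Qed.

Lemma cmeas_ppow b f : cmeas f -> cmeas (fun x => ppow b (f x)).
Proof.
move=> mf; have [ma mb] := mf; have mc := measurable_cn mf.
apply: cmeasM; first by apply: cmeas_real; exact: measurable_powf.
apply: cmeas_expi; apply: measurable_funM; first exact: measurable_cst.
apply: measurable_funM; first exact: measurable_cst.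
apply: (@measurableT_comp _ _ _ _ _ _ (@atan R)).
  by apply: continuous_measurable_fun; exact: continuous_atan.
by apply: measurable_funM => //; apply: measurable_invf; exact: measurable_funD.
Qed.

Lemma cintegrableD f g : cintegrable f -> cintegrable g -> cintegrable (fun x => f x + g x).
Proof.
move=> [a b] [c e]; split.
- by under eq_fun do rewrite cReD EFinD; exact: integrableD.
- by under eq_fun do rewrite cImD EFinD; exact: integrableD.
Qed.

Lemma integrable_scale (c : R) h : mu.-integrable setT (EFin \o h) ->
  mu.-integrable setT (fun x => (c * h x)%:E).
Proof. by move=> ih; under eq_fun do rewrite EFinM; exact: integrableZl. Qed.

Lemma cintegrableZ c f : cintegrable f -> cintegrable (fun x => c * f x).
Proof.
move=> [a b]; split.
- by under eq_fun do rewrite cReM EFinB; apply: integrableB => //; exact: integrable_scale.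
- by under eq_fun do rewrite cImM EFinD; apply: integrableD => //; exact: integrable_scale.
Qed.

Lemma CintD f g : cintegrable f -> cintegrable g ->
  Cint (fun x => f x + g x) = Cint f + Cint g.
Proof.
move=> [a b] [c e]; apply: complex_ReIm; rewrite ?cReD ?cImD /=.
- by rewrite -RintegralD//; congr Rintegral; apply/funext => x; rewrite cReD.
- by rewrite -RintegralD//; congr Rintegral; apply/funext => x; rewrite cImD.
Qed.

Lemma CintZ c f : cintegrable f -> Cint (fun x => c * f x) = c * Cint f.
Proof.
move=> [a b]; apply: complex_ReIm; rewrite ?cReM ?cImM /=.
- rewrite -!RintegralZl// -RintegralB//; try exact: integrable_scale.
  by congr Rintegral; apply/funext => x; rewrite cReM.
- rewrite -!RintegralZl// -RintegralD//; try exact: integrable_scale.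
  by congr Rintegral; apply/funext => x; rewrite cImM.
Qed.

Lemma Cint0 : Cint (fun=> 0) = 0.
Proof. by apply: complex_ReIm; rewrite /= /Rintegral integral0. Qed.

Lemma cintegrable0 : cintegrable (fun=> 0).
Proof. by split; exact: integrable0. Qed.

Lemma cintegrable_sum (I : Type) (s : seq I) (P : pred I) (F : I -> T -> R[i]) :
  (forall i, P i -> cintegrable (F i)) -> cintegrable (fun x => \sum_(i <- s | P i) F i x).
Proof.
move=> mF; elim: s => [|i s IH].
  by under eq_fun do rewrite big_nil; exact: cintegrable0.
under eq_fun do rewrite big_cons.
by case Pi : (P i) => //; apply: cintegrableD => //; exact: mF.
Qed.

Lemma Cint_sum (I : Type) (s : seq I) (P : pred I) (F : I -> T -> R[i]) :
  (forall i, P i -> cintegrable (F i)) ->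
  Cint (fun x => \sum_(i <- s | P i) F i x) = \sum_(i <- s | P i) Cint (F i).
Proof.
move=> mF; elim: s => [|i s IH].
  by rewrite big_nil; under eq_fun do rewrite big_nil; exact: Cint0.
rewrite big_cons; under eq_fun do rewrite big_cons.
case Pi : (P i) => //; rewrite CintD ?IH//; first exact: mF.
exact: cintegrable_sum.
Qed.

Lemma eq_Cint f g : f =1 g -> Cint f = Cint g.
Proof. by move=> /funext ->. Qed.

Lemma ae_eq_Cint f g : cmeas f -> cmeas g -> {ae mu, forall x, f x = g x} -> Cint f = Cint g.
Proof.
move=> [a b] [c e] fg; rewrite /Cint /Rintegral; congr (fine _ +i* fine _).
- apply: ae_eq_integral => //; try exact/measurable_EFinP.
  by apply: filterS fg => x -> _.
- apply: ae_eq_integral => //; try exact/measurable_EFinP.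
  by apply: filterS fg => x -> _.
Qed.

Lemma Rdominated (h_ : nat -> T -> R) (h h' : T -> R) :
  (forall n, measurable_fun setT (h_ n)) -> measurable_fun setT h ->
  {ae mu, forall x, h_ n x @[n --> \oo] --> h x} ->
  mu.-integrable setT (EFin \o h') -> {ae mu, forall x, forall n, `|h_ n x| <= h' x} ->
  \int[mu]_x h_ n x @[n --> \oo] --> \int[mu]_x h x.
Proof.
move=> m1 m2 c i dom.
have [] := @dominated_convergence _ T R mu setT measurableT (fun n => EFin \o h_ n) (EFin \o h) (EFin \o h').
- by move=> n; exact/measurable_EFinP.
- exact/measurable_EFinP.
- by apply: filterS c => x cx _; apply: cvg_EFin => //; apply: nearW.
- exact: i.
- by apply: filterS dom => x h0 n _ /=; rewrite lee_fin.
move=> ih _ cv; apply: fine_cvg; rewrite fineK; first exact: cv.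
exact: integrable_fin_num.
Qed.

Lemma Cdominated (f_ : nat -> T -> R[i]) f h :
  (forall n, cmeas (f_ n)) -> cmeas f ->
  {ae mu, forall x, ccvg \oo (f_ ^~ x) (f x)} ->
  mu.-integrable setT (EFin \o h) -> {ae mu, forall x, forall n, cn (f_ n x) <= h x} ->
  ccvg \oo (fun n => Cint (f_ n)) (Cint f).
Proof.
move=> m1 [m2 m3] c i dom; split => /=.
- apply: (@Rdominated (fun n x => Re (f_ n x)) _ h) => //.
  + by move=> n; have [] := m1 n.
  + by apply: filterS c => x [].
  + by apply: filterS dom => x h0 n; exact: le_trans (cn_Re _) (h0 n).
- apply: (@Rdominated (fun n x => Im (f_ n x)) _ h) => //.
  + by move=> n; have [] := m1 n.
  + by apply: filterS c => x [].
  + by apply: filterS dom => x h0 n; exact: le_trans (cn_Im _) (h0 n).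
Qed.

End complex_integral.

(** * Fubini for complex-valued functions *)

Section complex_fubini.
Context {R : realType} d1 d2 (T1 : measurableType d1) (T2 : measurableType d2).
Variables (m1 : probability T1 R) (m2 : probability T2 R).

(** The inner real integral is [fine] of an extended one that is finite only almost everywhere; the
    two agree outside a null set, which suffices for the outer integral. *)
Lemma Rfubini (f : T1 * T2 -> R) : (m1 \x m2)%E.-integrable setT (EFin \o f) ->
  \int[m1]_x \int[m2]_y f (x, y) = \int[(m1 \x m2)%E]_z f z.
Proof.
move=> fi; rewrite /Rintegral; congr fine.
rewrite -(integral12_prod_meas1 fi); apply: ae_eq_integral => //.
- apply/measurable_EFinP; apply: (@measurableT_comp _ _ _ _ _ _ (@fine R)) => //.
  exact: (measurable_fubini_F fi).
- exact: (measurable_fubini_F fi).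
have := integrable_ae measurableT (integrable_fubini_F fi).
by apply: filterS => x h _; rewrite fineK//; exact: h.
Qed.

Lemma Rfubini2 (f : T1 * T2 -> R) : (m1 \x m2)%E.-integrable setT (EFin \o f) ->
  \int[m2]_y \int[m1]_x f (x, y) = \int[(m1 \x m2)%E]_z f z.
Proof.
move=> fi; rewrite /Rintegral; congr fine.
rewrite -(integral21_prod_meas1 fi); apply: ae_eq_integral => //.
- apply/measurable_EFinP; apply: (@measurableT_comp _ _ _ _ _ _ (@fine R)) => //.
  exact: (measurable_fubini_G fi).
- exact: (measurable_fubini_G fi).
have := ae_integrable2 fi.
by apply: filterS => x h _; rewrite fineK//; exact: integrable_fin_num.
Qed.

Lemma Cfubini (f : T1 * T2 -> R[i]) : cintegrable (m1 \x m2)%E f ->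
  Cint m1 (fun x => Cint m2 (fun y => f (x, y))) = Cint (m1 \x m2)%E f.
Proof.
move=> [a b]; rewrite /Cint; congr (_ +i* _) => /=.
- by rewrite -(Rfubini a).
- by rewrite -(Rfubini b).
Qed.

Lemma Cfubini_swap (f : T1 * T2 -> R[i]) : cintegrable (m1 \x m2)%E f ->
  Cint m1 (fun x => Cint m2 (fun y => f (x, y))) =
  Cint m2 (fun y => Cint m1 (fun x => f (x, y))).
Proof.
move=> fi; rewrite (Cfubini fi); have [a b] := fi; rewrite /Cint; congr (_ +i* _) => /=.
- by rewrite -(Rfubini2 a).
- by rewrite -(Rfubini2 b).
Qed.

End complex_fubini.

(** * Independent uniform coordinates on an abstract probability space *)

Section cube.
Context {R : realType}.
Local Open Scope ereal_scope.
Implicit Types (F G : (nat -> R) -> \bar R) (z : nat -> R) (s : seq nat).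

Definition unif : probability (measurableTypeR R) R := uniform_prob (@ltr01 R).
Arguments unif : simpl never.

#[global] Instance unif_ae_filter : Filter (nbhs (almost_everywhere unif)).
Proof. exact: (ae_filter_ringOfSetsType unif). Qed.

Definition upd z (i : nat) (t : R) : nat -> R := fun j => if j == i then t else z j.

Lemma upd_same z i t : upd z i t i = t. Proof. by rewrite /upd eqxx. Qed.

Lemma upd_neq z i t j : j != i -> upd z i t j = z j.
Proof. by rewrite /upd => /negbTE ->. Qed.

Lemma upd_upd z i t u : upd (upd z i t) i u = upd z i u.
Proof. by apply/funext => j; rewrite /upd; case: eqP. Qed.

Lemma upd_comm z i j t u : i != j -> upd (upd z i t) j u = upd (upd z j u) i t.
Proof.
move=> ij; apply/funext => k; rewrite /upd.
by case: eqP => // ->; case: eqP => // e; rewrite e eqxx in ij.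
Qed.

(* Measurability tested along all coordinatewise measurable maps: this avoids
   choosing a sigma-algebra on nat -> R. *)
Definition ymeas {d'} {V : sigmaRingType d'} (F : (nat -> R) -> V) :=
  forall (d : measure_display) (T : measurableType d) (g : T -> nat -> R),
    (forall i, measurable_fun setT (fun y => g y i)) ->
    measurable_fun setT (fun y => F (g y)).

Lemma measurable_upd d (T : measurableType d) (g : T -> nat -> R) i :
  (forall j, measurable_fun setT (fun y => g y j)) ->
  forall j, measurable_fun setT (fun p : T * (measurableTypeR R) => upd (g p.1) i p.2 j).
Proof.
move=> mg j; rewrite /upd; case: (j == i); first exact: measurable_snd.
by apply: (measurableT_comp (mg j)); exact: measurable_fst.
Qed.

Lemma measurable_upd1 z i j : measurable_fun setT (fun t : measurableTypeR R => upd z i t j).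
Proof. by rewrite /upd; case: (j == i); [exact: measurable_id|exact: measurable_cst]. Qed.

(** Iterated integral over the coordinates listed in [s], the others being frozen at [z]. Keeping
    the order as a list makes Tonelli a statement about permuted lists. *)
Fixpoint II s F z : \bar R :=
  if s is i :: s' then \int[unif]_t II s' F (upd z i t) else F z.

Lemma II_ge0 s F z : (forall z, 0 <= F z) -> 0 <= II s F z.
Proof.
by move=> F0; elim: s z => [|i s IH] z //=; apply: integral_ge0 => t _; exact: IH.
Qed.

Lemma II_meas s F : (forall z, 0 <= F z) -> ymeas F -> ymeas (II s F).
Proof.
move=> F0 mF; elim: s => [//|i s IH] d T g mg /=.
apply: (@measurable_fun_fubini_tonelli_F _ _ T _ R unif (fun p => II s F (upd (g p.1) i p.2))).
- by apply: IH; exact: measurable_upd.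
- by move=> p; exact: II_ge0.
Qed.

Lemma II_cat s1 s2 F z : II (s1 ++ s2) F z = II s1 (II s2 F) z.
Proof.
elim: s1 z => //= i s1 IH z; apply: eq_integral => t _; exact: IH.
Qed.

Lemma eq_II s F G z : F =1 G -> II s F z = II s G z.
Proof. by move=> /funext ->. Qed.

Lemma II_swap i j s F z : (forall z, 0 <= F z) -> ymeas F ->
  II (i :: j :: s) F z = II (j :: i :: s) F z.
Proof.
move=> F0 mF; have [->//|ij] := eqVneq i j; rewrite /=.
rewrite (@fubini_tonelli _ _ _ _ _ unif unif (fun p => II s F (upd (upd z i p.1) j p.2))).
- apply: eq_integral => u _; apply: eq_integral => t _; by rewrite upd_comm.
- apply: (@II_meas s F F0 mF _ _ (fun p : measurableTypeR R * measurableTypeR R => upd (upd z i p.1) j p.2)) => k; rewrite /upd; case: (k == j); first exact: measurable_snd.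
  by case: (k == i); [exact: measurable_fst|exact: measurable_cst].
- by move=> p; exact: II_ge0.
Qed.

Lemma II_move i s1 s2 F z : (forall z, 0 <= F z) -> ymeas F ->
  II (i :: s1 ++ s2) F z = II (s1 ++ i :: s2) F z.
Proof.
move=> F0 mF; elim: s1 z => [//|j s1 IH] z.
rewrite cat_cons II_swap// [RHS]/=.
by rewrite [LHS]/=; apply: eq_integral => t _; rewrite -IH.
Qed.

Lemma II_catCA s1 s2 s3 F z : (forall z, 0 <= F z) -> ymeas F ->
  II (s1 ++ s2 ++ s3) F z = II (s2 ++ s1 ++ s3) F z.
Proof.
move=> F0 mF; elim: s1 z => [//|j s1 IH] z.
rewrite cat_cons -II_move// /=; apply: eq_integral => t _; exact: IH.
Qed.

(** Permutations of a list are generated by exchanges of adjacent blocks, and Tonelli permits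
    these. *)
Lemma II_perm s1 s2 F z : (forall z, 0 <= F z) -> ymeas F -> perm_eq s1 s2 ->
  II s1 F z = II s2 F z.
Proof.
move=> F0 mF s12.
apply: (@catCA_perm_ind _ (fun s => II s1 F z = II s F z) _ _ _ s12) => // a b c ->.
exact: II_catCA.
Qed.

Lemma integral_unif_cst (c : \bar R) : \int[unif]_t c = c.
Proof.
rewrite -[LHS]/(\int[unif]_t (cst c t)) integral_cst//.
by rewrite [X in _ * X](probability_setT unif) mule1.
Qed.

(** Once [i] is the innermost coordinate, the resampled integrand no longer depends on it, and a
    constant integrated against a probability is unchanged. *)
Lemma II_resample i s F z : (forall z, 0 <= F z) -> ymeas F -> i \in s ->
  II s F z = II s (fun z => \int[unif]_t F (upd z i t)) z.
Proof.
move=> F0 mF si.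
have G0 z' : 0 <= \int[unif]_t F (upd z' i t) by apply: integral_ge0.
have mG : ymeas (fun z => \int[unif]_t F (upd z i t)) by exact: (@II_meas [:: i] F).
have pe : perm_eq s (rem i s ++ [:: i]).
  by rewrite perm_sym cats1 perm_rcons perm_sym; exact: perm_to_rem.
rewrite (II_perm z F0 mF pe) (II_perm z G0 mG pe) !II_cat; apply: eq_II => z' /=.
under [RHS]eq_integral do under eq_integral do rewrite upd_upd.
by rewrite integral_unif_cst.
Qed.

(** [Z] has independent uniform coordinates at the indices in [s] and 0 elsewhere. This is expressed
    only through integrals of nonnegative functions, so no product of [n] spaces has to be named. *)
Definition cube_rep s d (X : measurableType d) (mu : probability X R) (Z : X -> nat -> R) :=
  (forall i, measurable_fun setT (fun y => Z y i)) /\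
  forall F, (forall z, 0 <= F z) -> ymeas F ->
    \int[mu]_y F (Z y) = II s F (fun=> 0%R).

Lemma cube_rep_ex s : exists d (X : measurableType d) (mu : probability X R)
  (Z : X -> nat -> R), cube_rep s mu Z.
Proof.
elim/last_ind: s => [|s i [d [X [mu [Z [mZ ZE]]]]]].
  exists _, _, unif, (fun _ _ => 0%R); split; first by move=> i; exact: measurable_cst.
  by move=> F F0 mF; rewrite integral_unif_cst.
exists _, _, (mu \x unif), (fun p => upd (Z p.1) i p.2); split.
  exact: measurable_upd.
move=> F F0 mF; rewrite (@fubini_tonelli1 _ _ _ _ _ mu unif); first last.
- by move=> p; exact: F0.
- by apply: mF; exact: measurable_upd.
rewrite -cats1 II_cat /= -ZE.
- by [].
- by move=> z; apply: integral_ge0.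
- exact: (@II_meas [:: i] F).
Qed.

Section rep.
Context (s : seq nat) (d : measure_display) (X : measurableType d).
Variables (mu : probability X R) (Z : X -> nat -> R).
Hypothesis rep : cube_rep s mu Z.

Lemma rep_meas i : measurable_fun setT (fun y => Z y i). Proof. by have [] := rep. Qed.

Lemma rep_resample i F : (forall z, 0 <= F z) -> ymeas F -> i \in s ->
  \int[mu]_y F (Z y) = \int[mu]_y \int[unif]_t F (upd (Z y) i t).
Proof.
move=> F0 mF si; have [_ ZE] := rep; rewrite ZE// (II_resample _ F0 mF si) -ZE//.
- by move=> z; apply: integral_ge0.
- exact: (@II_meas [:: i] F).
Qed.

(** Replacing the coordinate [i] by an independent uniform one preserves the law. Integrals over [X]
    thereby become integrals over a product with a one-dimensional factor, where Fubini applies. *)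
Lemma rep_prod i F : (forall z, 0 <= F z) -> ymeas F -> i \in s ->
  \int[mu \x unif]_p F (upd (Z p.1) i p.2) = \int[mu]_y F (Z y).
Proof.
move=> F0 mF si; rewrite (@fubini_tonelli1 _ _ _ _ _ mu unif); first last.
- by move=> p; exact: F0.
- by apply: mF; exact: measurable_upd rep_meas.
by rewrite (rep_resample F0 mF si).
Qed.

Lemma ymeas_EFin (f : (nat -> R) -> R) : ymeas f -> ymeas (fun z => (f z)%:E).
Proof. by move=> mf d' T g mg; apply/measurable_EFinP; exact: mf. Qed.

Lemma rep_integral i (f : (nat -> R) -> R) : ymeas f -> i \in s ->
  \int[mu \x unif]_p (f (upd (Z p.1) i p.2))%:E = \int[mu]_y (f (Z y))%:E.
Proof.
move=> mf si; rewrite integralE [RHS]integralE.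
have mE := ymeas_EFin mf.
have mp : ymeas (fun z => maxe (f z)%:E 0).
  by move=> d' T g mg; apply: measurable_maxe; [exact: mE|exact: measurable_cst].
have mn : ymeas (fun z => maxe (- (f z)%:E) 0).
  move=> d' T g mg; apply: measurable_maxe; last exact: measurable_cst.
  by apply: measurableT_comp => //; exact: mE.
congr (_ - _).
- have p0 z : 0 <= maxe (f z)%:E 0 by rewrite le_max lexx orbT.
  by rewrite funepos.unlock; exact: (rep_prod p0 mp si).
- have p0 z : 0 <= maxe (- (f z)%:E) 0 by rewrite le_max lexx orbT.
  by rewrite funeneg.unlock; exact: (rep_prod p0 mn si).
Qed.

Lemma rep_integrable i (f : (nat -> R) -> R) : ymeas f -> i \in s ->
  mu.-integrable setT (fun y => (f (Z y))%:E) ->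
  (mu \x unif).-integrable setT (fun p => (f (upd (Z p.1) i p.2))%:E).
Proof.
move=> mf si /integrableP[_ h]; apply/integrableP; split.
  by apply: ymeas_EFin => //; exact: measurable_upd rep_meas.
have ma : ymeas (fun z => `|f z|%:E).
  apply: ymeas_EFin => d' T g mg; apply: measurableT_comp => //; exact: mf.
by rewrite (@rep_prod i (fun z => `|f z|%:E)).
Qed.

Definition cymeas (f : (nat -> R) -> R[i]) :=
  ymeas (fun z => Re (f z)) /\ ymeas (fun z => Im (f z)).

Lemma rep_Cint i f : cymeas f -> i \in s -> cintegrable mu (fun y => f (Z y)) ->
  Cint mu (fun y => f (Z y)) = Cint mu (fun y => Cint unif (fun t => f (upd (Z y) i t))).
Proof.
move=> [m1 m2] si [i1 i2].
transitivity (Cint (mu \x unif) (fun p => f (upd (Z p.1) i p.2))); last first.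
  rewrite -(Cfubini (f := fun p : X * measurableTypeR R => f (upd (Z p.1) i p.2)))//.
  by split; [exact: (rep_integrable m1)|exact: (rep_integrable m2)].
rewrite /Cint /Rintegral; congr (fine _ +i* fine _).
- by rewrite (rep_integral m1 si).
- by rewrite (rep_integral m2 si).
Qed.

(** The indicator of the exceptional set has integral 0 along every line in direction [i], hence
    integral 0 by resampling. *)
Lemma rep_ae i (P : (nat -> R) -> bool) : ymeas P -> i \in s ->
  (forall z, {ae unif, forall t, P (upd z i t)}) ->
  {ae mu, forall y, P (Z y)}.
Proof.
move=> mP si aeP.
pose F z : \bar R := if P z then 0 else 1.
have F0 z : 0 <= F z by rewrite /F; case: ifP.
have mF : ymeas F.
  by move=> d' T g mg; apply: measurable_fun_ifT => //; exact: mP.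
have I0 : \int[mu]_y `|F (Z y)| = 0.
  under eq_integral do rewrite gee0_abs//.
  rewrite (rep_resample F0 mF si); apply: integral0_eq => y _.
  transitivity (\int[unif]_t (cst 0 t)); last by rewrite integral_cst ?mul0e.
  apply: ae_eq_integral => //.
  - by apply: mF => j; exact: measurable_upd1.
  - apply: filterS (aeP (Z y)) => t h _; by rewrite /F h.
have := (ae_eq_integral_abs mu measurableT (mF _ _ _ rep_meas)).1 I0.
apply: filterS => y; rewrite /F; case: (P (Z y)) => // /(_ I) /= /eqP.
by rewrite eqe oner_eq0.
Qed.

End rep.

End cube.

(** * The uniform law on the unit interval and a Green formula *)

Section unit_interval.
Context {R : realType}.
Implicit Types (h : R -> R) (f : R -> R[i]).
Local Notation unif := (@unif R).

Lemma unif_integral (h : R -> \bar R) : measurable_fun setT h ->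
  (\int[unif]_t h t = \int[lebesgue_measure]_(t in `[0%R, 1%R]) h t)%E.
Proof.
move=> mh.
have E (k : R -> \bar R) : measurable_fun setT k -> (forall x, 0 <= k x)%E ->
  (\int[unif]_t k t = \int[lebesgue_measure]_(t in `[0%R, 1%R]) k t)%E.
  by move=> mk k0; rewrite integral_uniform// subr0 invr1 mul1e.
rewrite integralE [RHS]integralE; congr (_ - _)%E.
- by apply: E => //; exact: measurable_funepos.
- by apply: E => //; exact: measurable_funeneg.
Qed.

Lemma unif_Rintegral h : measurable_fun setT h ->
  \int[unif]_t h t = \int[lebesgue_measure]_(t in `[0%R, 1%R]) h t.
Proof. by move=> mh; rewrite /Rintegral unif_integral//; exact/measurable_EFinP. Qed.

Lemma unif_measure (A : set (measurableTypeR R)) : measurable A ->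
  unif A = lebesgue_measure (A `&` `[0, 1]).
Proof.
move=> mA; rewrite -[A in LHS]setIT -integral_indic// unif_integral ?integral_indic//.
by apply/measurable_EFinP; exact: measurable_indic.
Qed.

Lemma unif_ae0 (c : R) : {ae unif, forall t, t != c}.
Proof.
have m : measurable ([set c] : set (measurableTypeR R)) by exact: measurable_set1.
exists [set c]; split => //; last by move=> t /= /negP; rewrite negbK => /eqP.
rewrite unif_measure//; apply/eqP; rewrite eq_le measure_ge0 andbT.
rewrite -(lebesgue_measure_set1 c); apply: le_measure => //; rewrite ?inE//.
by apply: measurableI => //; exact: measurable_itv.
Qed.

Lemma unif_ae01 : {ae unif, forall t, 0 < t < 1}.
Proof.
have h : {ae unif, forall t, 0 <= t <= 1}.
  have m : measurable (~` `[0, 1]%classic : set (measurableTypeR R)).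
    by apply: measurableC; exact: measurable_itv.
  exists (~` `[0, 1]%classic); split => //.
    by rewrite unif_measure// setICl measure0.
apply: filterS (filterI h (filterI (unif_ae0 0) (unif_ae0 1))) => t [/andP[a b] [c d]].
by rewrite !lt_neqAle a b d eq_sym c.
Qed.

Definition box (c d t : R) : R := ((c <= t) && (t <= d))%:R.

Lemma box_le1 c d t : `|box c d t| <= 1.
Proof. by rewrite /box; case: (_ && _); rewrite ?normr1// normr0. Qed.

Lemma measurable_box c d dd (T : measurableType dd) (g : T -> R) : measurable_fun setT g ->
  measurable_fun setT (fun x => box c d (g x)).
Proof.
move=> mg; rewrite /box.
rewrite (_ : (fun x => _) = (fun x => if (c <= g x) && (g x <= d) then 1 else 0 : R)).
  apply: measurable_fun_ifT => //; apply: measurable_and; exact: measurable_fun_ler.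
by apply/funext => x; case: ifP.
Qed.

Lemma unif_FTC h h' c d : 0 <= c -> c < d -> d <= 1 ->
  (forall t : R, c <= t -> t <= d -> is_derive t 1 h (h' t)) ->
  (forall t : R, c <= t -> t <= d -> {for t, continuous h'}) ->
  measurable_fun setT h' ->
  \int[unif]_t (box c d t * h' t) = h d - h c.
Proof.
move=> c0 cd d1 hd hc mh'.
rewrite unif_Rintegral; last by apply: measurable_funM => //; apply: measurable_box; exact: measurable_id.
rewrite Rintegral_mkcond.
have -> : (fun t => box c d t * h' t) \_ `[0, 1] = h' \_ `[c, d].
  apply/funext => t; rewrite /patch !mem_setE !in_itv /= /box.
  case: (leP c t) => ct /=; rewrite ?mul0r ?if_same//.
  case: (leP t d) => td; rewrite ?mul0r ?if_same//.
  by rewrite mul1r (le_trans c0 ct) (le_trans td d1).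
rewrite -Rintegral_mkcond /Rintegral (@continuous_FTC2 _ _ h)//.
- apply: continuous_in_subspaceT => t; rewrite inE /= in_itv /= => /andP[a b].
  exact: hc.
- split.
  + move=> t; rewrite in_itv /= => /andP[/ltW a /ltW b].
    by have [] := hd t a b.
  + apply: cvg_at_right_filter; apply: differentiable_continuous.
    by apply/derivable1_diffP; have [] := hd c (lexx _) (ltW cd).
  + apply: cvg_at_left_filter; apply: differentiable_continuous.
    by apply/derivable1_diffP; have [] := hd d (ltW cd) (lexx _).
- move=> t; rewrite in_itv /= => /andP[/ltW a /ltW b].
  by rewrite derive1E; have [_ ->] := hd t a b.
Qed.

Lemma unif_CFTC f f' c d : 0 <= c -> c < d -> d <= 1 ->
  (forall t : R, c <= t -> t <= d -> cder f t (f' t)) ->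
  (forall t : R, c <= t -> t <= d -> ccvg (nbhs t) f' (f' t)) ->
  cmeas (f' : measurableTypeR R -> _) ->
  Cint unif (fun t => (box c d t)%:C * f' t) = f d - f c.
Proof.
move=> c0 cd d1 hd hc [m1 m2]; apply: complex_ReIm => /=; rewrite ?cReB ?cImB.
- have h1 (t : R) : c <= t -> t <= d -> is_derive t 1 (fun t => Re (f t)) (Re (f' t)).
    by move=> u v; have [] := hd t u v.
  have h2 (t : R) : c <= t -> t <= d -> {for t, continuous (fun t => Re (f' t))}.
    by move=> u v; have [] := hc t u v.
  have <- := unif_FTC c0 cd d1 h1 h2 m1.
  by congr Rintegral; apply/funext => t; rewrite cReM /= mul0r subr0.
- have h1 (t : R) : c <= t -> t <= d -> is_derive t 1 (fun t => Im (f t)) (Im (f' t)).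
    by move=> u v; have [] := hd t u v.
  have h2 (t : R) : c <= t -> t <= d -> {for t, continuous (fun t => Im (f' t))}.
    by move=> u v; have [] := hc t u v.
  have <- := unif_FTC c0 cd d1 h1 h2 m2.
  by congr Rintegral; apply/funext => t; rewrite cImM /= mul0r addr0.
Qed.

Lemma prob_integrable_cst d (T : measurableType d) (mu : probability T R) (k : R) :
  mu.-integrable setT (EFin \o cst k).
Proof. exact: finite_measure_integrable_cst. Qed.

(** [M] is both the [t]-derivative of [H] and the [x]-derivative of [Q], which says that
    [H dx + Q dt] is closed. Integrating [M] over the rectangle in either order, with the
    fundamental theorem of calculus inside, gives the two sides. This takes the place of Cauchy's
    theorem. *)
Lemma green (H M Q : R -> R -> R[i]) a b c d : 0 <= a -> a < b -> b <= 1 ->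
  0 <= c -> c < d -> d <= 1 ->
  (forall x t : R, a <= x -> x <= b -> c <= t -> t <= d -> cder (H x) t (M x t)) ->
  (forall x t : R, a <= x -> x <= b -> c <= t -> t <= d -> cder (Q^~ t) x (M x t)) ->
  (forall x t : R, a <= x -> x <= b -> c <= t -> t <= d -> ccvg (nbhs t) (M x) (M x t)) ->
  (forall x t : R, a <= x -> x <= b -> c <= t -> t <= d -> ccvg (nbhs x) (M^~ t) (M x t)) ->
  cmeas (fun p : measurableTypeR R * measurableTypeR R => M p.1 p.2) ->
  (exists C, forall x t : R, a <= x -> x <= b -> c <= t -> t <= d -> cn (M x t) <= C) ->
  Cint unif (fun x => (box a b x)%:C * (H x d - H x c)) =
  Cint unif (fun t => (box c d t)%:C * (Q b t - Q a t)).
Proof.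
move=> a0 ab b1 c0 cd d1 dH dQ cMt cMx mM [C bM].
have px (t : R) : measurable_fun setT (fun x : measurableTypeR R => (x, t) : measurableTypeR R * measurableTypeR R).
  by apply: measurable_fun_pair.
have pt (x : R) : measurable_fun setT (fun t : measurableTypeR R => (x, t) : measurableTypeR R * measurableTypeR R).
  by apply: measurable_fun_pair.
have mx t : cmeas (fun x : measurableTypeR R => M x t).
  by have [m1 m2] := mM; split; [exact: (measurableT_comp m1 (px t))|exact: (measurableT_comp m2 (px t))].
have mt x : cmeas (fun t : measurableTypeR R => M x t).
  by have [m1 m2] := mM; split; [exact: (measurableT_comp m1 (pt x))|exact: (measurableT_comp m2 (pt x))].
pose f (p : measurableTypeR R * measurableTypeR R) :=
  (box a b p.1)%:C * ((box c d p.2)%:C * M p.1 p.2).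
have fi : cintegrable (unif \x unif)%E f.
  apply: (@cintegrable_dom _ _ _ _ _ (cst (Num.max C 0))).
  - apply: cmeasM; first by apply: cmeas_real; apply: measurable_box; exact: measurable_fst.
    by apply: cmeasM => //; apply: cmeas_real; apply: measurable_box; exact: measurable_snd.
  - exact: (prob_integrable_cst (unif \x unif)%E).
  move=> [x t]; rewrite /f /= !cnM !cn_real /box.
  case: (boolP ((a <= x) && (x <= b))) => [/andP[? ?]|_]; last first.
    by rewrite normr0 mul0r le_max lexx orbT.
  case: (boolP ((c <= t) && (t <= d))) => [/andP[? ?]|_]; last first.
    by rewrite normr0 mul0r mulr0 le_max lexx orbT.
  by rewrite !normr1 !mul1r le_max bM.
have := Cfubini_swap fi.
have -> : Cint unif (fun x => Cint unif (fun y => f (x, y))) =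
   Cint unif (fun x => (box a b x)%:C * (H x d - H x c)).
  apply: eq_Cint => x; rewrite /f /= /box.
  case: (boolP ((a <= x) && (x <= b))) => [/andP[? ?]|_]; last first.
    by rewrite mul0r -[RHS](Cint0 unif); apply: eq_Cint => t; rewrite mul0r.
  rewrite mul1r -(@unif_CFTC (H x) (M x) c d)//.
  - by apply: eq_Cint => t; rewrite mul1r.
  - by move=> t ? ?; apply: dH.
  - by move=> t ? ?; apply: cMt.
move=> ->; apply: eq_Cint => t; rewrite /f /= /box.
case: (boolP ((c <= t) && (t <= d))) => [/andP[? ?]|_]; last first.
  by rewrite mul0r -[RHS](Cint0 unif); apply: eq_Cint => x; rewrite mul0r mulr0.
rewrite mul1r -(@unif_CFTC (Q^~ t) (M^~ t) a b)//.
- by apply: eq_Cint => x; rewrite mul1r.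
- by move=> x ? ?; apply: dQ.
- by move=> x ? ?; apply: cMx.
Qed.

End unit_interval.

(** * Estimates for powers and boundary values at the cut *)

Section powers.
Context {R : realType}.
Implicit Types (b r x y : R).

Lemma powR_antitone b x y : 0 < x -> x <= y -> b <= 0 -> y `^ b <= x `^ b.
Proof.
move=> x0 xy b0; have y0 := lt_le_trans x0 xy.
rewrite -[b]opprK !(powRN _ (- b)) lef_pV2 ?posrE ?powR_gt0//.
by apply: ge0_ler_powR; rewrite ?oppr_ge0// nnegrE ltW.
Qed.

(** Adding the values at both ends covers both signs of [b]; factors whose base stays away from 0
    and infinity are bounded in this way throughout. *)
Lemma powR_between b m x y : 0 < m -> m <= x -> x <= y -> x `^ b <= m `^ b + y `^ b.
Proof.
move=> m0 mx xy; have [b0|b0] := leP 0 b.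
- apply: (@le_trans _ _ (y `^ b)); last by rewrite lerDr powR_ge0.
  by apply: ge0_ler_powR => //; rewrite nnegrE (le_trans (ltW m0))// (le_trans mx).
- apply: (@le_trans _ _ (m `^ b)); last by rewrite lerDl powR_ge0.
  by apply: powR_antitone => //; exact: ltW.
Qed.

Lemma powR_sumr (I : Type) (s : seq I) (P : pred I) (f : I -> R) x : 0 < x ->
  x `^ (\sum_(i <- s | P i) f i) = \prod_(i <- s | P i) x `^ f i.
Proof.
move=> x0; elim/big_rec2 : _ => [|i u v _ <-]; first by rewrite powRr0.
by rewrite powRD// (gt_eqF x0) implybT.
Qed.

Lemma cn_1Bexpi r psi : cn (1 - r%:C * expi psi) ^+ 2 = 1 - 2 * r * cos psi + r ^+ 2.
Proof.
rewrite cn_sqr cReB cImB cReM cImM /=.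
rewrite (_ : r ^+ 2 = r ^+ 2 * (cos psi ^+ 2 + sin psi ^+ 2)); last by rewrite cos2Dsin2 mulr1.
ring.
Qed.

Lemma cn_1Bexpi_ge r psi : 0 <= r -> `|1 - r| <= cn (1 - r%:C * expi psi).
Proof.
move=> r0; rewrite -ler_sqr ?nnegrE ?cn_ge0// cn_1Bexpi real_normK ?num_real//.
have : r * cos psi <= r * 1 by rewrite ler_wpM2l// cos_le1.
by rewrite sqrrB; lra.
Qed.

Lemma cn_1Bexpi_le r psi : 0 <= r -> cn (1 - r%:C * expi psi) <= 1 + r.
Proof.
by move=> r0; apply: le_trans (cnD _ _) _; rewrite cnN cn1 cnM cn_expi mulr1 cn_real ger0_norm.
Qed.

(** The squared distance is at least [1 - 2 r C + r ^ 2], whose minimum over [r], attained at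
    [r = C], is [1 - C ^ 2]. *)
Lemma cn_1Bexpi_sin r psi C s : 0 <= r -> cos psi <= C -> C ^+ 2 + s ^+ 2 = 1 -> 0 <= s ->
  s <= cn (1 - r%:C * expi psi).
Proof.
move=> r0 pC CS s0; rewrite -ler_sqr ?nnegrE ?cn_ge0// cn_1Bexpi.
have : r * cos psi <= r * C by rewrite ler_wpM2l.
have : 0 <= (r - C) ^+ 2 by exact: sqr_ge0.
have -> : s ^+ 2 = 1 - C ^+ 2 by rewrite -CS addrAC subrr add0r.
by rewrite sqrrB; lra.
Qed.

Lemma slit_1Bexpi r psi : 0 <= r -> cos psi != 1 -> slit (1 - r%:C * expi psi).
Proof.
move=> r0 c1; have [r00|rn0] := eqVneq r 0.
  by rewrite r00 mul0r subr0; apply: slit_Re => /=; exact: ltr01.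
have [s0|s0] := eqVneq (sin psi) 0; last first.
  by apply: slit_Im; rewrite cImB cImM /= mul0r addr0 sub0r oppr_eq0 mulf_neq0.
apply: slit_Re; rewrite cReB cReM /= mul0r subr0.
have : cos psi ^+ 2 == 1 by rewrite -(cos2Dsin2 psi) s0 expr0n addr0.
by rewrite sqrf_eq1 (negbTE c1) /= => /eqP ->; lra.
Qed.

(** Cosine decreases on [[0, pi]], and [t] may be replaced by [1 - t]. *)
Lemma cos2pi_le (e t : R) : 0 < e -> e < 2^-1 -> e <= t -> t <= 1 - e ->
  cos (2 * pi * t) <= cos (2 * pi * e).
Proof.
move=> e0 e1 et t1.
have p0 : 0 < pi :> R := pi_gt0 R.
have main (u : R) : e <= u -> u <= 2^-1 -> cos (2 * pi * u) <= cos (2 * pi * e).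
  move=> eu u2.
  have b1 : 2 * pi * e <= 2 * pi * u by rewrite ler_wpM2l// mulr_ge0// ltW.
  have b2 : 2 * pi * u <= pi.
    by rewrite (le_trans (_ : _ <= 2 * pi * 2^-1)) ?ler_wpM2l ?mulr_ge0 ?(ltW p0)//; lra.
  have b3 : 0 <= 2 * pi * e by rewrite !mulr_ge0 ?ltW.
  by rewrite leNgt ltr_cos ?in_itv /=; lra.
have [t2|t2] := leP t 2^-1; first exact: main.
have -> : 2 * pi * t = - (2 * pi * (1 - t)) + pi *+ 2 by rewrite -mulr_natl; ring.
by rewrite cosD2pi cosN; apply: main; lra.
Qed.

Lemma sin2pi_gt0 (e : R) : 0 < e -> e < 2^-1 -> 0 < sin (2 * pi * e).
Proof.
move=> e0 e1; have p0 : 0 < pi :> R := pi_gt0 R.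
apply: sin_gt0_pi; apply/andP; split; first by rewrite !mulr_gt0.
by rewrite (lt_le_trans (_ : _ < 2 * pi * 2^-1)) ?ltr_pM2l ?mulr_gt0//; lra.
Qed.

Lemma cos2pi_neq1 (t : R) : 0 < t -> t < 1 -> cos (2 * pi * t) != 1.
Proof.
move=> t0 t1.
have h : sin (pi * t) != 0.
  rewrite gt_eqF// sin_gt0_pi// mulr_gt0 ?pi_gt0//=.
  by rewrite -[ltRHS]mulr1 ltr_pM2l ?pi_gt0.
have -> : 2 * pi * t = (pi * t) *+ 2 by rewrite -mulr_natl; ring.
rewrite cos_mulr2n cos2sin2; apply/eqP => e.
have : sin (pi * t) ^+ 2 = 0 by move: e; rewrite mulr2n; lra.
by move=> /eqP; rewrite sqrf_eq0 (negbTE h).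
Qed.

Section boundary_value.
Context {T : Type} {F : set_system T} {FF : ProperFilter F}.

(** The argument is [2 atan u] with [u = Im / (cn + Re)]. The identity
    [(cn + Re) (cn - Re) = Im ^ 2] makes [u] the inverse of [Im / (cn - Re)], which tends to 0 from
    above; hence [u] tends to [+oo]. *)
Lemma cvg_carg_above (f : T -> R[i]) (z : R[i]) : Re z < 0 -> Im z = 0 -> ccvg F f z ->
  (\forall t \near F, 0 < Im (f t)) -> carg (f t) @[t --> F] --> pi.
Proof.
move=> z0 z1 fz fpos.
have -> : pi = 2 * (pi / 2) :> R by rewrite mulrC divfK.
apply: cvgM; first exact: cvg_cst.
have lim : Im (f t) / (cn (f t) + Re (f t)) @[t --> F] --> +oo.
  have e : \forall t \near F, (Im (f t) / (cn (f t) - Re (f t)))^-1 = Im (f t) / (cn (f t) + Re (f t)).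
    near=> t.
    have i0 : 0 < Im (f t) by near: t.
    have s0 : slit (f t) by apply: slit_Im; rewrite gt_eqF.
    have E := cn_sqr (f t).
    have E2 : (cn (f t) + Re (f t)) * (cn (f t) - Re (f t)) = Im (f t) ^+ 2.
      by rewrite mulrC -subr_sqr E addrAC subrr add0r.
    have s1 : cn (f t) + Re (f t) != 0 by rewrite gt_eqF.
    have i1 : Im (f t) != 0 by rewrite gt_eqF.
    rewrite invf_div; apply/eqP; rewrite eqr_div//.
    by rewrite mulrC E2 expr2.
  apply: cvg_trans (near_eq_cvg e) _.
  apply/gtr0_cvgV0.
    near=> t; rewrite invr_gt0 divr_gt0//; first by near: t.
    have i0 : 0 < Im (f t) by near: t.
    have : slit (f t) by apply: slit_Im; rewrite gt_eqF.
    have E2 : (cn (f t) + Re (f t)) * (cn (f t) - Re (f t)) = Im (f t) ^+ 2.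
      by rewrite mulrC -subr_sqr cn_sqr addrAC subrr add0r.
    rewrite /slit => h; rewrite -(pmulr_rgt0 _ h) E2.
    by rewrite exprn_gt0.
  have [c1 c2] := fz; rewrite /unstable.inv_fun; under eq_fun do rewrite invrK.
  rewrite (_ : 0 = Im z / (cn z - Re z)); last by rewrite z1 mul0r.
  apply: cvgM => //; apply: cvgV; last by apply: cvgB => //; exact: ccvg_cn.
  by rewrite gt_eqF// subr_gt0 (lt_le_trans z0)// cn_ge0.
exact: (cvg_comp _ _ lim (@cvgy_atan R)).
Unshelve. all: by end_near. Qed.

Lemma ccvg_ppow_above b (f : T -> R[i]) (z : R[i]) : Re z < 0 -> Im z = 0 -> ccvg F f z ->
  (\forall t \near F, 0 < Im (f t)) ->
  ccvg F (fun t => ppow b (f t)) ((`|Re z| `^ b)%:C * expi (b * pi)).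
Proof.
move=> z0 z1 fz fpos; apply: ccvgM; last first.
  by apply: ccvg_expi; apply: cvgM; [exact: cvg_cst|exact: (cvg_carg_above z0 z1)].
apply: ccvg_real.
have cz : 0 < `|Re z| by rewrite normr_gt0 lt_eqF.
have [/derivable1_diffP/differentiable_continuous h _] := is_derive1_powR b cz.
have e : cn z = `|Re z| by rewrite /cn z1 expr0n addr0 sqrtr_sqr.
by rewrite -e in h *; exact: (cvg_comp _ _ (ccvg_cn fz) h).
Qed.

(** Complex conjugation reduces this to the approach from above. *)
Lemma ccvg_ppow_below b (f : T -> R[i]) (z : R[i]) : Re z < 0 -> Im z = 0 -> ccvg F f z ->
  (\forall t \near F, Im (f t) < 0) ->
  ccvg F (fun t => ppow b (f t)) ((`|Re z| `^ b)%:C * expi (- (b * pi))).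
Proof.
move=> z0 z1 fz fneg.
pose g t := Re (f t) +i* - Im (f t).
have gz : ccvg F g z.
  have [c1 c2] := fz; split => //=; rewrite z1 -oppr0 -z1; exact: cvgN.
have gpos : \forall t \near F, 0 < Im (g t).
  by apply: filterS fneg => t; rewrite /= oppr_gt0.
have [h1 h2] := ccvg_ppow_above b z0 z1 gz gpos.
have cg t : cn (g t) = cn (f t) by rewrite /cn /= sqrrN.
have ag t : carg (g t) = - carg (f t) by rewrite /carg cg /= mulNr atanN mulrN.
split.
- rewrite (_ : (fun t => Re (ppow b (f t))) = (fun t => Re (ppow b (g t)))).
    have -> : Re ((`|Re z| `^ b)%:C * expi (- (b * pi))) = Re ((`|Re z| `^ b)%:C * expi (b * pi)).
      by rewrite !cReM /= cosN !mul0r.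
    exact: h1.
  by apply/funext => t; rewrite !cReM /= !mul0r cg ag mulrN cosN.
- rewrite (_ : (fun t => Im (ppow b (f t))) = (fun t => - Im (ppow b (g t)))).
    have -> : Im ((`|Re z| `^ b)%:C * expi (- (b * pi))) = - Im ((`|Re z| `^ b)%:C * expi (b * pi)).
      by rewrite !cImM /= sinN !mul0r !addr0 mulrN.
    exact: cvgN.
  by apply/funext => t; rewrite !cImM /= !mul0r !addr0 cg ag mulrN sinN mulrN opprK.
Qed.

End boundary_value.

Lemma finite_lower_bound (I : eqType) (s : seq I) (f : I -> R) :
  (forall i, i \in s -> 0 < f i) -> exists2 d, 0 < d & forall i, i \in s -> d <= f i.
Proof.
elim: s => [|i s IH] h; first by exists 1.
have [|d d0 hd] := IH; first by move=> j js; apply: h; rewrite inE js orbT.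
exists (Num.min d (f i)); first by rewrite lt_min d0 h// inE eqxx.
move=> j; rewrite inE => /orP[/eqP ->|js]; first by rewrite ge_min lexx orbT.
by rewrite ge_min hd.
Qed.

Lemma cder_logprod (I : Type) (s : seq I) (P : pred I) (f : I -> R -> R[i]) (l : I -> R[i]) x :
  (forall i, P i -> cder (f i) x (l i * f i x)) ->
  cder (fun t => \prod_(i <- s | P i) f i t) x
    ((\sum_(i <- s | P i) l i) * \prod_(i <- s | P i) f i x).
Proof.
move=> h; elim: s => [|i s IH].
  under eq_fun do rewrite big_nil; rewrite !big_nil mul0r; exact: cder_cst.
under eq_fun do rewrite big_cons; rewrite !big_cons.
case Pi : (P i) => //; have := cderM (h i Pi) IH.
by congr cder; ring.
Qed.

End powers.

(** * The keyhole contour for one variable *)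

Section keyhole.
Context {R : realType} (I : finType) (Pin Pout : pred I).
(** Inside the circle of radius [rho] the branch points are 0, with exponent [a], and the [p l],
    with exponents [b l]. Outside they have modulus [(c o)^-1], angle [phi o] and exponent [b' o],
    with no such point if [c o = 0]. *)
Variables (p b c phi b' : I -> R) (a rho : R).
Hypothesis rho0 : 0 < rho.
Hypothesis rho1 : rho <= 1.
Hypothesis a1 : -1 < a.
Hypothesis p_gt0 : forall l, Pin l -> 0 < p l.
Hypothesis p_lt : forall l, Pin l -> p l < rho.
Hypothesis p_inj : forall l l', Pin l -> Pin l' -> l != l' -> p l != p l'.
Hypothesis c_ge0 : forall o, Pout o -> 0 <= c o.
Hypothesis c_lt : forall o, Pout o -> c o * rho < 1.
Local Notation unif := (@unif R).

Variable al : R.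
Hypothesis alE : al = a + \sum_(l | Pin l) b l.

Definition uin l (x t : R) : R[i] := (p l / x)%:C * expi (- (2 * pi * t)).
Definition uout o (x t : R) : R[i] := (c o * x)%:C * expi (2 * pi * t - phi o).

(** With [z = x exp(2 pi i t)] this is [f(z) exp(2 pi i t)], where [f] is [z^al] times the powers of
    [1 - p_l / z] and the outer factors, a continuation of [z^a] times the powers of [z - p_l].
    Hence [f(z) dz = key dx + 2 pi i x key dt]. Extracting the powers of [z] leaves principal powers
    whose bases avoid the cut for [0 < t < 1]. *)
Definition key (x t : R) : R[i] := (x `^ al)%:C * expi ((al + 1) * (2 * pi * t)) *
  (\prod_(l | Pin l) ppow (b l) (1 - uin l x t)) *
  \prod_(o | Pout o) ppow (b' o) (1 - uout o x t).

(** This is [1 + z f'(z) / f(z)], the logarithmic derivative shared by both components of the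
    form. *)
Definition keylog (x t : R) : R[i] := (al + 1)%:C +
  \sum_(l | Pin l) (b l)%:C * uin l x t / (1 - uin l x t) +
  \sum_(o | Pout o) - (b' o)%:C * uout o x t / (1 - uout o x t).

Lemma is_derive_scale (k e t : R) : is_derive t 1 (fun t => k * t + e) k.
Proof.
have := is_derive_addf (is_derive_mul (is_derive_cst k t 1) (is_derive_id t 1)) (is_derive_cst e t 1).
by move=> h; apply: is_derive_eq h _; rewrite mulr1 mulr0 !addr0.
Qed.

Lemma cder_eq (f g : R -> R[i]) x d e : cder f x d -> f =1 g -> d = e -> cder g x e.
Proof. by move=> h /funext <- <-. Qed.

Lemma cder_uin_t l x t : cder (uin l x) t (- twopii * uin l x t).
Proof.
have := cderM (cder_cst (p l / x)%:C t) (cder_expi (is_derive_scale (- (2 * pi)) 0 t)).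
move=> h; apply: cder_eq h _ _.
  by move=> s; rewrite addr0 mulNr.
rewrite mul0r add0r /uin addr0 mulNr mulrCA; congr (_ * _).
by rewrite /twopii; apply: complex_ReIm; rewrite /= ?oppr0.
Qed.

Lemma cder_uout_t o x t : cder (uout o x) t (twopii * uout o x t).
Proof.
have := cderM (cder_cst (c o * x)%:C t) (cder_expi (is_derive_scale (2 * pi) (- phi o) t)).
by move=> h; apply: cder_eq h _ _ => //; rewrite mul0r add0r /uout mulrCA.
Qed.

Lemma cder_uin_x l x t : x != 0 -> cder (fun x => uin l x t) x (- (x^-1)%:C * uin l x t).
Proof.
move=> x0.
have := cderM (cder_real (is_derive_mul (is_derive_cst (p l) x 1)
   (@is_derive_invf R (fun x => x) x 1 x0 (is_derive_id x 1)))) (cder_cst (expi (- (2 * pi * t))) x).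
move=> h; apply: cder_eq h _ _ => //.
rewrite /cst /= !mulr0 !addr0 mulr1 /uin mulrA; congr (_ * _).
by rewrite -rmorphN -rmorphM /=; congr (_%:C); field.
Qed.

Lemma cder_uout_x o x t : x != 0 -> cder (fun x => uout o x t) x ((x^-1)%:C * uout o x t).
Proof.
move=> x0.
have := cderM (cder_real (is_derive_mul (is_derive_cst (c o) x 1)
   (is_derive_id x 1))) (cder_cst (expi (2 * pi * t - phi o)) x).
move=> h; apply: cder_eq h _ _ => //.
rewrite !mulr0 !addr0 mulr1 /uout mulrA; congr (_ * _).
by rewrite -rmorphM /=; congr (_%:C); field.
Qed.

Lemma cder_1B (u : R -> R[i]) x d : cder u x d -> cder (fun t => 1 - u t) x (- d).
Proof.
move=> h; have := cderD (cder_cst 1 x) (cderM (cder_cst (-1) x) h).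
by move=> k; apply: cder_eq k _ _ => [s|]; rewrite ?mul0r ?mulN1r// add0r add0r.
Qed.

Lemma slit_uin l x t : Pin l -> 0 < x -> 0 < t -> t < 1 -> slit (1 - uin l x t).
Proof.
move=> Pl x0 t0 t1; apply: slit_1Bexpi; first by rewrite divr_ge0// ltW// p_gt0.
by rewrite cosN; exact: cos2pi_neq1.
Qed.

Lemma cn_uout o x t : Pout o -> 0 < x -> x <= rho -> cn (uout o x t) <= c o * rho.
Proof.
move=> Po x0 xr; have cx : 0 <= c o * x by rewrite mulr_ge0 ?c_ge0// ltW.
by rewrite cnM cn_expi mulr1 cn_real ger0_norm// ler_wpM2l// c_ge0.
Qed.

Lemma slit_uout o x t : Pout o -> 0 < x -> x <= rho -> slit (1 - uout o x t).
Proof.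
move=> Po x0 xr; apply: slit_Re; rewrite cReB subr_gt0 -[ltRHS]/(1 : R).
apply: (le_lt_trans (ler_norm _)); apply: (le_lt_trans (cn_Re _)).
exact: le_lt_trans (cn_uout t Po x0 xr) (c_lt Po).
Qed.

Lemma cder_key_t x t : 0 < x -> x <= rho -> 0 < t -> t < 1 ->
  cder (key x) t (twopii * keylog x t * key x t).
Proof.
move=> x0 xr t0 t1.
have e1 : cder (fun t => expi ((al + 1) * (2 * pi * t))) t
   (twopii * (al + 1)%:C * expi ((al + 1) * (2 * pi * t))).
  have h := cder_expi (is_derive_scale ((al + 1) * (2 * pi)) 0 t).
  apply: cder_eq h _ _ => [s|]; first by rewrite addr0 -mulrA.
  rewrite addr0 -mulrA; congr (_ * _).
  by rewrite /twopii; apply: complex_ReIm; rewrite ?cReM ?cImM /=; ring.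
have e2 : cder (fun t => \prod_(l | Pin l) ppow (b l) (1 - uin l x t)) t
   ((\sum_(l | Pin l) twopii * ((b l)%:C * uin l x t / (1 - uin l x t))) *
     \prod_(l | Pin l) ppow (b l) (1 - uin l x t)).
  apply: cder_logprod => l Pl.
  apply: cder_eq (cder_ppow (b l) (slit_uin Pl x0 t0 t1) (cder_1B (cder_uin_t l x t))) _ _ => //.
  by rewrite mulNr opprK; ring.
have e3 : cder (fun t => \prod_(o | Pout o) ppow (b' o) (1 - uout o x t)) t
   ((\sum_(o | Pout o) twopii * (- (b' o)%:C * uout o x t / (1 - uout o x t))) *
     \prod_(o | Pout o) ppow (b' o) (1 - uout o x t)).
  apply: cder_logprod => o Po.
  apply: cder_eq (cder_ppow (b' o) (slit_uout t Po x0 xr) (cder_1B (cder_uout_t o x t))) _ _ => //.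
  by ring.
have := cderM (cderM (cderM (cder_cst (x `^ al)%:C t) e1) e2) e3.
move=> h; apply: cder_eq h _ _ => //.
rewrite -!mulr_sumr /keylog /key.
set A := _%:C; set B := expi _; set C := \prod_(_ | _) _; set D := \prod_(_ | _) _.
by set S1 := \sum_(_ | _) _; set S2 := \sum_(_ | _) _; ring.
Qed.

(** The value is also the [t]-derivative of [key x], which is the closedness of [f(z) dz]. The extra
    factor [x] accounts for the [+ 1] in [al + 1]. *)
Lemma cder_key_x x t : 0 < x -> x <= rho -> 0 < t -> t < 1 ->
  cder (fun x => twopii * (x%:C * key x t)) x (twopii * keylog x t * key x t).
Proof.
move=> x0 xr t0 t1; have xn0 : x != 0 by rewrite gt_eqF.
have e0 := cder_real (is_derive_id x 1).
have e1 := cder_real (is_derive1_powR al x0).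
have e2 : cder (fun x => \prod_(l | Pin l) ppow (b l) (1 - uin l x t)) x
   ((\sum_(l | Pin l) (x^-1)%:C * ((b l)%:C * uin l x t / (1 - uin l x t))) *
     \prod_(l | Pin l) ppow (b l) (1 - uin l x t)).
  apply: (@cder_logprod _ _ _ _ (fun l x => ppow (b l) (1 - uin l x t))) => l Pl.
  apply: cder_eq (cder_ppow (b l) (slit_uin Pl x0 t0 t1) (cder_1B (cder_uin_x l t xn0))) _ _ => //.
  by rewrite mulNr opprK; ring.
have e3 : cder (fun x => \prod_(o | Pout o) ppow (b' o) (1 - uout o x t)) x
   ((\sum_(o | Pout o) (x^-1)%:C * (- (b' o)%:C * uout o x t / (1 - uout o x t))) *
     \prod_(o | Pout o) ppow (b' o) (1 - uout o x t)).
  apply: (@cder_logprod _ _ _ _ (fun o x => ppow (b' o) (1 - uout o x t))) => o Po.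
  apply: cder_eq (cder_ppow (b' o) (slit_uout t Po x0 xr) (cder_1B (cder_uout_x o t xn0))) _ _ => //.
  by ring.
have := cderM (cder_cst twopii x) (cderM e0 (cderM (cderM (cderM e1 (cder_cst (expi ((al + 1) * (2 * pi * t))) x)) e2) e3)).
move=> h; apply: cder_eq h _ _ => //.
rewrite -!mulr_sumr /keylog /key.
have pE : x `^ (al - 1) = x `^ al / x.
  apply: (mulIf xn0).
  rewrite divfK// -{2}(powRr1 (ltW x0)) -powRD ?subrK//.
  by rewrite (gt_eqF x0) implybT.
rewrite pE.
have -> : (al * (x `^ al / x))%:C = al%:C * (x `^ al)%:C * (x^-1)%:C.
  by rewrite -!rmorphM /= mulrA.
have x1 : x%:C * (x^-1)%:C = 1 by rewrite -rmorphM /= mulfV.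
have -> : (al + 1)%:C = al%:C + 1 by apply: complex_ReIm; rewrite ?cReD ?cImD /= ?addr0.
rewrite !rmorph1; move: x1; set X := x%:C; set Y := (x^-1)%:C; move: (x `^ al)%:C (al%:C) => A L.
set B := expi _; set C := \prod_(_ | _) _; set D := \prod_(_ | _) _.
set S1 := \sum_(_ | _) _; set S2 := \sum_(_ | _) _ => XY.
transitivity (twopii * (A * B * C * D + (X * Y) * ((L + S1 + S2) * (A * B * C * D)))); first by ring.
by rewrite XY; ring.
Qed.

Lemma cmeas_uin d (T : measurableType d) (f g : T -> R) l : measurable_fun setT f ->
  measurable_fun setT g -> cmeas (fun y => uin l (f y) (g y)).
Proof.
move=> mf mg; apply: cmeasM.
  by apply: cmeas_real; apply: measurable_funM => //; exact: measurable_invf.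
apply: cmeas_expi; apply: measurableT_comp => //; exact: measurable_funM.
Qed.

Lemma cmeas_uout d (T : measurableType d) (f g : T -> R) o : measurable_fun setT f ->
  measurable_fun setT g -> cmeas (fun y => uout o (f y) (g y)).
Proof.
move=> mf mg; apply: cmeasM; first by apply: cmeas_real; exact: measurable_funM.
by apply: cmeas_expi; apply: measurable_funB => //; exact: measurable_funM.
Qed.

Lemma cmeas_1B d (T : measurableType d) (f : T -> R[i]) : cmeas f -> cmeas (fun y => 1 - f y).
Proof.
by move=> mf; apply: cmeasB => //; exact: cmeas_cst.
Qed.

Lemma cmeas_key d (T : measurableType d) (f g : T -> R) : measurable_fun setT f ->
  measurable_fun setT g -> cmeas (fun y => key (f y) (g y)).
Proof.
move=> mf mg; apply: cmeasM.
  apply: cmeasM.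
    apply: cmeasM; first by apply: cmeas_real; exact: measurable_powf.
    by apply: cmeas_expi; apply: measurable_funM => //; exact: measurable_funM.
  by apply: cmeas_prod => l Pl; apply: cmeas_ppow; apply: cmeas_1B; exact: cmeas_uin.
by apply: cmeas_prod => o Po; apply: cmeas_ppow; apply: cmeas_1B; exact: cmeas_uout.
Qed.

Lemma cmeas_key_x t : cmeas (fun x : measurableTypeR R => key x t).
Proof. by apply: cmeas_key => //; exact: measurable_id. Qed.

Lemma cmeas_key_t x : cmeas (fun t : measurableTypeR R => key x t).
Proof. by apply: cmeas_key => //; exact: measurable_id. Qed.

Lemma cmeas_inv d (T : measurableType d) (f : T -> R[i]) : cmeas f -> cmeas (fun y => (f y)^-1).
Proof.
move=> [m1 m2].
have ms : measurable_fun setT (fun y => (Re (f y) ^+ 2 + Im (f y) ^+ 2)^-1).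
  by apply: measurable_invf; apply: measurable_funD; exact: measurable_funX.
split.
- by under eq_fun do rewrite cReV; exact: measurable_funM.
- by under eq_fun do rewrite cImV; apply: measurableT_comp => //; exact: measurable_funM.
Qed.

Lemma cmeas_keylog d (T : measurableType d) (f g : T -> R) : measurable_fun setT f ->
  measurable_fun setT g -> cmeas (fun y => keylog (f y) (g y)).
Proof.
move=> mf mg; apply: cmeasD.
  apply: cmeasD; first exact: cmeas_cst.
  apply: cmeas_sum => l Pl; apply: cmeasM.
    by apply: cmeasM; [exact: cmeas_cst|exact: cmeas_uin].
  by apply: cmeas_inv; apply: cmeas_1B; exact: cmeas_uin.
apply: cmeas_sum => l Pl; apply: cmeasM.
  by apply: cmeasM; [exact: cmeas_cst|exact: cmeas_uout].
by apply: cmeas_inv; apply: cmeas_1B; exact: cmeas_uout.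
Qed.

Lemma slit_neq0 (z : R[i]) : slit z -> z != 0.
Proof. by move=> s; rewrite -cn_gt0 slit_cn. Qed.

Lemma ccvg_keylog (F : set_system R) {FF : ProperFilter F} (f g : R -> R) x t :
  0 < x -> x <= rho -> 0 < t -> t < 1 ->
  (forall l, Pin l -> ccvg F (fun s => uin l (f s) (g s)) (uin l x t)) ->
  (forall o, Pout o -> ccvg F (fun s => uout o (f s) (g s)) (uout o x t)) ->
  ccvg F (fun s => keylog (f s) (g s)) (keylog x t).
Proof.
move=> x0 xr t0 t1 h1 h2.
apply: ccvgD.
  apply: ccvgD; first exact: ccvg_cst.
  apply: ccvg_sum => l Pl; apply: ccvgM.
    by apply: ccvgM; [exact: ccvg_cst|exact: h1].
  by apply: ccvgV; [apply: slit_neq0; exact: slit_uin|apply: ccvg_1B; exact: h1].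
apply: ccvg_sum => o Po; apply: ccvgM.
  by apply: ccvgM; [exact: ccvg_cst|exact: h2].
by apply: ccvgV; [apply: slit_neq0; exact: slit_uout|apply: ccvg_1B; exact: h2].
Qed.

Lemma ccvg_key (F : set_system R) {FF : ProperFilter F} (f : R -> R) x t :
  0 < x -> x <= rho -> 0 < t -> t < 1 -> f s @[s --> F] --> x ->
  (forall l, Pin l -> ccvg F (fun s => uin l (f s) t) (uin l x t)) ->
  (forall o, Pout o -> ccvg F (fun s => uout o (f s) t) (uout o x t)) ->
  ccvg F (fun s => key (f s) t) (key x t).
Proof.
move=> x0 xr t0 t1 fx h1 h2.
apply: ccvgM.
  apply: ccvgM.
    apply: ccvgM; last exact: ccvg_cst.
    apply: ccvg_real.
    have [/derivable1_diffP/differentiable_continuous h _] := is_derive1_powR al x0.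
    exact: (cvg_comp _ _ fx h).
  by apply: ccvg_prod => l Pl; apply: ccvg_ppow; [exact: slit_uin|apply: ccvg_1B; exact: h1].
by apply: ccvg_prod => o Po; apply: ccvg_ppow; [exact: slit_uout|apply: ccvg_1B; exact: h2].
Qed.

Lemma ccvg0_le (f : nat -> R[i]) (g : nat -> R) : (forall n, cn (f n) <= g n) ->
  g n @[n --> \oo] --> 0 -> ccvg \oo f 0.
Proof.
move=> fg g0.
have sq (u : nat -> R) : (forall n, `|u n| <= g n) -> u n @[n --> \oo] --> 0.
  move=> ug; apply: (@squeeze_cvgr _ _ _ _ (fun n => - g n) g) => //.
    by apply: nearW => n; rewrite -ler_norml.
  by rewrite -oppr0; exact: cvgN.
by split; apply: sq => n; [exact: le_trans (cn_Re _) (fg n)|exact: le_trans (cn_Im _) (fg n)].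
Qed.

(** The modulus of [f] on the segment, apart from the outer factors. *)
Definition kden (x : R) : R := x `^ a * \prod_(l | Pin l) `|x - p l| `^ b l.

Lemma kden_ge0 x : 0 <= kden x.
Proof. by rewrite mulr_ge0 ?powR_ge0// prodr_ge0// => l _; exact: powR_ge0. Qed.

(** As [al - a] is the sum of the [b l], the power of [x] is shared out among the inner factors; it
    turns each [|1 - p l / z|] back into [|z - p l|]. *)
Lemma powR_al x (y : I -> R) : 0 < x -> (forall l, 0 <= y l) ->
  x `^ al * \prod_(l | Pin l) y l `^ b l = x `^ a * \prod_(l | Pin l) (x * y l) `^ b l.
Proof.
move=> x0 y0; rewrite alE powRD ?(gt_eqF x0) ?implybT// powR_sumr// -mulrA -big_split.
by congr (_ * _); apply: eq_bigr => l _; rewrite powRM// ltW.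
Qed.

Lemma cn_key x t : 0 < x -> cn (key x t) =
  x `^ a * (\prod_(l | Pin l) (x * cn (1 - uin l x t)) `^ b l) *
  \prod_(o | Pout o) cn (1 - uout o x t) `^ b' o.
Proof.
move=> x0; rewrite !cnM !cn_prod cn_expi mulr1 cn_real ger0_norm ?powR_ge0//.
rewrite -powR_al//; last by move=> l; exact: cn_ge0.
by congr (_ * _ * _); apply: eq_bigr => i _; rewrite cn_ppow.
Qed.

Lemma uin_ge l x t : Pin l -> 0 < x -> `|x - p l| <= x * cn (1 - uin l x t).
Proof.
move=> Pl x0; have r0 : 0 <= p l / x by rewrite divr_ge0// ltW// p_gt0.
rewrite (_ : `|x - p l| = x * `|1 - p l / x|); first by rewrite ler_pM2l// cn_1Bexpi_ge.
by rewrite -{2}(gtr0_norm x0) -normrM; congr (`|_|); field; rewrite gt_eqF.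
Qed.

Lemma uin_le l x t : Pin l -> 0 < x -> x * cn (1 - uin l x t) <= x + p l.
Proof.
move=> Pl x0; have r0 : 0 <= p l / x by rewrite divr_ge0// ltW// p_gt0.
rewrite (_ : x + p l = x * (1 + p l / x)); first by rewrite ler_pM2l// cn_1Bexpi_le.
by field; rewrite gt_eqF.
Qed.

Lemma uin_le2 l x t : Pin l -> 0 < x -> x <= rho -> x * cn (1 - uin l x t) <= 2.
Proof.
move=> Pl x0 xr; apply: (le_trans (uin_le t Pl x0)).
by have := p_lt Pl; move: xr rho1; lra.
Qed.

Lemma out_bound : exists2 E, 0 <= E & forall x t, 0 < x -> x <= rho ->
  \prod_(o | Pout o) cn (1 - uout o x t) `^ b' o <= E.
Proof.
exists (\prod_(o | Pout o) ((1 - c o * rho) `^ b' o + 2 `^ b' o)).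
  by apply: prodr_ge0 => o _; rewrite addr_ge0 ?powR_ge0.
move=> x t x0 xr; apply: ler_prod => o Po; rewrite powR_ge0 /=.
have u := cn_uout t Po x0 xr; have k := c_lt Po.
have cx : 0 <= c o * x by rewrite mulr_ge0 ?c_ge0// ltW.
have cE : cn (uout o x t) = c o * x by rewrite cnM cn_expi mulr1 cn_real ger0_norm.
apply: powR_between.
- by rewrite subr_gt0.
- apply: le_trans (cn_1Bexpi_ge _ cx); rewrite -cE ger0_norm; move: u k; lra.
- by apply: (le_trans (cn_1Bexpi_le _ cx)); rewrite -cE; move: u k; lra.
Qed.

(** The factor 2 ensures that a point within [d] of one [p l] is still at distance at least [d] from
    the others and from 0. *)
Lemma sep_inner : exists2 d, 0 < d & (forall l, Pin l -> 2 * d <= p l) /\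
  (forall l l', Pin l -> Pin l' -> l != l' -> 2 * d <= `|p l - p l'|).
Proof.
pose s1 := [seq l <- enum I | Pin l].
have [|d1 d10 h1] := @finite_lower_bound R _ s1 (fun l => p l).
  by move=> l; rewrite mem_filter => /andP[Pl _]; exact: p_gt0.
pose s2 := [seq q <- enum {: I * I} | [&& Pin q.1, Pin q.2 & q.1 != q.2]].
have [|d2 d20 h2] := @finite_lower_bound R _ s2 (fun q => `|p q.1 - p q.2|).
  move=> q; rewrite mem_filter => /andP[/and3P[q1 q2 q3] _].
  by rewrite normr_gt0 subr_eq0; exact: p_inj.
exists (Num.min d1 d2 / 2); first by rewrite divr_gt0// lt_min d10 d20.
have e : 2 * (Num.min d1 d2 / 2) = Num.min d1 d2 by rewrite mulrC divfK.
split=> [l Pl|l l' Pl Pl' ll']; rewrite e ge_min.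
- by rewrite h1// mem_filter Pl mem_enum.
- by apply/orP; right; apply: (h2 (l, l')); rewrite mem_filter mem_enum /= Pl Pl' ll'.
Qed.

(** [kden] alone is no bound near a point with nonnegative exponent, where it may vanish; there the
    remaining factors are controlled and [key] is bounded, whence the [+ 1]. Elsewhere [|z - p l|]
    is at least [|x - p l|], which settles negative exponents, and at most [2 / d] times it when
    [b l] is nonnegative. *)
Lemma key_dom : exists2 C, 0 <= C & forall x t, 0 < x -> x <= rho ->
  (forall l, Pin l -> x != p l) -> cn (key x t) <= C * (kden x + 1).
Proof.
have [E E0 hE] := out_bound.
have [d d0 [hd1 hd2]] := sep_inner.
pose C1 := \prod_(l | Pin l) (if 0 <= b l then (2 / d) `^ b l else 1).
pose C2 := \prod_(l | Pin l) (d `^ b l + 2 `^ b l).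
pose C3 := d `^ a + 1 `^ a.
have C10 : 0 <= C1 by apply: prodr_ge0 => l _; case: ifP => _ //; exact: powR_ge0.
have C20 : 0 <= C2 by apply: prodr_ge0 => l _; rewrite addr_ge0 ?powR_ge0.
have C30 : 0 <= C3 by rewrite addr_ge0 ?powR_ge0.
exists ((C1 + C3 * C2) * E); first by rewrite mulr_ge0// addr_ge0// mulr_ge0.
move=> x t x0 xr xp; rewrite cn_key// [leRHS]mulrAC.
have k0 := kden_ge0 x.
apply: ler_pM; [|by apply: prodr_ge0 => o _; exact: powR_ge0| |exact: hE].
  by rewrite mulr_ge0 ?powR_ge0// prodr_ge0// => l _; exact: powR_ge0.
have xpos l : Pin l -> 0 < `|x - p l| by move=> Pl; rewrite normr_gt0 subr_eq0 xp.
have [/existsP[l0 /and3P[P0 b0 near0]]|/existsPn far] :=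
  boolP [exists l, [&& Pin l, 0 <= b l & `|x - p l| < d]].
- apply: (@le_trans _ _ (C3 * C2)); last first.
    rewrite -[leLHS]mulr1; apply: ler_pM => //; rewrite ?mulr_ge0//; last by rewrite lerDr.
    by rewrite lerDr.
  have dx : d <= x by have := hd1 l0 P0; move: near0; rewrite ltr_norml => /andP[]; lra.
  apply: ler_pM; rewrite ?powR_ge0//.
  + by apply: prodr_ge0 => l _; exact: powR_ge0.
  + by apply: powR_between => //; exact: le_trans xr rho1.
  apply: ler_prod => l Pl; rewrite powR_ge0 /=.
  have [ll0|ll0] := eqVneq l l0.
    apply: (@le_trans _ _ (2 `^ b l)); last by rewrite lerDr powR_ge0.
    rewrite ll0; apply: ge0_ler_powR => //; rewrite ?nnegrE//.
      by rewrite mulr_ge0 ?cn_ge0// ltW.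
    exact: uin_le2.
  apply: powR_between => //; last exact: uin_le2.
  apply: le_trans (uin_ge t Pl x0).
  have h := hd2 l l0 Pl P0 ll0.
  have : `|p l - p l0| <= `|x - p l| + `|x - p l0|.
    by rewrite (_ : p l - p l0 = (x - p l0) - (x - p l)) 1?(le_trans (ler_normB _ _)) 1?addrC//; ring.
  by move: near0; lra.
- apply: (@le_trans _ _ (C1 * kden x)); last first.
    by apply: ler_pM => //; rewrite ?lerDl ?mulr_ge0.
  rewrite mulrCA ler_wpM2l ?powR_ge0// -big_split /=.
  apply: ler_prod => l Pl; rewrite powR_ge0 /=.
  case: ifPn => bl; last first.
    rewrite mul1r; apply: powR_antitone; [exact: xpos|exact: uin_ge|].
    by rewrite ltW// ltNge.
  have dl : d <= `|x - p l|.
    by have := far l; rewrite Pl bl /= -leNgt.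
  rewrite -powRM; last exact: normr_ge0; last by rewrite divr_ge0// ltW.
  apply: ge0_ler_powR => //; rewrite ?nnegrE.
  + by rewrite mulr_ge0 ?cn_ge0// ltW.
  + by rewrite mulr_ge0// divr_ge0// ltW.
  apply: (le_trans (uin_le2 t Pl x0 xr)).
  by rewrite mulrAC ler_pdivlMr// ler_pM2l.
Qed.

(** Near 0 only the factor at the origin can be singular. As [-1 < a], the bound makes [x * key x t]
    vanish in the limit, and with it the small circle. *)
Lemma key_small : exists C d0, [/\ 0 <= C, 0 < d0, d0 <= rho & forall x t, 0 < x -> x <= d0 ->
  cn (key x t) <= C * x `^ a].
Proof.
have [E E0 hE] := out_bound.
have [d d0 [hd1 _]] := sep_inner.
exists ((\prod_(l | Pin l) (d `^ b l + 2 `^ b l)) * E), (Num.min d rho); split.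
- by rewrite mulr_ge0// prodr_ge0// => l _; rewrite addr_ge0 ?powR_ge0.
- by rewrite lt_min d0 rho0.
- by rewrite ge_min lexx orbT.
move=> x t x0; rewrite le_min => /andP[xd xr].
rewrite cn_key// -mulrA [leRHS]mulrC; apply: ler_wpM2l; first exact: powR_ge0.
apply: ler_pM.
- by rewrite prodr_ge0// => l _; exact: powR_ge0.
- by rewrite prodr_ge0// => l _; exact: powR_ge0.
- apply: ler_prod => l Pl; rewrite powR_ge0 /=; apply: powR_between => //; last exact: uin_le2.
  apply: le_trans (uin_ge t Pl x0); have := hd1 l Pl => h.
  by rewrite ler0_norm; move: xd; lra.
- exact: hE.
Qed.

Lemma key_rho : exists2 C, 0 <= C & forall t, cn (key rho t) <= C.
Proof.
have [E E0 hE] := out_bound.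
exists (rho `^ a * (\prod_(l | Pin l) ((rho - p l) `^ b l + 2 `^ b l)) * E).
  rewrite !mulr_ge0 ?powR_ge0// prodr_ge0// => l _; by rewrite addr_ge0 ?powR_ge0.
move=> t; rewrite cn_key//; apply: ler_pM; last exact: hE.
- by rewrite mulr_ge0 ?powR_ge0// prodr_ge0// => l _; exact: powR_ge0.
- by rewrite prodr_ge0// => l _; exact: powR_ge0.
rewrite ler_wpM2l ?powR_ge0//; apply: ler_prod => l Pl; rewrite powR_ge0 /=.
apply: powR_between => //; last exact: uin_le2.
- by rewrite subr_gt0 p_lt.
- by apply: le_trans (uin_ge t Pl rho0); rewrite ler_norm.
Qed.

Lemma key_bnd de e : 0 < de -> 0 < e -> e < 2^-1 -> exists C, forall x t,
  de <= x -> x <= rho -> e <= t -> t <= 1 - e ->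
  cn (twopii * keylog x t * key x t) <= C.
Proof.
move=> de0 e0 e1; have [E E0 hE] := out_bound.
(* The angle stays [e] away from the cut, so every [1 - uin] has modulus at least [s]. *)
have s0 := sin2pi_gt0 e0 e1; set s := sin _ in s0.
have us l x t : Pin l -> de <= x -> e <= t -> t <= 1 - e -> s <= cn (1 - uin l x t).
  move=> Pl dx et te; have x0 := lt_le_trans de0 dx.
  apply: (@cn_1Bexpi_sin _ _ _ (cos (2 * pi * e))).
  - by rewrite divr_ge0// ltW// p_gt0.
  - by rewrite cosN; exact: cos2pi_le.
  - exact: cos2Dsin2.
  - exact: ltW.
exists (cn (twopii : R[i]) * (`|al + 1| + (\sum_(l | Pin l) `|b l| * (p l / de) / s) +
    \sum_(o | Pout o) `|b' o| * (c o * rho) / (1 - c o * rho)) *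
  ((de `^ a + 1 `^ a) * (\prod_(l | Pin l) ((de * s) `^ b l + 2 `^ b l)) * E)).
move=> x t dx xr et te; have x0 := lt_le_trans de0 dx.
rewrite !cnM; apply: ler_pM.
- by rewrite mulr_ge0 ?cn_ge0.
- by rewrite !mulr_ge0 ?cn_ge0.
- apply: ler_wpM2l; first exact: cn_ge0.
  apply: (le_trans (cnD _ _)); apply: lerD.
    apply: (le_trans (cnD _ _)); apply: lerD; first by rewrite cn_real.
    apply: (le_trans (cn_sum _ _ _)); apply: ler_sum => l Pl.
    have r0 : 0 <= p l / x by rewrite divr_ge0// ltW// p_gt0.
    rewrite !cnM cnV cn_real cn_real cn_expi mulr1 (ger0_norm r0).
    have s1 := us l x t Pl dx et te.
    apply: ler_pM; [by rewrite mulr_ge0|by rewrite invr_ge0 cn_ge0| |].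
      by rewrite ler_wpM2l// ler_pM2l ?p_gt0// lef_pV2 ?posrE.
    by rewrite lef_pV2 ?posrE// (lt_le_trans s0).
  apply: (le_trans (cn_sum _ _ _)); apply: ler_sum => o Po.
  rewrite !cnM -!cnM cnM cnV [X in X * _]cnM cnN cn_real.
  have u := cn_uout t Po x0 xr; have k := c_lt Po.
  have cx : 0 <= c o * x by rewrite mulr_ge0 ?c_ge0// ltW.
  have cE : cn (uout o x t) = c o * x by rewrite cnM cn_expi mulr1 cn_real ger0_norm.
  have w : 1 - c o * rho <= cn (1 - uout o x t).
    apply: le_trans (cn_1Bexpi_ge _ cx); rewrite -cE ger0_norm; move: u k; lra.
  apply: ler_pM; [by rewrite mulr_ge0 ?cn_ge0|by rewrite invr_ge0 cn_ge0| |].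
    by rewrite ler_wpM2l.
  by rewrite lef_pV2 ?posrE ?subr_gt0// (lt_le_trans _ w)// subr_gt0.
- rewrite -!cnM -/(key x t) cn_key//; apply: ler_pM; last exact: hE.
  + by rewrite mulr_ge0 ?powR_ge0// prodr_ge0// => l _; exact: powR_ge0.
  + by rewrite prodr_ge0// => l _; exact: powR_ge0.
  apply: ler_pM; rewrite ?powR_ge0//.
  + by rewrite prodr_ge0// => l _; exact: powR_ge0.
  + by apply: powR_between => //; exact: le_trans xr rho1.
  apply: ler_prod => l Pl; rewrite powR_ge0 /=; apply: powR_between; last exact: uin_le2.
  + by rewrite mulr_gt0.
  + by apply: ler_pM => //; rewrite ?(ltW de0) ?(ltW s0)//; exact: us.
Qed.

(** The outer factors on the segment: they do not jump, as [exp(2 pi i t)] is 1 at both ends [t = 0]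
    and [t = 1]. *)
Definition kE (x : R) : R[i] := \prod_(o | Pout o) ppow (b' o) (1 - (c o * x)%:C * expi (- phi o)).

(** Treats both sides of the cut at once: [tau] will be 0 or 1, and [sg] is the sign of the half
    turn acquired by the inner points beyond [x]. *)
Lemma key_lim x (tn : nat -> R) tau sg : 0 < x -> x <= rho -> (forall l, Pin l -> x != p l) ->
  tn n @[n --> \oo] --> tau -> expi (2 * pi * tau) = 1 ->
  (forall l, Pin l -> x < p l -> ccvg \oo (fun n => ppow (b l) (1 - uin l x (tn n)))
     ((`|1 - p l / x| `^ b l)%:C * expi (sg * (b l * pi)))) ->
  ccvg \oo (fun n => key x (tn n)) ((kden x)%:C * expi (al * (2 * pi * tau)) *
    (\prod_(l | Pin l) if p l < x then 1 else expi (sg * (b l * pi))) * kE x).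
Proof.
move=> x0 xr xp tl et hin.
have t2 : 2 * pi * tn n @[n --> \oo] --> 2 * pi * tau by apply: cvgM => //; exact: cvg_cst.
have -> : (kden x)%:C * expi (al * (2 * pi * tau)) *
    (\prod_(l | Pin l) if p l < x then 1 else expi (sg * (b l * pi))) * kE x =
  (x `^ al)%:C * expi ((al + 1) * (2 * pi * tau)) *
  (\prod_(l | Pin l) ((`|1 - p l / x| `^ b l)%:C * if p l < x then 1 else expi (sg * (b l * pi)))) * kE x.
  rewrite big_split /= (mulrDl al 1) mul1r expiD et mulr1.
  have -> : kden x = x `^ al * \prod_(l | Pin l) `|1 - p l / x| `^ b l.
    rewrite powR_al//; congr (_ * _); apply: eq_bigr => l Pl; congr (_ `^ _).
    by rewrite -{2}(gtr0_norm x0) -normrM; congr (`|_|); field; rewrite gt_eqF.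
  by rewrite rmorphM rmorph_prod /=; ring.
apply: ccvgM.
  apply: ccvgM.
    apply: ccvgM; first exact: ccvg_cst.
    by apply: ccvg_expi; apply: cvgM => //; exact: cvg_cst.
  apply: ccvg_prod => l Pl; have [px|px] := ltP (p l) x; last first.
    by apply: hin => //; rewrite lt_neqAle xp.
  have ul : ccvg \oo (fun n => uin l x (tn n)) (p l / x)%:C.
    rewrite -[X in ccvg _ _ X]mulr1; apply: ccvgM; first exact: ccvg_cst.
    have -> : 1 = expi (- (2 * pi * tau)) by rewrite expiN et invr1.
    by apply: ccvg_expi; exact: cvgN.
  have q0 : 0 < 1 - p l / x by rewrite subr_gt0 ltr_pdivrMr// mul1r.
  have -> : (`|1 - p l / x| `^ b l)%:C * 1 = ppow (b l) (1 - (p l / x)%:C).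
    have -> : 1 - (p l / x)%:C = (1 - p l / x)%:C by rewrite rmorphB.
    by rewrite /ppow /carg cn_real /= mul0r atan0 !mulr0 expi0.
  apply: ccvg_ppow; last exact: ccvg_1B.
  by apply: slit_Re; rewrite cReB.
apply: ccvg_prod => o Po; apply: ccvg_ppow; last first.
  apply: ccvg_1B; apply: ccvgM; first exact: ccvg_cst.
  have -> : expi (- phi o) = expi (2 * pi * tau - phi o) by rewrite expiD et mul1r.
  by apply: ccvg_expi; apply: cvgB => //; exact: cvg_cst.
have -> : (c o * x)%:C * expi (- phi o) = uout o x 0 by rewrite /uout mulr0 sub0r.
exact: slit_uout.
Qed.

Lemma unif_ae_neq (s : seq I) : {ae unif, forall t, all (fun l => t != p l) s}.
Proof.
elim: s => [|l s IH] /=; first exact: nearW.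
by apply: filterS (filterI (unif_ae0 (p l)) IH) => t [-> ->].
Qed.

Lemma unif_ae_inner : {ae unif, forall t, forall l, Pin l -> t != p l}.
Proof.
apply: filterS (unif_ae_neq (enum I)) => t /allP h l _.
by apply: h; rewrite mem_enum.
Qed.

Definition pbox (x : R) : R := ((0 < x) && (x <= rho))%:R.

Lemma measurable_pbox d (X : measurableType d) (f : X -> R) : measurable_fun setT f ->
  measurable_fun setT (fun x => pbox (f x)).
Proof.
move=> mf; rewrite /pbox (_ : (fun x => _) = (fun x => if (0 < f x) && (f x <= rho) then 1 else 0 : R)).
  apply: measurable_fun_ifT => //; apply: measurable_and.
    exact: measurable_fun_ltr.
  exact: measurable_fun_ler.
by apply/funext => x; case: ifP.
Qed.

Hypothesis kden_int : unif.-integrable setT (fun x => (pbox x * kden x)%:E).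

Lemma dom_int C : unif.-integrable setT
  (EFin \o (fun x => pbox x * (C * (kden x + 1)))).
Proof.
rewrite (_ : _ \o _ = (fun x => (C * (pbox x * kden x))%:E + (C * pbox x)%:E)%E).
  apply: integrableD => //; first exact: integrable_scale.
  apply: (@integrable_dom _ _ _ _ _ (cst `|C|)).
  - by apply: measurable_funM => //; apply: measurable_pbox; exact: measurable_id.
  - exact: prob_integrable_cst.
  by move=> x /=; rewrite normrM /pbox; case: (_ && _); rewrite ?normr1 ?mulr1 ?normr0 ?mulr0.
by apply/funext => x /=; rewrite -EFinD; congr (_%:E); ring.
Qed.

(** The [green] formula on [de n <= x <= rho], [e <= t <= 1 - e]: the inner radius tends to 0 while
    the angular gap stays fixed, so that only one kind of singularity is met in each limit. *)
Lemma keyhole_cut e : 0 < e -> e < 2^-1 ->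
  Cint unif (fun x => (pbox x)%:C * (key x (1 - e) - key x e)) =
  Cint unif (fun t => (box e (1 - e) t)%:C * (twopii * (rho%:C * key rho t))).
Proof.
move=> e0 e1.
have [Cs [d0 [Cs0 d00 d0r hs]]] := key_small.
have [Cr Cr0 hr] := key_rho.
have [Cd Cd0 hd] := key_dom.
have p1 : 0 < 1 - e by lra.
have p2 : 1 - e < 1 by lra.
have p3 : e < 1 by lra.
(* With geometric radii the inner circle contributes at most a multiple of [q ^+ n.+1], where
   [q < 1] because [-1 < a]. *)
pose de n : R := d0 * 2^-1 ^+ n.+1.
have de0 n : 0 < de n by rewrite mulr_gt0// exprn_gt0.
have deS n : 2^-1 ^+ n.+1 < 1 :> R by rewrite exprn_ilt1//; lra.
have ded n : de n < d0 by rewrite -[ltRHS]mulr1 ltr_pM2l.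
have der n : de n < rho by exact: lt_le_trans (ded n) d0r.
have decvg : de n @[n --> \oo] --> 0.
  rewrite -(mulr0 d0); apply: cvgM; first exact: cvg_cst.
  rewrite (@cvg_shiftS _ (fun n => 2^-1 ^+ n : R)); apply: cvg_expr.
  by rewrite ger0_norm; lra.
have G n := @green R key (fun x t => twopii * keylog x t * key x t)
  (fun x t => twopii * (x%:C * key x t)) (de n) rho e (1 - e) (ltW (de0 n)) (der n) rho1
  (ltW e0) (_ : e < 1 - e) (ltW p2).
have L1 : ccvg \oo (fun n => Cint unif (fun x => (box (de n) rho x)%:C * (key x (1 - e) - key x e)))
   (Cint unif (fun x => (pbox x)%:C * (key x (1 - e) - key x e))).
  apply: (@Cdominated R _ (measurableTypeR R) unif
    (fun n x => (box (de n) rho x)%:C * (key x (1 - e) - key x e))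
    (fun x => (pbox x)%:C * (key x (1 - e) - key x e))
    (fun x => pbox x * ((2 * Cd) * (kden x + 1)))).
  - move=> n; apply: cmeasM; first by apply: cmeas_real; apply: measurable_box; exact: measurable_id.
    by apply: cmeasB; exact: cmeas_key_x.
  - apply: cmeasM; first by apply: cmeas_real; apply: measurable_pbox; exact: measurable_id.
    by apply: cmeasB; exact: cmeas_key_x.
  - apply: nearW => x; apply: ccvgM; last exact: ccvg_cst.
    apply: ccvg_eq (ccvg_cst _); have [x0|x0] := leP x 0.
      apply: nearW => n; rewrite /box /pbox (_ : de n <= x = false) ?(ltNge 0 x) ?x0//.
      by apply/negbTE; rewrite -ltNge (le_lt_trans x0).
    near=> n; rewrite /box /pbox x0 (_ : de n <= x)//.
    apply: ltW; near: n.
    by have /cvgr_lt := decvg; apply.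
  - exact: dom_int.
  - apply: filterS unif_ae_inner => x xp n.
    rewrite cnM cn_real; apply: (@le_trans _ _ (pbox x * cn (key x (1 - e) - key x e))).
      rewrite ler_wpM2r ?cn_ge0// /box /pbox; case: (leP (de n) x) => /= h; rewrite ?normr0 ?ler0n//.
      by rewrite (lt_le_trans (de0 n) h) /= ger0_norm.
    rewrite /pbox; case: (boolP ((0 < x) && (x <= rho))) => [/andP[x0 xr]|_]; rewrite ?mul0r// !mul1r.
    apply: (le_trans (cnD _ _)); rewrite cnN.
    have h1 := hd x (1 - e) x0 xr xp; have h2 := hd x e x0 xr xp.
    by move: h1 h2; lra.
have L2 : ccvg \oo (fun n => Cint unif (fun t => (box e (1 - e) t)%:C *
     (twopii * (rho%:C * key rho t) - twopii * ((de n)%:C * key (de n) t))))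
   (Cint unif (fun t => (box e (1 - e) t)%:C * (twopii * (rho%:C * key rho t)))).
  pose q : R := 2^-1 `^ (a + 1).
  have sm n t : cn (twopii * ((de n)%:C * key (de n) t)) <=
    cn (twopii : R[i]) * (Cs * d0 `^ (a + 1)) * q ^+ n.+1.
    rewrite cnM [cn (_ * key _ _)]cnM cn_real gtr0_norm// -[leRHS]mulrA; apply: ler_wpM2l; first exact: cn_ge0.
    apply: (@le_trans _ _ (de n * (Cs * de n `^ a))).
      by rewrite ler_pM2l//; apply: hs => //; exact: ltW.
    rewrite mulrCA -[leRHS]mulrA; apply: ler_wpM2l => //.
    rewrite (_ : de n * de n `^ a = de n `^ (a + 1)); last first.
      rewrite powRD ?powRr1 1?mulrC//; first exact: ltW.
      by rewrite (gt_eqF (de0 n)) implybT.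
    rewrite /de powRM ?exprn_ge0 ?(ltW d00)// ler_wpM2l ?powR_ge0//.
    by rewrite /q -!powR_mulrn ?powR_ge0// -!powRrM mulrC.
  have q0 : 0 <= q by exact: powR_ge0.
  have q1 : q < 1.
    have a10 : 0 < a + 1 by move: a1; lra.
    have h1 : (2^-1 : R) `^ (a + 1) < 1 `^ (a + 1).
      by apply: gt0_ltr_powR => //; rewrite ?nnegrE; lra.
    by move: h1; rewrite powR1.
  apply: (@Cdominated R _ (measurableTypeR R) unif
    (fun n t => (box e (1 - e) t)%:C *
     (twopii * (rho%:C * key rho t) - twopii * ((de n)%:C * key (de n) t)))
    (fun t => (box e (1 - e) t)%:C * (twopii * (rho%:C * key rho t)))
    (cst (cn (twopii : R[i]) * (rho * Cr) +
      cn (twopii : R[i]) * (Cs * d0 `^ (a + 1))))).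
  - move=> n; apply: cmeasM; first by apply: cmeas_real; apply: measurable_box; exact: measurable_id.
    by apply: cmeasB; apply: cmeasM; (try exact: cmeas_cst);
      apply: cmeasM; (try exact: cmeas_cst); exact: cmeas_key_t.
  - apply: cmeasM; first by apply: cmeas_real; apply: measurable_box; exact: measurable_id.
    by apply: cmeasM; [exact: cmeas_cst|apply: cmeasM; [exact: cmeas_cst|exact: cmeas_key_t]].
  - apply: nearW => t; apply: ccvgM; first exact: ccvg_cst.
    rewrite -[X in ccvg _ _ X]addr0; apply: ccvgD; first exact: ccvg_cst.
    apply: (@ccvg0_le _ (fun n => cn (twopii : R[i]) * (Cs * d0 `^ (a + 1)) * q ^+ n.+1)).
      by move=> n; rewrite cnN; exact: sm.
    rewrite -(mulr0 (cn (twopii : R[i]) * (Cs * d0 `^ (a + 1)))); apply: cvgM; first exact: cvg_cst.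
    rewrite (@cvg_shiftS _ (fun n => q ^+ n : R)); apply: cvg_expr.
    by rewrite ger0_norm.
  - exact: prob_integrable_cst.
  - apply: nearW => t n; rewrite cnM cn_real -[leRHS]mul1r.
    apply: ler_pM; rewrite ?cn_ge0 ?box_le1//=.
    apply: (le_trans (cnD _ _)); rewrite cnN; apply: lerD.
      by rewrite cnM [cn (_ * key _ _)]cnM cn_real gtr0_norm// ler_wpM2l ?cn_ge0// ler_pM2l.
    apply: (le_trans (sm n t)); rewrite -[leRHS]mulr1 ler_wpM2l ?exprn_ile1 ?(ltW q1)//.
    by rewrite !mulr_ge0 ?cn_ge0 ?powR_ge0.
have E n : Cint unif (fun x => (box (de n) rho x)%:C * (key x (1 - e) - key x e)) =
  Cint unif (fun t => (box e (1 - e) t)%:C *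
     (twopii * (rho%:C * key rho t) - twopii * ((de n)%:C * key (de n) t))).
  apply: G.
  - by lra.
  - move=> x t x1 x2 t1 t2; apply: cder_key_t => //; first exact: lt_le_trans x1.
      exact: lt_le_trans t1.
    exact: le_lt_trans t2 p2.
  - move=> x t x1 x2 t1 t2; apply: cder_key_x => //; first exact: lt_le_trans x1.
      exact: lt_le_trans t1.
    exact: le_lt_trans t2 p2.
  - move=> x t x1 x2 t1 t2.
    have x0 := lt_le_trans (de0 n) x1; have t0 := lt_le_trans e0 t1; have t3 := le_lt_trans t2 p2.
    apply: ccvgM; last exact: cder_ccvg (cder_key_t x0 x2 t0 t3).
    apply: ccvgM; first exact: ccvg_cst.
    apply: ccvg_keylog => //.
    + by move=> l _; exact: cder_ccvg (cder_uin_t l x t).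
    + by move=> o _; exact: cder_ccvg (cder_uout_t o x t).
  - move=> x t x1 x2 t1 t2.
    have x0 := lt_le_trans (de0 n) x1; have t0 := lt_le_trans e0 t1; have t3 := le_lt_trans t2 p2.
    have xn0 : x != 0 by rewrite gt_eqF.
    apply: ccvgM; last first.
      apply: (@ccvg_key (nbhs x) _ (fun s => s) x t x0 x2 t0 t3); first exact: cvg_id.
      + by move=> l _; exact: cder_ccvg (cder_uin_x l t xn0).
      + by move=> o _; exact: cder_ccvg (cder_uout_x o t xn0).
    apply: ccvgM; first exact: ccvg_cst.
    apply: ccvg_keylog => //.
    + by move=> l _; exact: cder_ccvg (cder_uin_x l t xn0).
    + by move=> o _; exact: cder_ccvg (cder_uout_x o t xn0).
  - apply: cmeasM; last by apply: cmeas_key; [exact: measurable_fst|exact: measurable_snd].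
    apply: cmeasM; first exact: cmeas_cst.
    by apply: cmeas_keylog; [exact: measurable_fst|exact: measurable_snd].
  - have [C hC] := key_bnd (de0 n) e0 e1; exists C => x t x1 x2 t1 t2; exact: hC.
apply: (ccvg_unique L1); rewrite (_ : (fun n => _) = (fun n => Cint unif (fun t => (box e (1 - e) t)%:C *
     (twopii * (rho%:C * key rho t) - twopii * ((de n)%:C * key (de n) t)))))//.
by apply/funext => n; exact: E.
Unshelve. all: by end_near. Qed.

(** Now the gap closes. The side [t -> 1] carries the monodromy [exp(2 pi i al)] of the extracted
    power, and every inner point beyond [x] contributes opposite half turns on the two sides. *)
Lemma keyhole :
  Cint unif (fun x => (pbox x * kden x)%:C * kE x *
    (expi (2 * pi * al) * (\prod_(l | Pin l) if p l < x then 1 else expi (- (b l * pi)))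
     - \prod_(l | Pin l) if p l < x then 1 else expi (b l * pi))) =
  twopii * rho%:C * Cint unif (fun t => key rho t).
Proof.
have [Cr Cr0 hr] := key_rho.
have [Cd Cd0 hd] := key_dom.
(* The shift by 3 keeps the gap strictly below one half. *)
pose e n : R := (n.+3)%:R^-1.
have e0 n : 0 < e n by rewrite invr_gt0.
have e1 n : e n < 2^-1 by rewrite ltf_pV2 ?posrE// ltr_nat.
have ecvg : e n @[n --> \oo] --> 0.
  have := @cvg_harmonic R; rewrite -(cvg_shiftn 2) => h.
  rewrite (_ : e = (fun n => harmonic (n + 2)%N))//.
  by apply/funext => n; rewrite /e /harmonic /= addn2.
have uinl x (l : I) (tn : nat -> R) tau : tn n @[n --> \oo] --> tau -> expi (2 * pi * tau) = 1 ->
  ccvg \oo (fun n => 1 - uin l x (tn n)) (1 - (p l / x)%:C).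
  move=> tl et; apply: ccvg_1B.
  rewrite -[X in ccvg _ _ X]mulr1; apply: ccvgM; first exact: ccvg_cst.
  have -> : 1 = expi (- (2 * pi * tau)) by rewrite expiN et invr1.
  by apply: ccvg_expi; apply: cvgN; apply: cvgM => //; exact: cvg_cst.
have Im1 x l t : Im (1 - uin l x t) = p l / x * sin (2 * pi * t).
  by rewrite cImB cImM /= mul0r addr0 sub0r sinN mulrN opprK.
have et0 : expi (2 * pi * 0 : R) = 1 by rewrite mulr0 expi0.
have et1 : expi (2 * pi * 1 : R) = 1 by rewrite mulr1 expi_2pi.
have e1cvg : 1 - e n @[n --> \oo] --> (1 : R).
  by rewrite -[X in _ --> X]subr0; apply: cvgB => //; exact: cvg_cst.
have tgt : ccvg \oo (fun n => Cint unif (fun x => (pbox x)%:C * (key x (1 - e n) - key x (e n))))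
  (Cint unif (fun x => (pbox x * kden x)%:C * kE x *
    (expi (2 * pi * al) * (\prod_(l | Pin l) if p l < x then 1 else expi (- (b l * pi)))
     - \prod_(l | Pin l) if p l < x then 1 else expi (b l * pi)))).
  apply: (@Cdominated R _ (measurableTypeR R) unif
    (fun n x => (pbox x)%:C * (key x (1 - e n) - key x (e n)))
    (fun x => (pbox x * kden x)%:C * kE x *
    (expi (2 * pi * al) * (\prod_(l | Pin l) if p l < x then 1 else expi (- (b l * pi)))
     - \prod_(l | Pin l) if p l < x then 1 else expi (b l * pi)))
    (fun x => pbox x * ((2 * Cd) * (kden x + 1)))).
  - move=> n; apply: cmeasM; first by apply: cmeas_real; apply: measurable_pbox; exact: measurable_id.
    by apply: cmeasB; exact: cmeas_key_x.
  - apply: cmeasM.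
      apply: cmeasM; first by apply: cmeas_real; apply/measurable_EFinP; have /measurable_int := kden_int.
      apply: cmeas_prod => o Po; apply: cmeas_ppow; apply: cmeas_1B; apply: cmeasM; last exact: cmeas_cst.
      by apply: cmeas_real; apply: measurable_funM => //; exact: measurable_id.
    have mif (u : I -> R[i]) : cmeas (fun x : measurableTypeR R => \prod_(l | Pin l) if p l < x then 1 else u l).
      apply: cmeas_prod => l Pl; apply: cmeas_if; [|exact: cmeas_cst|exact: cmeas_cst].
      by apply: measurable_fun_ltr => //; exact: measurable_id.
    by apply: cmeasB; [apply: cmeasM; [exact: cmeas_cst|exact: mif]|exact: mif].
  - apply: filterS unif_ae_inner => x xp; rewrite /pbox.
    case: (boolP ((0 < x) && (x <= rho))) => [/andP[x0 xr]|_]; last first.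
      under eq_fun do rewrite mul0r; rewrite mul0r !mul0r; exact: ccvg_cst.
    under eq_fun do rewrite mul1r; rewrite mul1r.
    have neg l : x < p l -> Re (1 - (p l / x)%:C) < 0.
      by move=> xl; rewrite cReB /= subr_lt0 ltr_pdivlMr// mul1r.
    have imz l : Im (1 - (p l / x)%:C) = 0 by rewrite cImB /= subr0.
    have k1 := @key_lim x (fun n => 1 - e n) 1 (-1) x0 xr xp e1cvg et1.
    have k0 := @key_lim x e 0 1 x0 xr xp ecvg et0.
    have h1 : forall l, Pin l -> x < p l -> ccvg \oo (fun n => ppow (b l) (1 - uin l x (1 - e n)))
      ((`|1 - p l / x| `^ b l)%:C * expi (-1 * (b l * pi))).
      move=> l Pl xl; rewrite mulN1r.
      have -> : `|1 - p l / x| = `|Re (1 - (p l / x)%:C)| by rewrite cReB.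
      apply: ccvg_ppow_below; [exact: neg|exact: imz|exact: uinl e1cvg et1|].
      apply: nearW => n; rewrite Im1 pmulr_rlt0; last by rewrite divr_gt0// p_gt0.
      have -> : 2 * pi * (1 - e n) = - (2 * pi * e n) + pi *+ 2 by rewrite -mulr_natl; ring.
      by rewrite sinD2pi sinN oppr_lt0; exact: sin2pi_gt0.
    have h0 : forall l, Pin l -> x < p l -> ccvg \oo (fun n => ppow (b l) (1 - uin l x (e n)))
      ((`|1 - p l / x| `^ b l)%:C * expi (1 * (b l * pi))).
      move=> l Pl xl; rewrite mul1r.
      have -> : `|1 - p l / x| = `|Re (1 - (p l / x)%:C)| by rewrite cReB.
      apply: ccvg_ppow_above; [exact: neg|exact: imz|exact: uinl ecvg et0|].
      apply: nearW => n; rewrite Im1 pmulr_rgt0; last by rewrite divr_gt0// p_gt0.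
      exact: sin2pi_gt0.
    rewrite [X in ccvg _ _ X](_ : _ = (kden x)%:C * expi (al * (2 * pi * 1)) *
       (\prod_(l | Pin l) if p l < x then 1 else expi (-1 * (b l * pi))) * kE x +
      -1 * ((kden x)%:C * expi (al * (2 * pi * 0)) *
       (\prod_(l | Pin l) if p l < x then 1 else expi (1 * (b l * pi))) * kE x)).
      under eq_fun do rewrite -[X in _ + X]mulN1r.
      by apply: ccvgD; [exact: k1|apply: ccvgM; [exact: ccvg_cst|exact: k0]].
    rewrite mulr1 !mulr0 expi0 (mulrC al).
    under [in RHS]eq_bigr do rewrite mulN1r.
    under [X in _ = _ + _ * (_ * X * _)]eq_bigr do rewrite mul1r.
    by ring.
  - exact: dom_int.
  - apply: filterS unif_ae_inner => x xp n.
    rewrite cnM cn_real /pbox; case: (boolP ((0 < x) && (x <= rho))) => [/andP[x0 xr]|_].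
      rewrite normr1 !mul1r; apply: (le_trans (cnD _ _)); rewrite cnN.
      have h1 := hd x (1 - e n) x0 xr xp; have h2 := hd x (e n) x0 xr xp.
      by move: h1 h2; lra.
    by rewrite normr0 !mul0r.
have mk := cmeas_key_t rho.
have ki : cintegrable unif (fun t => key rho t).
  by apply: (cintegrable_dom mk (prob_integrable_cst unif Cr)) => t; exact: hr.
have L2 : ccvg \oo (fun n => Cint unif (fun t => (box (e n) (1 - e n) t)%:C * (twopii * (rho%:C * key rho t))))
   (Cint unif (fun t => twopii * (rho%:C * key rho t))).
  apply: (@Cdominated R _ (measurableTypeR R) unif
    (fun n t => (box (e n) (1 - e n) t)%:C * (twopii * (rho%:C * key rho t)))
    (fun t => twopii * (rho%:C * key rho t)) (cst (cn (twopii : R[i]) * (rho * Cr)))).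
  - move=> n; apply: cmeasM; first by apply: cmeas_real; apply: measurable_box; exact: measurable_id.
    by apply: cmeasM; [exact: cmeas_cst|apply: cmeasM => //; exact: cmeas_cst].
  - by apply: cmeasM; [exact: cmeas_cst|apply: cmeasM => //; exact: cmeas_cst].
  - apply: filterS unif_ae01 => t /andP[t0 t1].
    apply: ccvg_eq (ccvg_cst _); near=> n; rewrite /box.
    have -> : e n <= t by apply: ltW; near: n; have /cvgr_lt := ecvg; apply.
    have -> : t <= 1 - e n by apply: ltW; near: n; have /cvgr_gt := e1cvg; apply.
    by rewrite mul1r.
  - exact: prob_integrable_cst.
  - apply: nearW => t n; rewrite cnM cn_real -[leRHS]mul1r.
    apply: ler_pM; rewrite ?cn_ge0 ?box_le1//=.
    by rewrite cnM ler_wpM2l ?cn_ge0// cnM cn_real gtr0_norm// ler_pM2l.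
rewrite -[RHS]mulrA -(CintZ rho%:C ki) -(CintZ twopii (cintegrableZ rho%:C ki)).
apply: (ccvg_unique tgt); rewrite (_ : (fun n => _) = (fun n => Cint unif (fun t =>
  (box (e n) (1 - e n) t)%:C * (twopii * (rho%:C * key rho t)))))//.
by apply/funext => n; exact: keyhole_cut.
Unshelve. all: by end_near. Qed.

End keyhole.

(** * The braiding factor as a product over inversions *)

Section braiding.
Context {R : realType} (n : nat) (mm : 'I_n -> 'I_n -> R).
Implicit Types (s t : {perm 'I_n}) (x y : 'I_n).

Local Close Scope classical_set_scope.
Local Open Scope set_scope.

Definition inv_set s := [set p : 'I_n * 'I_n | ((p.1 < p.2) && (s p.2 < s p.1))%N].

Lemma perm_lengthE s : perm_length s = #|inv_set s|.
Proof. by apply: eq_card => p; rewrite finset.inE; apply/idP/idP; rewrite inE. Qed.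

Lemma stranspE k (Hk : (k.+1 < n)%N) x : stransp Hk x =
  (if x == k :> nat then k.+1 else if x == k.+1 :> nat then k else x) :> nat.
Proof.
rewrite /stransp; case: tpermP => [->|->|/eqP a /eqP b] /=.
- by rewrite eqxx.
- by rewrite eqxx gtn_eqF.
- by move: a b; rewrite -!val_eqE /= => /negbTE -> /negbTE ->.
Qed.

Lemma stransp_lt k (Hk : (k.+1 < n)%N) x y : (stransp Hk y < stransp Hk x)%N =
  ((y < x) && ~~ ((x == k.+1 :> nat) && (y == k :> nat)))%N
  || ((x == k :> nat) && (y == k.+1 :> nat)).
Proof.
rewrite !stranspE.
case: (eqVneq (x : nat) k) => ?; case: (eqVneq (y : nat) k) => ?;
case: (eqVneq (x : nat) k.+1) => ?; case: (eqVneq (y : nat) k.+1) => ? /=; lia.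
Qed.

(** The transposition exchanges only the adjacent values [k] and [k.+1], so it changes the relative
    order of a single pair of arguments. *)
Lemma inv_set_stransp k (Hk : (k.+1 < n)%N) s :
  ((s^-1)%g (Ordinal (ltnW Hk)) < (s^-1)%g (Ordinal Hk))%N ->
  inv_set (s * stransp Hk)%g =
    ((s^-1)%g (Ordinal (ltnW Hk)), (s^-1)%g (Ordinal Hk)) |: inv_set s /\
  ((s^-1)%g (Ordinal (ltnW Hk)), (s^-1)%g (Ordinal Hk)) \notin inv_set s.
Proof.
set a := (s^-1)%g _; set b := (s^-1)%g _ => ab.
have sa : s a = Ordinal (ltnW Hk) by rewrite permKV.
have sb : s b = Ordinal Hk by rewrite permKV.
have eqa x : (s x == k :> nat) = (x == a).
  by rewrite -(inj_eq (@perm_inj _ s)) sa -val_eqE.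
have eqb x : (s x == k.+1 :> nat) = (x == b).
  by rewrite -(inj_eq (@perm_inj _ s)) sb -val_eqE.
split; last by rewrite finset.inE /= sa sb /= ab /= -leqNgt.
apply/finset.setP => -[x y]; rewrite !finset.inE /= !permM stransp_lt !eqa !eqb xpair_eqE.
case: (eqVneq x a) => [->|xa]; case: (eqVneq y b) => [->|yb] /=.
- by rewrite ab orbT.
- have -> : (a == b) = false by rewrite -val_eqE /= ltn_eqF.
  by rewrite /= andbT orbF.
- by rewrite orbF; case: (eqVneq x b) => [->|]; rewrite ?ltnn ?andbT//=.
- rewrite orbF; case: (eqVneq x b) => [->|] /=; rewrite ?andbT//.
  case: (eqVneq y a) => [->|] /=; rewrite ?andbT//.
  by rewrite andbF ltnNge (ltnW ab).
Qed.

Lemma incr_ge (f : 'I_n -> 'I_n) : (forall x y, (x < y)%N -> (f x < f y)%N) ->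
  forall x, (x <= f x)%N.
Proof.
move=> fi [i Hi]; elim: i Hi => [//|i IH] Hi.
have := fi (Ordinal (ltnW Hi)) (Ordinal Hi) (ltnSn i).
by apply: leq_ltn_trans; exact: IH.
Qed.

(** An increasing self-map of ['I_n] satisfies [x <= f x]; applied to [s] and to its inverse this
    forces equality. *)
Lemma inv_set0 s : inv_set s = finset.set0 -> s = 1%g.
Proof.
move=> s0.
have si x y : (x < y)%N -> (s x < s y)%N.
  move=> xy; have : (x, y) \notin inv_set s by rewrite s0 finset.inE.
  rewrite finset.inE /= xy /= -leqNgt leq_eqVlt => /orP[/eqP e|//].
  by move: xy; rewrite (perm_inj (val_inj e)) ltnn.
have vi x y : (x < y)%N -> ((s^-1)%g x < (s^-1)%g y)%N.
  move=> xy; rewrite ltnNge; apply/negP; rewrite leq_eqVlt => /orP[/eqP e|/si].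
    by move: xy; rewrite (perm_inj (val_inj e)) ltnn.
  by rewrite !permKV ltnNge (ltnW xy).
apply/permP => x; rewrite perm1; apply/val_inj/eqP; rewrite eqn_leq (incr_ge si) andbT.
by have := incr_ge vi (s x); rewrite permK.
Qed.

(** If the inverse increased at all adjacent values, it would increase everywhere and leave no
    inversion. *)
Lemma descent s : inv_set s != finset.set0 -> exists k (Hk : (k.+1 < n)%N),
  ((s^-1)%g (Ordinal Hk) < (s^-1)%g (Ordinal (ltnW Hk)))%N.
Proof.
move=> s0; apply: contrapT => h.
have adj k (Hk : (k.+1 < n)%N) : ((s^-1)%g (Ordinal (ltnW Hk)) < (s^-1)%g (Ordinal Hk))%N.
  rewrite ltnNge leq_eqVlt; apply/negP => /orP[/eqP/val_inj/perm_inj e|lt]; last first.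
    by apply: h; exists k, Hk.
  by have /(congr1 val) /= := e; lia.
have mono d : forall x y, (y = x + d.+1 :> nat)%N -> ((s^-1)%g x < (s^-1)%g y)%N.
  elim: d => [|d IH] x y e.
    have Hk : (x.+1 < n)%N by rewrite -(addn1 x) -e.
    have -> : x = Ordinal (ltnW Hk) by apply: val_inj.
    have -> : y = Ordinal Hk by apply: val_inj; rewrite /= e addn1.
    exact: adj.
  have Hk : ((x + d.+1).+1 < n)%N by rewrite -addnS -e.
  apply: (ltn_trans (IH x (Ordinal (ltnW Hk)) _)) => //.
  have -> : y = Ordinal Hk by apply: val_inj; rewrite /= e addnS.
  exact: adj.
case/finset.set0Pn: s0 => -[x y]; rewrite finset.inE /= => /andP[xy syx].
have h2 : ((s^-1)%g (s y) < (s^-1)%g (s x))%N by apply: (mono (s x - (s y).+1)%N); lia.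
by move: h2; rewrite !permK ltnNge (ltnW xy).
Qed.

(** Induction on the number of inversions: undoing a descent removes exactly one, so the recursion
    determines [q] on all permutations. *)
Lemma braiding_factorE (q : {perm 'I_n} -> R[i]) : is_braiding_factor mm q ->
  forall s, q s = \prod_(p in inv_set s) expi (pi * mm p.1 p.2).
Proof.
move=> [q1 qS] s; move: {2}#|_| (erefl #|inv_set s|) => N; elim: N s => [|N IH] s.
  by move=> /cards0_eq s0; rewrite s0 big_set0 (inv_set0 s0).
move=> sN; have [|k [Hk desc]] := @descent s; first by rewrite -card_gt0 sN.
pose s' := (s * stransp Hk)%g.
have ss : s = (s' * stransp Hk)%g by rewrite /s' -mulgA tperm2 mulg1.
have s'V x : (s'^-1)%g x = (s^-1)%g (stransp Hk x).
  by rewrite /s' invMg permM /stransp tpermV.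
have lt' : ((s'^-1)%g (Ordinal (ltnW Hk)) < (s'^-1)%g (Ordinal Hk))%N.
  by rewrite !s'V /stransp tpermL tpermR.
have [E nE] := inv_set_stransp lt'.
have c' : #|inv_set s'| = N.
  by move: sN; rewrite {1}ss E cardsU1 nE add1n => -[].
have l' : perm_length (s' * stransp Hk)%g = (perm_length s').+1.
  by rewrite !perm_lengthE -ss sN c'.
rewrite {1}ss (qS k Hk s' l') IH// [in RHS]ss E big_setU1//=.
Qed.

End braiding.

(** * Resummation of the reduced monodromy numbers *)

Section reduced_sum.
Context {R : realType} (n : nat) (m : 'I_n -> R) (mm : 'I_n -> 'I_n -> R).
Hypothesis mmC : forall i j, mm i j = mm j i.
Implicit Types (sigma tau eta : {perm 'I_n}) (x y : 'I_n) (A : {set 'I_n}).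
Local Close Scope classical_set_scope.
Local Open Scope set_scope.

(** The total phase on the chamber where the coordinates decrease along [tau]. The minuend at [i]
    belongs to the end of the turn of [z_i], the subtrahend to its beginning. *)
Definition chamber_phase tau : R[i] := \prod_(i < n)
  (expi (2 * pi * m i) * (\prod_(j < n | (i < j)%N)
     if (tau i < tau j)%N then expi (2 * pi * mm i j) else expi (pi * mm i j))
   - \prod_(j < n | (i < j)%N) if (tau i < tau j)%N then 1 else expi (pi * mm i j)).

Section order.
Variables (tau : {perm 'I_n}) (A : {set 'I_n}).

(* Elements of A come first, in tau-order; the others follow in reverse tau-order. *)
Definition kap x : nat := if x \in A then tau x : nat else (2 * n - tau x)%N.

Lemma kap_inj x y : kap x = kap y -> x = y.
Proof.
rewrite /kap => h; apply: (@perm_inj _ tau); apply: ord_inj.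
by move: h; have := ltn_ord (tau x); have := ltn_ord (tau y); do 2 case: ifP => _; lia.
Qed.

Lemma kapA x y : x \in A -> y \notin A -> (kap x < kap y)%N.
Proof.
rewrite /kap => -> /negbTE ->.
by have := ltn_ord (tau x); have := ltn_ord (tau y); lia.
Qed.

Definition rank x : nat := #|[set y | (kap y < kap x)%N]|.

Lemma rank_lt x : (rank x < n)%N.
Proof.
rewrite /rank -[X in (_ < X)%N]card_ord -cardsT; apply: proper_card.
by apply/fintype.properP; split; [exact: finset.subsetT|exists x; rewrite !finset.inE ?ltnn].
Qed.

Lemma rank_mono x y : (rank x < rank y)%N = (kap x < kap y)%N.
Proof.
have imp u v : (kap u < kap v)%N -> (rank u < rank v)%N.
  move=> uv; apply: proper_card; apply/fintype.properP; split.
    by apply/fintype.subsetP => w; rewrite !finset.inE => /ltn_trans; apply.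
  by exists u; rewrite !finset.inE ?ltnn.
apply/idP/idP; last exact: imp.
case: (ltngtP (kap x) (kap y)) => // [/imp h1 h2|/kap_inj ->]; last by rewrite ltnn.
by have := ltn_trans h1 h2; rewrite ltnn.
Qed.

Lemma rank_inj : injective (fun x => Ordinal (rank_lt x)).
Proof.
move=> x y /(congr1 val) /= h; apply: kap_inj.
have := rank_mono x y; have := rank_mono y x; rewrite h ltnn => a b.
by apply/eqP; rewrite eqn_leq leqNgt -a leqNgt -b.
Qed.

Definition sortp : {perm 'I_n} := perm rank_inj.

Lemma sortpE x : sortp x = rank x :> nat.
Proof. by rewrite permE. Qed.

Lemma sortp_lt x y : (sortp x < sortp y)%N = (kap x < kap y)%N.
Proof. by rewrite !sortpE rank_mono. Qed.

Lemma sortp_A x : (sortp x < #|A|)%N = (x \in A).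
Proof.
rewrite sortpE; apply/idP/idP => [|xA].
  apply: contraLR => xA; rewrite -leqNgt; apply: subset_leq_card.
  by apply/fintype.subsetP => y yA; rewrite finset.inE; exact: kapA.
apply: proper_card; apply/fintype.properP; split.
  apply/fintype.subsetP => y; rewrite finset.inE; apply: contraLR => yA.
  by rewrite -leqNgt ltnW// kapA.
by exists x; rewrite // finset.inE ltnn.
Qed.

End order.

(** With [sigma = sortp tau A] this gives [tau = sigma * eta]; the subsets [A] enumerate the
    factorisations of [tau] whose second factor is a shuffle. *)
Definition eta_of tau A : {perm 'I_n} := ((sortp tau A)^-1 * tau)%g.

Lemma shuffle_eta_of tau A : shuffle #|A| (eta_of tau A).
Proof.
have e i : eta_of tau A i = tau (((sortp tau A)^-1)%g i) by rewrite permM.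
have v (i : 'I_n) : (i < #|A|)%N = (((sortp tau A)^-1)%g i \in A).
  by rewrite -(sortp_A tau) permKV.
have w (i j : 'I_n) : (i < j)%N = (kap tau A (((sortp tau A)^-1)%g i) < kap tau A (((sortp tau A)^-1)%g j))%N.
  by rewrite -sortp_lt !permKV.
apply/andP; split; apply/forallP => i; apply/forallP => j; apply/implyP => /andP[].
- move=> ij jA; have iA := ltn_trans ij jA; move: ij; rewrite w !e /kap.
  by move: iA jA; rewrite !v => -> ->.
- rewrite leqNgt => iA ij.
  have jA : ~~ (j < #|A|)%N by move: iA ij; lia.
  move: ij; rewrite w !e /kap; move: iA jA; rewrite !v => /negbTE -> /negbTE ->.
  have := ltn_ord (tau (((sortp tau A)^-1)%g i)).
  by have := ltn_ord (tau (((sortp tau A)^-1)%g j)); lia.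
Qed.

Lemma card_perm_lt (s : {perm 'I_n}) k : (k <= n)%N -> #|[set x | (s x < k)%N]| = k.
Proof.
move=> kn; have -> : [set x | (s x < k)%N] = s @^-1: [set i : 'I_n | (i < k)%N].
  by apply/finset.setP => x; rewrite !finset.inE.
rewrite card_preimset; last exact: perm_inj.
have -> : #|[set i : 'I_n | (i < k)%N]| = #|[set widen_ord kn i | i : 'I_k]|.
  congr #|pred_of_set _|; apply/finset.setP => i; rewrite finset.inE; apply/idP/finset.imsetP.
    by move=> ik; exists (Ordinal ik) => //; apply: val_inj.
  by move=> [j _ ->] /=.
by rewrite card_imset ?card_ord// => i j /(congr1 val) /= /val_inj.
Qed.

(** The inverse construction: a shuffle determines [A] as the elements that [tau * eta^-1] sends
    below [k], and its two monotonicity conditions say that this permutation sorts by [kap]. *)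
Lemma shuffle_sortp tau (k : 'I_n.+1) eta : shuffle k eta ->
  sortp tau [set x | ((tau * eta^-1)%g x < k)%N] = (tau * eta^-1)%g.
Proof.
move=> /andP[/forallP h1 /forallP h2]; set s := (tau * eta^-1)%g; set A := [set x | _].
have es x : eta (s x) = tau x by rewrite /s permM permKV.
have lt x y : (kap tau A x < kap tau A y)%N = (s x < s y)%N.
  have main u v : (s u < s v)%N -> (kap tau A u < kap tau A v)%N.
    rewrite /kap !finset.inE => uv; case: (ltnP (s v) k) => vk.
      have uk := ltn_trans uv vk; rewrite uk.
      by have /forallP/(_ (s v))/implyP := h1 (s u); rewrite uv vk !es; apply.
    case: (ltnP (s u) k) => uk.
      by have := ltn_ord (tau u); have := ltn_ord (tau v); lia.
    have /forallP/(_ (s v))/implyP := h2 (s u); rewrite uv uk !es => /(_ isT).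
    by have := ltn_ord (tau u); have := ltn_ord (tau v); lia.
  apply/idP/idP; last exact: main.
  case: (ltngtP (s x) (s y)) => // [/main a b|/val_inj/perm_inj ->]; last by rewrite ltnn.
  by have := ltn_trans a b; rewrite ltnn.
apply/permP => x; apply: val_inj; rewrite /= sortpE /rank.
under eq_finset do rewrite lt.
by rewrite card_perm_lt// ltnW.
Qed.

(** Brings the double sum into the shape of an expanded product of [n] differences, which is indexed
    by subsets; [k] becomes the size of the subset. *)
Lemma shuffle_reindex tau (f : 'I_n.+1 -> {perm 'I_n} -> R[i]) :
  \sum_(k < n.+1) \sum_(eta | shuffle k eta) f k eta =
  \sum_(A : {set 'I_n}) f (inord #|A|) (eta_of tau A).
Proof.
rewrite pair_big_dep /=.
pose g (p : 'I_n.+1 * {perm 'I_n}) := [set x | ((tau * (p.2)^-1)%g x < p.1)%N].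
have cA A : (inord #|A| : 'I_n.+1) = #|A| :> nat.
  by rewrite inordK// ltnS -[X in (_ <= X)%N]card_ord; exact: max_card.
rewrite (reindex_onto (fun A : {set 'I_n} => (inord #|A| : 'I_n.+1, eta_of tau A)) g) /=.
  apply: eq_bigl => A; rewrite cA shuffle_eta_of /=; apply/eqP/finset.setP => x.
  by rewrite finset.inE /= cA /eta_of invMg invgK mulgA mulgV mul1g sortp_A.
move=> [k eta] /= h; rewrite /g /=; congr pair.
  apply: val_inj; rewrite /= cA card_perm_lt//.
  by rewrite -ltnS.
rewrite /eta_of (shuffle_sortp tau h) invMg invgK -mulgA mulVg mulg1 //.
Qed.

(** Products over inversions taken in different orders are brought to the common index set [x < y],
    where they can be compared factor by factor. *)
Lemma prod_pairs_split (S : comNzRingType) (P : rel 'I_n) (f : 'I_n -> 'I_n -> S) : (forall x y, f x y = f y x) ->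
  (forall x, P x x = false) ->
  \prod_x \prod_(y | P x y) f x y =
  \prod_(x < n) \prod_(y < n | (x < y)%N) ((if P x y then f x y else 1) * (if P y x then f x y else 1)).
Proof.
move=> fC P0.
transitivity ((\prod_(x < n) \prod_(y < n | (x < y)%N) if P x y then f x y else 1) *
  (\prod_(x < n) \prod_(y < n | (y < x)%N) if P x y then f x y else 1)).
  rewrite -big_split; apply: eq_bigr => x _; rewrite big_mkcond (bigID (fun y : 'I_n => (x < y)%N)) /=.
  congr (_ * _); rewrite (bigID (fun y : 'I_n => (y < x)%N)) /= [X in _ * X]big1 ?mulr1.
    by apply: eq_bigl => y; lia.
  move=> y h; have -> : y = x by apply: ord_inj; lia.
  by rewrite P0.
rewrite [X in _ * X](exchange_big_dep xpredT) //= -big_split; apply: eq_bigr => x _ /=.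
by rewrite -big_split; apply: eq_bigr => y _ /=; rewrite fC.
Qed.

(** For a pair [x < y], the half turns from [q] and from the inversions of [eta] add up to a number
    that depends on whether [x] lies in [A] but not on whether [y] does: 0 or 1 for [x] in [A], 2 or
    1 otherwise. Hence the weight factorises over [x]. *)
Lemma set_phase tau A (q : {perm 'I_n} -> R[i]) : is_braiding_factor mm q ->
  q (sortp tau A) * ((-1) ^+ #|A| *
    (\prod_(i < n | (#|A| <= i)%N) expi (2 * pi * m (((sortp tau A)^-1)%g i))) *
    \prod_(i < n) \prod_(j < n | ((i < j) && (eta_of tau A j < eta_of tau A i))%N)
        expi (pi * mm (((sortp tau A)^-1)%g i) (((sortp tau A)^-1)%g j))) =
  \prod_(i < n) (if i \in A
    then - \prod_(j < n | (i < j)%N) (if (tau i < tau j)%N then 1 else expi (pi * mm i j))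
    else expi (2 * pi * m i) * \prod_(j < n | (i < j)%N)
      (if (tau i < tau j)%N then expi (2 * pi * mm i j) else expi (pi * mm i j))).
Proof.
move=> hq; set s := sortp tau A.
have E1 : \prod_(i < n | (#|A| <= i)%N) expi (2 * pi * m ((s^-1)%g i)) =
   \prod_(i < n | i \notin A) expi (2 * pi * m i).
  rewrite (reindex_inj (@perm_inj _ s)) /=; apply: eq_big => i.
    by rewrite leqNgt sortp_A.
  by rewrite permK.
have E2 : \prod_(i < n) \prod_(j < n | ((i < j) && (eta_of tau A j < eta_of tau A i))%N)
        expi (pi * mm ((s^-1)%g i) ((s^-1)%g j)) =
  \prod_x \prod_(y | ((s x < s y) && (tau y < tau x))%N) expi (pi * mm x y).
  rewrite (reindex_inj (@perm_inj _ s)) /=; apply: eq_bigr => x _.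
  rewrite (reindex_inj (@perm_inj _ s)) /=; apply: eq_big => y; last by rewrite !permK.
  by rewrite /eta_of !permM !permK.
have E3 : q s = \prod_(x < n) \prod_(y < n | (x < y)%N) (if (s y < s x)%N then expi (pi * mm x y) else 1).
  rewrite (braiding_factorE hq) pair_big_dep /= big_mkcond [RHS]big_mkcond /=.
  by apply: eq_bigr => -[x y] _ /=; rewrite finset.inE /=; case: (x < y)%N.
have E4 : (-1) ^+ #|A| = \prod_(i < n) (if i \in A then -1 else 1) :> R[i].
  by rewrite -big_mkcond prodr_const.
rewrite E1 E2 E3 E4 (@prod_pairs_split _ (fun x y => (s x < s y) && (tau y < tau x))%N (fun x y => expi (pi * mm x y))); first last.
- by move=> x; rewrite ltnn.
- by move=> x y; rewrite mmC.
rewrite [X in _ * (_ * X * _)]big_mkcond -!big_split; apply: eq_bigr => x _ /=.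
rewrite mulrCA -!big_split.
have sE y : (s x < s y)%N = (kap tau A x < kap tau A y)%N by exact: sortp_lt.
have sE' y : (s y < s x)%N = (kap tau A y < kap tau A x)%N by exact: sortp_lt.
have e2 y : expi (2 * pi * mm x y) = expi (pi * mm x y) * expi (pi * mm x y).
  by rewrite -expiD; congr expi; ring.
case: (boolP (x \in A)) => xA /=.
- rewrite mulr1 mulN1r; congr (- _); apply: eq_bigr => y xy.
  rewrite sE sE' /kap xA; have tn := ltn_ord (tau x); have tn' := ltn_ord (tau y).
  have ne : (tau x != tau y :> nat).
    by apply/eqP => /ord_inj/perm_inj e; move: xy; rewrite e ltnn.
  by case: (y \in A); case: (ltngtP (tau x) (tau y)) ne => //= h _;
    repeat (case: ifP => /= ?); rewrite ?mulr1 ?mul1r//; lia.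
- rewrite mul1r; congr (_ * _); apply: eq_bigr => y xy.
  rewrite sE sE' /kap (negbTE xA) e2; have tn := ltn_ord (tau x); have tn' := ltn_ord (tau y).
  have ne : (tau x != tau y :> nat).
    by apply/eqP => /ord_inj/perm_inj e; move: xy; rewrite e ltnn.
  by case: (y \in A); case: (ltngtP (tau x) (tau y)) ne => //= h _;
    repeat (case: ifP => /= ?); rewrite ?mulr1 ?mul1r//; lia.
Qed.

(** The Selberg integral depends only on [tau = sigma * eta]. Summing by [tau] collects all phases
    in front of one integral, and their sum over subsets is an expanded product of differences. *)
Lemma reduced_sumE (q : {perm 'I_n} -> R[i]) : is_braiding_factor mm q ->
  \sum_sigma q sigma * Ftilde (fun i => m ((sigma^-1)%g i))
                        (fun i j => mm ((sigma^-1)%g i) ((sigma^-1)%g j)) =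
  twopii ^- n * \sum_tau (fine (Sel_eta m mm tau))%:C * chamber_phase tau.
Proof.
move=> hq; rewrite /Ftilde.
pose W (k : 'I_n.+1) sigma eta : R[i] := q sigma * ((-1) ^+ k *
    (\prod_(i < n | (k <= i)%N) expi (2 * pi * m ((sigma^-1)%g i))) *
    \prod_(i < n) \prod_(j < n | ((i < j) && (eta j < eta i))%N)
        expi (pi * mm ((sigma^-1)%g i) ((sigma^-1)%g j))).
transitivity (twopii ^- n * \sum_sigma \sum_(k < n.+1) \sum_(eta | shuffle k eta)
    (fine (Sel_eta m mm (sigma * eta)%g))%:C * W k sigma eta).
  rewrite mulr_sumr; apply: eq_bigr => sigma _; rewrite mulrCA; congr (_ * _).
  rewrite mulr_sumr; apply: eq_bigr => k _; rewrite mulr_sumr mulr_sumr; apply: eq_bigr => eta _.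
  have -> : Sel_eta (fun i => m ((sigma^-1)%g i)) (fun i j => mm ((sigma^-1)%g i) ((sigma^-1)%g j)) eta =
     Sel_eta m mm (sigma * eta)%g.
    by rewrite /Sel_eta; congr Sel; [apply/funext => i|apply/funext => i; apply/funext => j]; rewrite invMg !permM.
  by rewrite /W; ring.
congr (_ * _); rewrite exchange_big /=.
transitivity (\sum_(k < n.+1) \sum_(eta | shuffle k eta) \sum_tau
   (fine (Sel_eta m mm tau))%:C * W k (tau * eta^-1)%g eta).
  apply: eq_bigr => k _; rewrite exchange_big /=; apply: eq_bigr => eta _.
  rewrite (reindex_inj (@mulIg _ (eta^-1)%g)) /=; apply: eq_bigr => tau _.
  by rewrite -mulgA mulVg mulg1.
transitivity (\sum_(k < n.+1) \sum_tau (fine (Sel_eta m mm tau))%:C *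
   \sum_(eta | shuffle k eta) W k (tau * eta^-1)%g eta).
  apply: eq_bigr => k _; rewrite exchange_big /=; apply: eq_bigr => tau _.
  by rewrite mulr_sumr.
rewrite exchange_big /=; apply: eq_bigr => tau _.
rewrite -mulr_sumr; congr (_ * _).
rewrite (shuffle_reindex tau (fun k eta => W k (tau * eta^-1)%g eta)) /chamber_phase.
(* With the negative term in front, the expansion is indexed by the set of factors in which the
   subtrahend is chosen. *)
under [RHS]eq_bigr do rewrite addrC.
rewrite bigA_distr /=; apply: eq_bigr => A _.
rewrite -(set_phase tau A hq) /W /eta_of invMg invgK mulgA mulgV mul1g.
rewrite inordK// ltnS -[X in (_ <= X)%N]card_ord; exact: max_card.
Qed.

End reduced_sum.

(** * Nested integrals as integrals over the cube *)

Section iterated.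
Context {R : realType}.
Local Notation unif := (@unif R).
Implicit Types (F G : (nat -> R) -> \bar R) (z : nat -> R) (s : seq nat).

Lemma eq_II_on s F G z : (forall z', (forall a, a \notin s -> z' a = z a) -> F z' = G z') ->
  II s F z = II s G z.
Proof.
elim: s z => [|i s IH] z h /=; first exact: h.
apply: eq_integral => t _; apply: IH => z' hz'; apply: h => a.
rewrite inE negb_or => /andP[ai /hz' ->]; exact: upd_neq.
Qed.

Lemma II_zero s z : II s (fun=> 0%E : \bar R) z = 0%E.
Proof.
by elim: s z => [//|i s IH] z /=; under eq_integral do rewrite IH; rewrite integral0.
Qed.

Lemma unif_integral_cut (h : R -> \bar R) (u : R) : 0 <= u -> u <= 1 ->
  measurable_fun setT h -> (forall t, 0 <= h t)%E ->
  (\int[lebesgue_measure]_(t in `[0%R, u]%classic) h t =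
   \int[unif]_t (if (0 <= t)%R && (t <= u)%R then h t else 0))%E.
Proof.
move=> u0 u1 mh h0; rewrite unif_integral; last first.
  apply: measurable_fun_ifT => //; apply: measurable_and; exact: measurable_fun_ler.
rewrite integral_mkcond [RHS]integral_mkcond; apply: eq_integral => t _.
rewrite /patch !mem_setE !in_itv /=.
case: (leP 0 t) => t0 /=; rewrite ?if_same//; case: (leP t u) => tu; rewrite ?if_same//.
by rewrite (le_trans tu u1).
Qed.

(** The nested domain of [iint]. The map [e] tells which coordinate plays the role of the [j]-th
    variable, so that all chambers live in the same cube. *)
Fixpoint chain (e : nat -> nat) (j k : nat) (up : R) z : bool :=
  if k is k'.+1 then [&& (0 <= z (e j))%R, (z (e j) <= up)%R & chain e j.+1 k' (z (e j)) z]
  else true.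

Lemma measurable_chain d (T : measurableType d) e j k (up : T -> R) (g : T -> nat -> R) :
  measurable_fun setT up -> (forall i, measurable_fun setT (fun y => g y i)) ->
  measurable_fun setT (fun y => chain e j k (up y) (g y)).
Proof.
move=> mup mg; elim: k j up mup => [|k IH] j up mup /=; first exact: measurable_cst.
apply: measurable_and; first exact: measurable_fun_ler.
apply: measurable_and; first exact: measurable_fun_ler.
exact: IH.
Qed.

(** Every interval [[0, up]] is cut out of the unit interval by an indicator; injectivity of [e]
    prevents a later variable from overwriting an earlier one. *)
Lemma iint_II (e : nat -> nat) (F : (nat -> R) -> \bar R) : injective e ->
  (forall z, (0 <= F z)%E) -> ymeas F ->
  forall k j (up : R) zz, 0 <= up -> up <= 1 ->
  iint j k up (fun a => zz (e a)) F =
  II [seq e a | a <- iota j k] (fun z => if chain e j k up z then F (fun a => z (e a)) else 0%E) zz.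
Proof.
move=> ei F0 mF; elim=> [//|k IH] j up zz u0 u1 /=.
set s := [seq e a | a <- iota j.+1 k].
have ejs : e j \notin s.
  by rewrite mem_map// mem_iota ltnn.
have cm jj kk u : ymeas (fun z => if chain e jj kk u z then F (fun a => z (e a)) else 0%E).
  move=> d T g mg; apply: measurable_fun_ifT => //.
    by apply: measurable_chain => //; exact: measurable_cst.
  exact: mF.
have c0 jj kk u z : (0 <= if chain e jj kk u z then F (fun a => z (e a)) else 0)%E.
  by case: ifP.
pose h t := II s (fun z => if chain e j.+1 k (z (e j)) z then F (fun a => z (e a)) else 0%E) (upd zz (e j) t).
have hm : measurable_fun setT h.
  apply: (@II_meas R s (fun z => if chain e j.+1 k (z (e j)) z then F (fun a => z (e a)) else 0%E)).
  - by move=> z; case: ifP.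
  - move=> d T g mg; apply: measurable_fun_ifT => //; first exact: measurable_chain.
    exact: mF.
  - by move=> a; exact: measurable_upd1.
have h0 t : (0 <= h t)%E by apply: II_ge0 => z; case: ifP.
transitivity (\int[lebesgue_measure]_(t in `[0%R, up]%classic) h t)%E.
  apply: eq_integral => t; rewrite inE /= in_itv /= => /andP[t0 tu].
  have -> : (fun i => if i == j then t else zz (e i)) = (fun a => upd zz (e j) t (e a)).
    by apply/funext => a; rewrite /upd (inj_eq ei).
  rewrite IH ?(le_trans tu u1)//; apply: eq_II_on => z' hz'.
  by rewrite hz'// upd_same.
rewrite (unif_integral_cut u0 u1 hm h0); apply: eq_integral => t _.
case: ifPn => tu.
  apply: eq_II_on => z' hz'; rewrite hz'// upd_same.
  by move: tu => /andP[-> ->].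
rewrite -[LHS](II_zero s (upd zz (e j) t)); apply: eq_II_on => z' hz'.
by rewrite hz'// upd_same andbA (negbTE tu).
Qed.

End iterated.

(** * Selberg integrals over the chambers of the cube *)

Section selberg.
Context {R : realType} (n : nat) (m : 'I_n -> R) (mm : 'I_n -> 'I_n -> R).
Hypothesis mmC : forall i j, mm i j = mm j i.
Implicit Types (tau : {perm 'I_n}) (z : nat -> R).
Local Notation unif := (@unif R).

Definition den z : R := \prod_(i < n) (z i `^ m i * \prod_(j < n | (i < j)%N) `|z i - z j| `^ mm i j).

Definition in_chamber tau z : bool :=
  [forall i : 'I_n, forall j : 'I_n, (tau i < tau j)%N ==> (z j < z i)%R].

Lemma den_ge0 z : 0 <= den z.
Proof.
rewrite prodr_ge0// => i _; rewrite mulr_ge0 ?powR_ge0// prodr_ge0// => j _; exact: powR_ge0.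
Qed.

Lemma ymeas_cst d' (V : sigmaRingType d') (v : V) : ymeas (fun _ : nat -> R => v).
Proof. by move=> d T g mg; exact: measurable_cst. Qed.

Lemma ymeas_coord i : ymeas (fun z : nat -> R => z i).
Proof. by move=> d T g mg; exact: mg. Qed.

Lemma ymeasM (f g : (nat -> R) -> R) : ymeas f -> ymeas g -> ymeas (fun z => f z * g z).
Proof. by move=> mf mg d T h mh; apply: measurable_funM; [exact: mf|exact: mg]. Qed.

Lemma ymeasB (f g : (nat -> R) -> R) : ymeas f -> ymeas g -> ymeas (fun z => f z - g z).
Proof. by move=> mf mg d T h mh; apply: measurable_funB; [exact: mf|exact: mg]. Qed.

Lemma ymeas_prod (I : Type) (s : seq I) (P : pred I) (f : I -> (nat -> R) -> R) :
  (forall i, P i -> ymeas (f i)) -> ymeas (fun z => \prod_(i <- s | P i) f i z).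
Proof.
move=> mf d T g mg; elim: s => [|i s IH].
  by under eq_fun do rewrite big_nil; exact: measurable_cst.
under eq_fun do rewrite big_cons.
by case Pi : (P i) => //; apply: measurable_funM => //; exact: mf.
Qed.

Lemma ymeas_pow (f : (nat -> R) -> R) b : ymeas f -> ymeas (fun z => f z `^ b).
Proof. by move=> mf d T h mh; apply: measurable_powf; exact: mf. Qed.

Lemma ymeas_norm (f : (nat -> R) -> R) : ymeas f -> ymeas (fun z => `|f z|).
Proof. by move=> mf d T h mh; apply: measurableT_comp => //; exact: mf. Qed.

Lemma ymeas_lt (f g : (nat -> R) -> R) : ymeas f -> ymeas g -> ymeas (fun z => f z < g z).
Proof. by move=> mf mg d T h mh; apply: measurable_fun_ltr; [exact: mf|exact: mg]. Qed.

Lemma ymeas_den : ymeas den.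
Proof.
apply: ymeas_prod => i _; apply: ymeasM; first by apply: ymeas_pow; exact: ymeas_coord.
apply: ymeas_prod => j _; apply: ymeas_pow; apply: ymeas_norm.
by apply: ymeasB; exact: ymeas_coord.
Qed.

Lemma ymeas_all (I : Type) (s : seq I) (f : I -> (nat -> R) -> bool) :
  (forall i, ymeas (f i)) -> ymeas (fun z => all (f^~ z) s).
Proof.
move=> mf d T h mh; elim: s => [|i s IH] /=; first exact: measurable_cst.
by apply: measurable_and => //; exact: mf.
Qed.

Lemma ymeas_chamber tau : ymeas (in_chamber tau).
Proof.
have -> : in_chamber tau = (fun z => all (fun i : 'I_n => all (fun j : 'I_n =>
    (tau i < tau j)%N ==> (z j < z i)%R) (enum 'I_n)) (enum 'I_n)).
  apply/funext => z; apply/forallP/allP => [h i _|h i]; last first.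
    by apply/forallP => j; have /allP -> := h i (mem_enum _ i); rewrite ?mem_enum.
  by apply/allP => j _; have /forallP := h i.
apply: (@ymeas_all _ _ (fun i z => all (fun j : 'I_n => (tau i < tau j)%N ==> (z j < z i)%R) (enum 'I_n))) => i.
apply: (@ymeas_all _ _ (fun j z => (tau i < tau j)%N ==> (z j < z i)%R)) => j.
case: (tau i < tau j)%N => /=; last exact: ymeas_cst.
by apply: ymeas_lt; exact: ymeas_coord.
Qed.

(** [iint] numbers its variables by natural numbers, so [tau^-1] is prolonged by the identity beyond
    [n] to an injection of [nat]. *)
Definition ext tau (a : nat) : nat := if insub a is Some i then ((tau^-1)%g i : nat) else a.

Lemma extE tau (i : 'I_n) : ext tau i = (tau^-1)%g i.
Proof. by rewrite /ext valK. Qed.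

Lemma ext_ge tau a : (n <= a)%N -> ext tau a = a.
Proof. by move=> na; rewrite /ext insubN// -leqNgt. Qed.

Lemma ext_inj tau : injective (ext tau).
Proof.
move=> a b; case: (ltnP a n) => an; case: (ltnP b n) => bn.
- rewrite -[a]/(nat_of_ord (Ordinal an)) -[b]/(nat_of_ord (Ordinal bn)) !extE.
  by move=> /ord_inj/perm_inj ->.
- rewrite -[a]/(nat_of_ord (Ordinal an)) extE (ext_ge _ bn) => e.
  by move: bn; rewrite -e leqNgt ltn_ord.
- rewrite -[b]/(nat_of_ord (Ordinal bn)) extE (ext_ge _ an) => e.
  by move: an; rewrite e leqNgt ltn_ord.
- by rewrite !ext_ge.
Qed.

Lemma ext_perm tau : perm_eq [seq ext tau a | a <- iota 0 n] (iota 0 n).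
Proof.
apply: uniq_perm; rewrite ?iota_uniq ?(map_inj_uniq (@ext_inj tau)) ?iota_uniq//.
move=> a; rewrite mem_iota /= add0n; apply/mapP/idP.
  move=> [b]; rewrite mem_iota /= add0n => bn ->.
  by rewrite -[b]/(nat_of_ord (Ordinal bn)) extE ltn_ord.
move=> an; exists (tau (Ordinal an) : nat); first by rewrite mem_iota /= add0n.
by rewrite extE permK.
Qed.

Definition distinct z : bool := [forall i : 'I_n, forall j : 'I_n, (i != j) ==> (z i != z j)].

Lemma chain_le e j k up z : chain e j k up z ->
  (forall a, (j <= a < j + k)%N -> 0 <= z (e a) <= up) /\
  (forall a b, (j <= a)%N -> (a < b)%N -> (b < j + k)%N -> z (e b) <= z (e a)).
Proof.
elim: k j up => [|k IH] j up /=.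
  by rewrite addn0; split => [a|a b] *; exfalso; lia.
move=> /and3P[h1 h2 /IH[h3 h4]]; split.
  move=> a /andP[ja]; rewrite leq_eqVlt in ja; case/orP: ja => [/eqP <- _|ja ak].
    by rewrite h1 h2.
  by have /andP[-> u] := h3 a ltac:(lia); rewrite (le_trans u).
move=> a b ja ab bk; rewrite leq_eqVlt in ja; case/orP: ja => [/eqP ja|ja].
  by subst a; have /andP[_ ->] := h3 b ltac:(lia).
by apply: h4 => //; lia.
Qed.

Lemma chainT e j k up z : (forall a, (j <= a < j + k)%N -> 0 <= z (e a) <= up) ->
  (forall a b, (j <= a)%N -> (a < b)%N -> (b < j + k)%N -> z (e b) <= z (e a)) ->
  chain e j k up z.
Proof.
elim: k j up => [//|k IH] j up h1 h2 /=.
have /andP[-> ->] /= := h1 j ltac:(lia).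
apply: IH; first by move=> a ak; rewrite h2; [have /andP[-> _] := h1 a ltac:(lia)|lia|lia|lia].
by move=> a b *; apply: h2; lia.
Qed.

(** Nested intervals give weak inequalities and chambers strict ones; they agree once the
    coordinates are distinct. *)
Lemma chain_chamber tau z : distinct z -> (forall i : 'I_n, 0 < z i < 1) ->
  chain (ext tau) 0 n 1 z = in_chamber tau z.
Proof.
move=> dz z01; apply/idP/idP.
- move=> /chain_le[_ h]; apply/forallP => i; apply/forallP => j; apply/implyP => ij.
  have := h (tau i) (tau j) isT ij (ltn_ord _); rewrite !extE !permK => zz.
  rewrite lt_neqAle zz andbT.
  have /forallP/(_ j)/forallP/(_ i)/implyP := dz; apply.
  by apply/eqP => e; move: ij; rewrite e ltnn.
- move=> /forallP h; apply: chainT.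
    move=> a /andP[_ an]; rewrite -[a]/(nat_of_ord (Ordinal (an : (a < n)%N))) extE.
    by have /andP[u v] := z01 ((tau^-1)%g (Ordinal (an : (a < n)%N))); rewrite !ltW.
  move=> a b _ ab bn; have an := ltn_trans ab bn.
  rewrite -[a]/(nat_of_ord (Ordinal (an : (a < n)%N))) -[b]/(nat_of_ord (Ordinal (bn : (b < n)%N))) !extE.
  have /forallP/(_ ((tau^-1)%g (Ordinal (bn : (b < n)%N))))/implyP := h ((tau^-1)%g (Ordinal (an : (a < n)%N))).
  by rewrite !permKV => /(_ ab) /ltW.
Qed.

(** On the chamber all differences that occur are positive, and the symmetry of [mm] lets each pair
    be listed in its original order. *)
Lemma den_chamber tau z : in_chamber tau z ->
  \prod_(i < n) (z (ext tau i) `^ m ((tau^-1)%g i) * (1 - z (ext tau i)) `^ 0)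
   * \prod_(i < n) \prod_(j < n | (i < j)%N)
       (z (ext tau i) - z (ext tau j)) `^ mm ((tau^-1)%g i) ((tau^-1)%g j) = den z.
Proof.
move=> /forallP h; rewrite /den [RHS]big_split /=; congr (_ * _).
  rewrite (reindex_inj (@perm_inj _ tau)) /=; apply: eq_bigr => i _.
  by rewrite extE permK powRr0 mulr1.
transitivity (\prod_(x < n) \prod_(y < n | (tau x < tau y)%N) `|z x - z y| `^ mm x y).
  rewrite (reindex_inj (@perm_inj _ tau)) /=; apply: eq_bigr => x _.
  rewrite (reindex_inj (@perm_inj _ tau)) /=; apply: eq_bigr => y xy.
  rewrite !extE !permK gtr0_norm// subr_gt0.
  by have /forallP/(_ y)/implyP := h x; apply.
rewrite (@prod_pairs_split n _ (fun x y => (tau x < tau y)%N) (fun x y => `|z x - z y| `^ mm x y)); first last.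
- by move=> x; rewrite ltnn.
- by move=> x y; rewrite distrC mmC.
apply: eq_bigr => x _; apply: eq_bigr => y xy.
case: (ltngtP (tau x) (tau y)) => [|_|/ord_inj/perm_inj e]; rewrite ?mulr1 ?mul1r//.
by move: xy; rewrite e ltnn.
Qed.

Section rep.
Context (d : measure_display) (X : measurableType d).
Variables (mu : probability X R) (Z : X -> nat -> R).
Hypothesis rep : cube_rep (iota 0 n) mu Z.

Lemma iota_ord (i : 'I_n) : (i : nat) \in iota 0 n.
Proof. by rewrite mem_iota /= add0n. Qed.

Lemma rep_ae_all (I : finType) (P : I -> X -> Prop) :
  (forall i, {ae mu, forall y, P i y}) -> {ae mu, forall y, forall i, P i y}.
Proof.
move=> h.
have : forall s : seq I, {ae mu, forall y, forall i, i \in s -> P i y}.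
  elim=> [|i s IH]; first by apply: nearW.
  apply: filterS (filterI (h i) IH) => y [p q] j; rewrite inE => /orP[/eqP ->//|]; exact: q.
by move=> /(_ (enum I)); apply: filterS => y k i; apply: k; rewrite mem_enum.
Qed.

Lemma rep_ae01 : {ae mu, forall y, forall i : 'I_n, 0 < Z y i < 1}.
Proof.
apply: rep_ae_all => i.
apply: (@rep_ae R _ _ _ _ _ rep i (fun z => (0 < z i) && (z i < 1)) _ (iota_ord i)).
  move=> d' T g mg; apply: measurable_and; apply: measurable_fun_ltr => //; exact: mg.
move=> z; apply: filterS unif_ae01 => t; by rewrite upd_same.
Qed.

Lemma rep_ae_distinct : {ae mu, forall y, distinct (Z y)}.
Proof.
have : {ae mu, forall y, forall i : 'I_n, forall j : 'I_n, (i != j) ==> (Z y i != Z y j)}.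
  apply: rep_ae_all => i; apply: rep_ae_all => j.
  have [->|ij] := eqVneq i j; first exact: nearW.
  apply: (@rep_ae R _ _ _ _ _ rep i (fun z => (z i != z j)) _ (iota_ord i)).
    move=> d' T g mg; apply: measurable_neg; apply: measurable_fun_eqr; exact: mg.
  move=> z; apply: filterS (unif_ae0 (z j)) => t.
  by rewrite upd_same upd_neq// eq_sym.
apply: filterS => y h; apply/forallP => i; apply/forallP => j; exact: h.
Qed.

Lemma Sel_cube tau :
  (Sel_eta m mm tau = \int[mu]_y (if in_chamber tau (Z y) then (den (Z y))%:E else 0))%E.
Proof.
rewrite /Sel_eta /Sel.
set F := (fun z : nat -> R => (_%:E)).
have F0 z : (0 <= F z)%E.
  rewrite lee_fin mulr_ge0// prodr_ge0// => i _; first by rewrite mulr_ge0 ?powR_ge0.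
  by rewrite prodr_ge0// => j _; exact: powR_ge0.
have mF : ymeas F.
  apply: ymeas_EFin; apply: ymeasM; apply: ymeas_prod => i _.
    apply: ymeasM; first by apply: ymeas_pow; exact: ymeas_coord.
    by apply: ymeas_pow; apply: ymeasB; [exact: ymeas_cst|exact: ymeas_coord].
  by apply: ymeas_prod => j _; apply: ymeas_pow; apply: ymeasB; exact: ymeas_coord.
have := @iint_II R (ext tau) F (@ext_inj tau) F0 mF n 0 1 (fun=> 0) ler01 (lexx _).
move=> ->.
have c0 z : (0 <= if chain (ext tau) 0 n 1 z then F (fun a => z (ext tau a)) else 0)%E by case: ifP.
have mc : ymeas (fun z => if chain (ext tau) 0 n 1 z then F (fun a => z (ext tau a)) else 0%E).
  move=> d' T g mg; apply: measurable_fun_ifT => //.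
    by apply: measurable_chain => //; exact: measurable_cst.
  by apply: mF => i; exact: mg.
rewrite (II_perm _ c0 mc (ext_perm tau)); have [mZ ZE] := rep; rewrite -ZE//.
apply: ge0_ae_eq_integral => //.
- exact: mc.
- apply: measurable_fun_ifT; [exact: ymeas_chamber| |exact: measurable_cst].
  by apply/measurable_EFinP; exact: ymeas_den.
- by move=> y _; case: ifP => // _; rewrite lee_fin den_ge0.
apply: filterS (filterI rep_ae01 rep_ae_distinct) => y [h1 h2] _ /=.
rewrite chain_chamber//; case: ifP => // hc; rewrite /F; congr (_%:E).
exact: den_chamber.
Qed.

End rep.

End selberg.

(** * Splitting the cube into chambers *)

Section chambers.
Context {R : realType} (n : nat) (m : 'I_n -> R) (mm : 'I_n -> 'I_n -> R).
Hypothesis mmC : forall i j, mm i j = mm j i.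
Implicit Types (tau : {perm 'I_n}) (z : nat -> R).
Local Notation unif := (@unif R).
Local Notation den := (den m mm).
Local Close Scope classical_set_scope.
Local Open Scope set_scope.

Lemma chamber_lt tau z (i j : 'I_n) : in_chamber tau z -> (tau i < tau j)%N = (z j < z i).
Proof.
move=> /forallP h; have imp (u v : 'I_n) : (tau u < tau v)%N -> z v < z u.
  by have /forallP/(_ v)/implyP := h u.
apply/idP/idP; first exact: imp.
case: (ltngtP (tau i) (tau j)) => // [/imp a b|/ord_inj/perm_inj ->]; last by rewrite ltxx.
by have := lt_trans a b; rewrite ltxx.
Qed.

(** On its chamber, [tau i] is the number of coordinates larger than [z i]. *)
Lemma chamber_uniq tau tau' z : in_chamber tau z -> in_chamber tau' z -> tau = tau'.
Proof.
move=> h h'; apply/permP => i; apply: ord_inj.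
rewrite -(@card_perm_lt n tau (tau i)) ?(ltnW (ltn_ord _))//.
rewrite -[RHS](@card_perm_lt n tau' (tau' i)) ?(ltnW (ltn_ord _))//.
congr #|pred_of_set _|; apply/finset.setP => j; rewrite !finset.inE.
by rewrite (chamber_lt _ _ h) (chamber_lt _ _ h').
Qed.

Lemma chamber_ex z : distinct n z -> exists tau, in_chamber tau z.
Proof.
move=> dz.
pose rk (i : 'I_n) := #|[set j : 'I_n | z i < z j]|.
have rk_lt i : (rk i < n)%N.
  rewrite /rk -[X in (_ < X)%N]card_ord -cardsT; apply: proper_card.
  apply/fintype.properP; split; first exact: finset.subsetT.
  by exists i; rewrite !finset.inE ?ltxx.
have rk_mono (i j : 'I_n) : z j < z i -> (rk i < rk j)%N.
  move=> ij; apply: proper_card; apply/fintype.properP; split.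
    by apply/fintype.subsetP => k; rewrite !finset.inE; exact: lt_trans.
  by exists i; rewrite !finset.inE ?ltxx.
have rk_inj : injective (fun i => Ordinal (rk_lt i)).
  move=> i j /(congr1 val) /= e; apply/eqP; apply: contraT => ij.
  have /forallP/(_ i)/forallP/(_ j)/implyP/(_ ij) := dz.
  by rewrite neq_lt => /orP[] /rk_mono; rewrite e ltnn.
exists (perm rk_inj); apply/forallP => i; apply/forallP => j; apply/implyP.
rewrite !permE /= => h; rewrite ltNge; apply/negP; rewrite le_eqVlt => /orP[/eqP e|/rk_mono h'].
  have [ij|ij] := eqVneq i j; first by move: h; rewrite ij ltnn.
  by have /forallP/(_ i)/forallP/(_ j)/implyP/(_ ij) := dz; rewrite e eqxx.
by have := ltn_trans h h'; rewrite ltnn.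
Qed.

Lemma chamber_sum (V : nmodType) z (f : {perm 'I_n} -> V) tau : in_chamber tau z ->
  \sum_t (if in_chamber t z then f t else 0) = f tau.
Proof.
move=> h; rewrite (bigD1 tau) //= h big1 ?addr0// => t tt.
case: ifP => // h'; by rewrite (chamber_uniq h h') eqxx in tt.
Qed.

(** The exponent of [z_i] after [z_i] has been taken out of its differences with the later
    variables. *)
Definition al (i : 'I_n) : R := m i + \sum_(l < n | (i < l)%N) mm i l.

(** The difference of the phases on the two sides of the segment of [z_i], as in [keyhole]; each
    pair of variables is counted at its smaller index. *)
Definition phz (i : 'I_n) z : R[i] :=
  expi (2 * pi * al i) * (\prod_(l < n | (i < l)%N) if z l < z i then 1 else expi (- (mm i l * pi)))
  - \prod_(l < n | (i < l)%N) if z l < z i then 1 else expi (mm i l * pi).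

(** For [z_l > z_i] the full turn of [m_il] contained in [al] and the half turn back leave one half
    turn. *)
Lemma phz_chamber tau z : in_chamber tau z -> \prod_(i < n) phz i z = chamber_phase m mm tau.
Proof.
move=> h; apply: eq_bigr => i _; rewrite /phz /al; congr (_ - _); last first.
  by apply: eq_bigr => l _; rewrite (chamber_lt _ _ h); case: ifP => // _; rewrite mulrC.
rewrite mulrDr mulr_sumr expiD expi_sum -mulrA -big_split; congr (_ * _).
apply: eq_bigr => l _ /=; rewrite (chamber_lt _ _ h); case: ifP => _; rewrite ?mulr1//.
by rewrite -expiD; congr expi; ring.
Qed.

Lemma cn_phz i z : cn (phz i z) <= 2.
Proof.
apply: (le_trans (cnD _ _)); rewrite cnN cnM cn_expi mul1r !cn_prod.
rewrite !big1 => [|l _|l _]; first by lra.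
- by case: ifP; rewrite ?cn1 ?cn_expi.
- by case: ifP; rewrite ?cn1 ?cn_expi.
Qed.

Lemma cmeas_phz d (T : measurableType d) (g : T -> nat -> R) i :
  (forall a, measurable_fun [set: T]%classic (fun y => g y a)) -> cmeas (fun y => phz i (g y)).
Proof.
move=> mg.
have mif (u : 'I_n -> R[i]) : cmeas (fun y => \prod_(l < n | (i < l)%N) if g y l < g y i then 1 else u l).
  apply: cmeas_prod => l Pl; apply: cmeas_if; [|exact: cmeas_cst|exact: cmeas_cst].
  exact: measurable_fun_ltr.
by apply: cmeasB; [apply: cmeasM; [exact: cmeas_cst|exact: mif]|exact: mif].
Qed.

Section rep.
Context (d : measure_display) (X : measurableType d).
Variables (mu : probability X R) (Z : X -> nat -> R).
Hypothesis rep : cube_rep (iota 0 n) mu Z.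
Hypothesis Selfin : forall tau, (Sel_eta m mm tau < +oo)%E.

Let mZ := rep_meas rep.

Definition dench tau z : R := if in_chamber tau z then den z else 0.

Lemma measurable_dench tau : measurable_fun setT (fun y => dench tau (Z y)).
Proof.
apply: measurable_fun_ifT; [exact: ymeas_chamber|exact: ymeas_den|exact: measurable_cst].
Qed.

Lemma dench_ge0 tau z : 0 <= dench tau z.
Proof. by rewrite /dench; case: ifP => // _; exact: den_ge0. Qed.

Lemma Sel_dench tau : (Sel_eta m mm tau = \int[mu]_y (dench tau (Z y))%:E)%E.
Proof.
rewrite (Sel_cube m mmC rep); apply: eq_integral => y _; rewrite /dench.
by case: ifP.
Qed.

Lemma dench_int tau : mu.-integrable [set: X]%classic (fun y => (dench tau (Z y))%:E).
Proof.
apply/integrableP; split; first by apply/measurable_EFinP; exact: measurable_dench.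
under eq_integral do rewrite gee0_abs ?lee_fin ?dench_ge0//.
by rewrite -Sel_dench.
Qed.

Lemma ae_den : {ae mu, forall y, den (Z y) = \sum_tau dench tau (Z y)}.
Proof.
apply: filterS (rep_ae_distinct rep) => y /chamber_ex[tau h].
by rewrite (chamber_sum (fun=> den (Z y)) h).
Qed.

(** There are finitely many chambers, and they cover the cube up to a null set. *)
Lemma den_int : mu.-integrable [set: X]%classic (fun y => (den (Z y))%:E).
Proof.
have mden : measurable_fun setT (fun y => den (Z y)) by exact: ymeas_den.
have i : mu.-integrable [set: X]%classic (fun y => (\sum_tau dench tau (Z y))%:E).
  under eq_fun do rewrite -sumEFin.
  by apply: (integrable_sum measurableT) => tau _; exact: dench_int.
apply/integrableP; split; first exact/measurable_EFinP.
have /integrableP[_] := i; congr (_ < _)%E; apply: ge0_ae_eq_integral => //.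
- by apply: measurableT_comp => //; have /measurable_int := i.
- by apply: measurableT_comp => //; exact/measurable_EFinP.
- by apply: filterS ae_den => y -> _.
Qed.

Lemma Cint_real (f : X -> R) : Cint mu (fun y => (f y)%:C) = (\int[mu]_y f y)%:C.
Proof. by apply: complex_ReIm => //=; rewrite /Rintegral integral0. Qed.

Lemma Cint_chambers : Cint mu (fun y => (den (Z y))%:C * \prod_(i < n) phz i (Z y)) =
  \sum_tau (fine (Sel_eta m mm tau))%:C * chamber_phase m mm tau.
Proof.
have di tau : cintegrable mu (fun y => (dench tau (Z y))%:C).
  by split => /=; [exact: dench_int|exact: integrable0].
transitivity (Cint mu (fun y => \sum_tau chamber_phase m mm tau * (dench tau (Z y))%:C)).
  apply: ae_eq_Cint.
  - apply: cmeasM; first by apply: cmeas_real; exact: ymeas_den.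
    by apply: cmeas_prod => i _; exact: cmeas_phz.
  - apply: cmeas_sum => tau _; apply: cmeasM; first exact: cmeas_cst.
    by apply: cmeas_real; exact: measurable_dench.
  apply: filterS (rep_ae_distinct rep) => y /chamber_ex[tau h].
  rewrite (phz_chamber h) mulrC -(chamber_sum (fun t => chamber_phase m mm t * (den (Z y))%:C) h).
  by apply: eq_bigr => t _; rewrite /dench; case: ifP; rewrite ?mulr0.
rewrite Cint_sum => [|tau _]; last exact: cintegrableZ.
apply: eq_bigr => tau _; rewrite CintZ// mulrC; congr (_ * _).
by rewrite Cint_real Sel_dench.
Qed.

End rep.

End chambers.

(** * Comparing integrals fibre by fibre *)

Section resampling.
Context {R : realType} (s : seq nat) (d : measure_display) (X : measurableType d).
Variables (mu : probability X R) (Z : X -> nat -> R).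
Hypothesis rep : cube_rep s mu Z.
Local Notation unif := (@unif R).

Lemma rep_ae_integrable i (f : (nat -> R) -> R) : ymeas f -> i \in s ->
  mu.-integrable setT (fun y => (f (Z y))%:E) ->
  {ae mu, forall y, unif.-integrable setT (fun t => (f (upd (Z y) i t))%:E)}.
Proof.
move=> mf si fi; have := ae_integrable1 (rep_integrable rep mf si fi).
exact.
Qed.

Lemma rep_ae_cintegrable i (f : (nat -> R) -> R[i]) : cymeas f -> i \in s ->
  cintegrable mu (fun y => f (Z y)) ->
  {ae mu, forall y, cintegrable unif (fun t => f (upd (Z y) i t))}.
Proof.
move=> [m1 m2] si [i1 i2].
by apply: filterS (filterI (rep_ae_integrable m1 si i1) (rep_ae_integrable m2 si i2)) => y [].
Qed.

Lemma measurable_inner i (f : (nat -> R) -> R) : ymeas f -> i \in s ->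
  mu.-integrable setT (fun y => (f (Z y))%:E) ->
  measurable_fun setT (fun y => \int[unif]_t f (upd (Z y) i t)).
Proof.
move=> mf si fi; apply: (@measurableT_comp _ _ _ _ _ _ (@fine R)) => //.
exact: (measurable_fubini_F (rep_integrable rep mf si fi)).
Qed.

(** Reduces an identity over the cube to one-dimensional identities, needed only for almost every
    value of the other coordinates. *)
Lemma rep_Cint_eq i (f g : (nat -> R) -> R[i]) : cymeas f -> cymeas g -> i \in s ->
  cintegrable mu (fun y => f (Z y)) -> cintegrable mu (fun y => g (Z y)) ->
  {ae mu, forall y, Cint unif (fun t => f (upd (Z y) i t)) = Cint unif (fun t => g (upd (Z y) i t))} ->
  Cint mu (fun y => f (Z y)) = Cint mu (fun y => g (Z y)).
Proof.
move=> mf mg si fi gi h; rewrite (rep_Cint rep mf si fi) (rep_Cint rep mg si gi).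
apply: ae_eq_Cint => //.
- by have [a b] := mf; have [u v] := fi; split; [exact: (measurable_inner a si u)|exact: (measurable_inner b si v)].
- by have [a b] := mg; have [u v] := gi; split; [exact: (measurable_inner a si u)|exact: (measurable_inner b si v)].
Qed.

End resampling.

(** * Integrability bounds the exponent at the origin *)

Section exponent.
Context {R : realType} (I : finType) (Pin : pred I).
Variables (p b : I -> R) (a rho : R).
Hypothesis rho0 : 0 < rho.
Hypothesis rho1 : rho <= 1.
Hypothesis p_gt0 : forall l, Pin l -> 0 < p l.
Local Notation unif := (@unif R).

(** The reciprocal of the two-sided upper bound, taken for the exponent [- e]. *)
Lemma powR_lower (m y u e : R) : 0 < m -> m <= u -> u <= y -> (m `^ (- e) + y `^ (- e))^-1 <= u `^ e.
Proof.
move=> m0 mu uy; have u0 := lt_le_trans m0 mu.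
rewrite (_ : u `^ e = (u `^ (- e))^-1); last by rewrite powRN invrK.
rewrite lef_pV2 ?posrE ?powR_gt0//; first exact: powR_between.
by rewrite addr_gt0 ?powR_gt0// (lt_le_trans u0).
Qed.

(** If [a <= -1], the density is at least a positive multiple of [1 / x] near 0, whose integral
    diverges. *)
Lemma kden_exponent : unif.-integrable setT (fun x => (pbox rho x * kden Pin p b a x)%:E) -> -1 < a.
Proof.
move=> ki; rewrite ltNge; apply/negP => a1.
have [|d0 d00 hd0] := @finite_lower_bound R _ [seq l <- enum I | Pin l] (fun l => p l / 2).
  by move=> l; rewrite mem_filter => /andP[Pl _]; rewrite divr_gt0// p_gt0.
pose d := Num.min d0 rho.
have d_gt0 : 0 < d by rewrite lt_min d00.
have d_rho : d <= rho by rewrite ge_min lexx orbT.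
have d_p l : Pin l -> d <= p l / 2.
  by move=> Pl; rewrite ge_min hd0// mem_filter Pl mem_enum.
pose c := \prod_(l | Pin l) (d `^ (- b l) + p l `^ (- b l))^-1.
have c0 : 0 < c.
  by apply: prodr_gt0 => l Pl; rewrite invr_gt0 addr_gt0// powR_gt0 ?p_gt0.
have low x : 0 < x -> x <= d -> c * x^-1 <= kden Pin p b a x.
  move=> x0 xd; rewrite mulrC /kden; apply: ler_pM.
  - by rewrite invr_ge0 ltW.
  - exact: ltW.
  - rewrite -(powR_inv1 (ltW x0)).
    have x1 : x <= 1 by rewrite (le_trans xd)// (le_trans d_rho).
    by apply: ger_powR; [rewrite x0 x1|].
  - apply: ler_prod => l Pl; have dl := d_p l Pl; have pl := p_gt0 Pl.
    apply/andP; split; first by rewrite invr_ge0 addr_ge0 ?powR_ge0.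
    have e : `|x - p l| = p l - x by rewrite ler0_norm; move: xd; lra.
    by rewrite e; apply: powR_lower => //; move: xd x0; lra.
pose M := \int[unif]_x (pbox rho x * kden Pin p b a x).
(* Chosen so that [c] times the integral of [1 / x] over [[de, d]] is [M + c], more than the total
   mass [M]. *)
pose de := d * expR (- (M / c + 1)).
have de0 : 0 < de by rewrite mulr_gt0// expR_gt0.
have M0 : 0 <= M.
  by apply: Rintegral_ge0 => x _; rewrite mulr_ge0 ?kden_ge0// /pbox; case: (_ && _).
have ded : de < d.
  rewrite -[ltRHS]mulr1 ltr_pM2l// expR_lt1 oppr_lt0.
  by rewrite ltr_wpDl// divr_ge0// ltW.
have lnd (t : R) : de <= t -> t <= d -> is_derive t 1 (@ln R) t^-1.
  by move=> h _; apply: is_derive1_ln; exact: lt_le_trans h.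
have lnc (t : R) : de <= t -> t <= d -> {for t, continuous (fun t : R => t^-1)}.
  by move=> h _; apply: inv_continuous; rewrite gt_eqF// (lt_le_trans de0 h).
have mi : measurable_fun setT (fun t : measurableTypeR R => t^-1 : R).
  by apply: measurable_invf; exact: measurable_id.
have I1 := unif_FTC (ltW de0) ded (le_trans d_rho rho1) lnd lnc mi.
have ib : unif.-integrable setT (EFin \o (fun t => c * (box de d t * t^-1))).
  apply: (@integrable_dom R _ (measurableTypeR R) unif (fun t => c * (box de d t * t^-1)) (fun x => pbox rho x * kden Pin p b a x)) => //.
    apply: measurable_funM => //; apply: measurable_funM => //.
    by apply: measurable_box; exact: measurable_id.
  move=> t; rewrite /box; case: (boolP ((de <= t) && (t <= d))) => [/andP[h1 h2]|_]; last first.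
    rewrite mul0r mulr0 normr0 mulr_ge0 ?kden_ge0// /pbox; by case: (_ && _).
  have t0 := lt_le_trans de0 h1.
  rewrite mul1r ger0_norm ?mulr_ge0 ?(ltW c0) ?invr_ge0 ?(ltW t0)//.
  by rewrite /pbox t0 (le_trans h2 d_rho) mul1r; exact: low.
have ib' : unif.-integrable setT (EFin \o (fun t => box de d t * t^-1)).
  have := integrable_scale c^-1 ib; congr (_.-integrable _ _); apply/funext => t /=.
  by rewrite mulrA mulVf ?mul1r// gt_eqF.
have : \int[unif]_t (c * (box de d t * t^-1)) <= M.
  apply: le_Rintegral => // t _.
  rewrite /box; case: (boolP ((de <= t) && (t <= d))) => [/andP[h1 h2]|_]; last first.
    rewrite mul0r mulr0 mulr_ge0 ?kden_ge0// /pbox; by case: (_ && _).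
  have t0 := lt_le_trans de0 h1.
  by rewrite mul1r /pbox t0 (le_trans h2 d_rho) mul1r; exact: low.
rewrite RintegralZl// I1 /de lnM ?posrE ?expR_gt0// expRK.
have -> : c * (ln d - (ln d - (M / c + 1))) = M + c by field; rewrite gt_eqF.
by move: c0; lra.
Qed.

End exponent.

(** * Moving one variable from its segment to its circle *)

Section contour_shift.
Context {R : realType} (n : nat) (m : 'I_n -> R) (mm : 'I_n -> 'I_n -> R) (x : R).
Hypothesis x0 : 0 < x.
Hypothesis x1 : x < 1.
Implicit Types (z : nat -> R) (k : nat) (i j l o : 'I_n).
Local Notation unif := (@unif R).
Local Notation alm := (al m mm).
Local Notation phm := (phz m mm).

Definition rho (i : nat) : R := x ^+ i.

Lemma rho_gt0 (i : nat) : 0 < rho i. Proof. exact: exprn_gt0. Qed.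

Lemma rho_le1 (i : nat) : rho i <= 1.
Proof. by rewrite exprn_ile1 ?ltW. Qed.

Lemma rho_lt (i l : nat) : (i < l)%N -> (rho i)^-1 * rho l <= x.
Proof.
move=> il; rewrite /rho -(subnKC il) addSn -addnS exprD mulKf ?gt_eqF ?exprn_gt0//.
by rewrite exprS ger_pMr// exprn_ile1 ?ltW.
Qed.

Lemma rho_mono (i l : nat) : (i < l)%N -> rho l < rho i.
Proof. by move=> il; rewrite /rho ltr_iXn2l. Qed.

(** Modulus and, below, angle of [z_l / z_i] for [z_i] on its circle. The coordinate [z l] has two
    meanings: for [l < k] it is the angle of [z_l], counted in turns, on the circle of radius
    [rho l]; otherwise it is the point on the segment itself. *)
Definition Wr k z (i l : 'I_n) : R := (rho i)^-1 * (if (l < k)%N then rho l else z l).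
Definition Wp k z (i l : 'I_n) : R := (if (l < k)%N then 2 * pi * z l else 0) - 2 * pi * z i.
Definition W k z (i l : 'I_n) : R[i] := (Wr k z i l)%:C * expi (Wp k z i l).

Definition circ k i z : R[i] := expi ((alm i + 1) * (2 * pi * z i)) *
  \prod_(l < n | (i < l)%N) ppow (mm i l) (1 - W k z i l).

(** The density of [z_i] on its segment. It involves only the coordinates from [i] on, which is what
    allows an induction on the first index. *)
Definition gfac i z : R := pbox (rho i) (z i) *
  kden (fun l : 'I_n => (i < l)%N) (fun l : 'I_n => z l) (mm i) (m i) (z i).

Definition gden k z : R := \prod_(j < n | (k <= j)%N) gfac j z.

(* The integrand after the variables z_0, ..., z_(k-1) have been moved from the
   segments [0, rho_i] to the circles of radius rho_i. *)
Definition Phi k z : R[i] := \prod_(j < n)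
  if (k <= j)%N then (gfac j z)%:C * phm j z else circ k j z.

Lemma pbox_ge0 (r u : R) : 0 <= pbox r u.
Proof. by rewrite /pbox; case: (_ && _). Qed.

Lemma gfac_ge0 i z : 0 <= gfac i z.
Proof. by rewrite mulr_ge0 ?pbox_ge0 ?kden_ge0. Qed.

Lemma gden_ge0 k z : 0 <= gden k z.
Proof. by rewrite prodr_ge0// => j _; exact: gfac_ge0. Qed.

Lemma gden_neq0 k z : gden k z != 0 -> forall j, (k <= j)%N -> 0 < z j /\ z j <= rho j.
Proof.
move=> /prodf_neq0 h j /h; rewrite /gfac mulf_eq0 negb_or => /andP[+ _].
by rewrite /pbox; case: (boolP (_ && _)) => [/andP[]|]; rewrite // eqxx.
Qed.

Lemma gden_recl i z : gden i z = gfac i z * gden i.+1 z.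
Proof.
rewrite /gden (bigD1 i)//=; congr (_ * _); apply: eq_bigl => j.
by rewrite ltn_neqAle eq_sym andbC.
Qed.

Lemma gfac_upd i j z t : (i < j)%N -> gfac j (upd z i t) = gfac j z.
Proof.
move=> ij; rewrite /gfac /kden !upd_neq ?gtn_eqF//; congr (_ * (_ * _)).
apply: eq_bigr => l jl; rewrite upd_neq// gtn_eqF//; exact: ltn_trans jl.
Qed.

Lemma gden_upd i z t : gden i.+1 (upd z i t) = gden i.+1 z.
Proof. by apply: eq_bigr => j ij; exact: gfac_upd. Qed.

Lemma phz_upd i j z t : (i < j)%N -> phm j (upd z i t) = phm j z.
Proof.
move=> ij; rewrite /phz upd_neq ?gtn_eqF//; congr (_ * _ - _); apply: eq_bigr => l jl;
  by rewrite upd_neq// gtn_eqF// (ltn_trans ij).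
Qed.

Lemma W_bound k z i l : (forall j, (k <= j)%N -> 0 < z j /\ z j <= rho j) -> (i < l)%N ->
  0 <= Wr k z i l <= x.
Proof.
move=> h il; rewrite /Wr; case: (ltnP l k) => lk.
  by rewrite mulr_ge0 ?invr_ge0 ?(ltW (rho_gt0 _))//= rho_lt.
have [z0 zl] := h l lk; rewrite mulr_ge0 ?invr_ge0 ?(ltW (rho_gt0 _)) ?(ltW z0)//=.
by apply: le_trans (rho_lt il); rewrite ler_wpM2l// invr_ge0 ltW// rho_gt0.
Qed.

Lemma ppow_W_bound k z i l : (forall j, (k <= j)%N -> 0 < z j /\ z j <= rho j) -> (i < l)%N ->
  cn (ppow (mm i l) (1 - W k z i l)) <= (1 - x) `^ mm i l + 2 `^ mm i l.
Proof.
move=> h il; have /andP[w0 w1] := W_bound h il.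
rewrite cn_ppow; apply: powR_between; first by rewrite subr_gt0.
  apply: le_trans (cn_1Bexpi_ge _ w0); rewrite ger0_norm; first lra.
  by rewrite subr_ge0 (le_trans w1)// ltW.
by apply: le_trans (cn_1Bexpi_le _ w0) _; move: x1; lra.
Qed.

Lemma circ_bound k i z : (forall j, (k <= j)%N -> 0 < z j /\ z j <= rho j) ->
  cn (circ k i z) <= \prod_(l < n | (i < l)%N) ((1 - x) `^ mm i l + 2 `^ mm i l).
Proof.
move=> h; rewrite /circ cnM cn_expi mul1r cn_prod; apply: ler_prod => l il.
by rewrite cn_ge0 /=; exact: ppow_W_bound.
Qed.

(** Circles contribute bounded factors, since all ratios have modulus at most [x < 1]. The summands
    1 keep the constant at least 1, so that it also serves the indices still on segments. *)
Lemma Phi_bound k z : cn (Phi k z) <= 2 ^+ n *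
  (\prod_(i < n) \prod_(l < n | (i < l)%N) (1 + ((1 - x) `^ mm i l + 2 `^ mm i l))) * gden k z.
Proof.
have w0 i l : 0 <= (1 - x) `^ mm i l + 2 `^ mm i l by rewrite addr_ge0 ?powR_ge0.
have [g0|g0] := eqVneq (gden k z) 0.
  suff -> : Phi k z = 0 by rewrite cn0 g0 mulr0.
  move/eqP: g0; rewrite prodf_seq_eq0 => /hasP[j _ /andP[kj /eqP gj]].
  by apply/eqP; rewrite prodf_seq_eq0; apply/hasP; exists j; rewrite ?mem_index_enum//= kj gj mul0r.
have h := gden_neq0 g0.
rewrite /Phi cn_prod /gden [X in _ <= _ * X]big_mkcond /=.
rewrite (_ : 2 ^+ n = \prod_(i < n) 2 :> R); last by rewrite prodr_const card_ord.
rewrite -!big_split /=; apply: ler_prod => j _; rewrite cn_ge0 /=.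
have p1 : 1 <= \prod_(l < n | (j < l)%N) (1 + ((1 - x) `^ mm j l + 2 `^ mm j l)).
  by elim/big_rec : _ => // l u _ u1; rewrite -[leLHS]mulr1 ler_pM ?lerDl.
case: ifP => kj.
  rewrite cnM cn_real ger0_norm ?gfac_ge0// mulrC ler_wpM2r ?gfac_ge0//.
  apply: le_trans (cn_phz _ _ _ _) _.
  by rewrite ler_peMr.
rewrite mulr1; apply: le_trans (circ_bound j h) _.
apply: (@le_trans _ _ (\prod_(l < n | (j < l)%N) (1 + ((1 - x) `^ mm j l + 2 `^ mm j l)))).
  by apply: ler_prod => l _; rewrite w0 /= lerDr.
by rewrite ler_peMl// ?ler1n// (le_trans _ p1).
Qed.

Lemma W_change i j l z : l != i -> W i.+1 z j l = W i z j l.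
Proof.
move=> li; rewrite /W /Wr /Wp ltnS leq_eqVlt.
by rewrite (_ : (nat_of_ord l == i) = false) //; apply/negbTE.
Qed.

Definition circ_rest i j z : R[i] := expi ((alm j + 1) * (2 * pi * z j)) *
  \prod_(l < n | (j < l)%N && (l != i)) ppow (mm j l) (1 - W i z j l).

(** The factors without [z_i]. They are common to the stages before and after the move, so the
    comparison takes place in one variable. *)
Definition Rest i z : R[i] := \prod_(j < n | j != i)
  if (i < j)%N then (gfac j z)%:C * phm j z else circ_rest i j z.

Lemma Rest_upd i z t : Rest i (upd z i t) = Rest i z.
Proof.
apply: eq_bigr => j ji; case: ifP => ij; first by rewrite gfac_upd ?phz_upd.
rewrite /circ_rest upd_neq//; congr (_ * _); apply: eq_bigr => l /andP[_ li].
by rewrite /W /Wr /Wp !upd_neq.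
Qed.

Lemma prod_lt_neq (i : 'I_n) (f g : 'I_n -> R[i]) :
  \prod_(j < n | j != i) (if (i < j)%N then f j else g j) =
  \prod_(j < n | j != i) (if (j < i)%N then g j else f j).
Proof.
apply: eq_bigr => j; rewrite -(inj_eq val_inj) /=; by case: ltngtP.
Qed.

Lemma prod_below (i : 'I_n) (f : 'I_n -> R[i]) :
  \prod_(j < n | j != i) (if (i < j)%N then 1 else f j) = \prod_(j < n | (j < i)%N) f j.
Proof.
rewrite prod_lt_neq -big_mkcondr; apply: eq_bigl => j.
by rewrite -(inj_eq val_inj) /=; case: ltngtP.
Qed.

Lemma circ_split i j z k : (j < i)%N -> (forall l, l != i -> W k z j l = W i z j l) ->
  circ k j z = circ_rest i j z * ppow (mm j i) (1 - W k z j i).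
Proof.
move=> ji h; rewrite /circ /circ_rest (bigD1 i)//= [X in _ * X = _]mulrC [LHS]mulrA.
congr (_ * _ * _); apply: eq_bigr => l /andP[_ li]; by rewrite h.
Qed.

Lemma Phi_step i z : Phi i z = Rest i z *
  ((gfac i z)%:C * phm i z * \prod_(o < n | (o < i)%N) ppow (mm o i) (1 - W i z o i)).
Proof.
rewrite /Phi (bigD1 i)//= leqnn mulrC [RHS]mulrCA [RHS]mulrC; congr (_ * _).
rewrite -prod_below /Rest -big_split /=; apply: eq_bigr => j ji.
have ji' : nat_of_ord i != j by rewrite eq_sym.
rewrite (leq_eqVlt i) (negbTE ji') /=; case: (ltngtP i j) => [_|ij|e].
- by rewrite mulr1.
- by apply: circ_split => //.
- by rewrite e eqxx in ji'.
Qed.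

Lemma Phi_stepS i z : Phi i.+1 z = Rest i z *
  (circ i.+1 i z * \prod_(o < n | (o < i)%N) ppow (mm o i) (1 - W i.+1 z o i)).
Proof.
rewrite /Phi (bigD1 i)//= ltnn mulrC [RHS]mulrCA [RHS]mulrC; congr (_ * _).
rewrite -prod_below /Rest -big_split /=; apply: eq_bigr => j ji.
have ji' : nat_of_ord i != j by rewrite eq_sym.
case: (ltngtP i j) => [_|ij|e].
- by rewrite mulr1.
- by apply: circ_split => // l; exact: W_change.
- by rewrite e eqxx in ji'.
Qed.

(** As a function of the angle of [z_i], the stage on the circle is a keyhole integrand: the later
    variables are its inner branch points, the earlier ones lie on larger circles and are the outer
    ones. The power of [rho i], absent from [circ], is divided out. *)
Lemma key_Phi i z t : Phi i.+1 (upd z i t) = ((rho i `^ alm i)%:C)^-1 * Rest i z *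
  key (fun l : 'I_n => (i < l)%N) (fun o : 'I_n => (o < i)%N) (fun l : 'I_n => z l) (mm i)
    (fun o : 'I_n => (rho o)^-1) (fun o : 'I_n => 2 * pi * z o) (fun o => mm o i)
    (alm i) (rho i) t.
Proof.
rewrite Phi_stepS Rest_upd [_^-1 * Rest i z]mulrC -[_ * _ * key _ _ _ _ _ _ _ _ _ _]mulrA; congr (_ * _).
rewrite /key -3!mulrA mulKf; last first.
  by rewrite -cn_eq0 cn_real normr_eq0 gt_eqF// powR_gt0 ?rho_gt0.
rewrite /circ upd_same; rewrite -!mulrA; congr (_ * (_ * _)); apply: eq_bigr => l il; congr (ppow _ (1 - _)).
- rewrite /W /uin /Wr /Wp ltnS leqNgt il /= upd_same upd_neq ?gtn_eqF//.
  by congr (_%:C * expi _); [exact: mulrC|exact: sub0r].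
- by rewrite /W /uout /Wr /Wp ltnSn upd_same upd_neq ?ltn_eqF.
Qed.

Lemma kden_Phi i z t : Phi i (upd z i t) = Rest i z *
  ((pbox (rho i) t * kden (fun l : 'I_n => (i < l)%N) (fun l : 'I_n => z l) (mm i) (m i) t)%:C *
   kE (fun o : 'I_n => (o < i)%N) (fun o : 'I_n => (rho o)^-1) (fun o : 'I_n => 2 * pi * z o) (fun o => mm o i) t *
    (expi (2 * pi * alm i) * (\prod_(l < n | (i < l)%N) if z l < t then 1 else expi (- (mm i l * pi)))
     - \prod_(l < n | (i < l)%N) if z l < t then 1 else expi (mm i l * pi))).
Proof.
rewrite Phi_step Rest_upd; congr (_ * _); rewrite mulrAC; congr (_ * _ * _).
- rewrite /gfac upd_same; congr ((_ * (_ * _))%:C); apply: eq_bigr => l il.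
  by rewrite upd_neq// gtn_eqF.
- apply: eq_bigr => o oi; rewrite /W /Wr /Wp ltnn upd_same upd_neq ?ltn_eqF// sub0r.
  by [].
- rewrite /phz upd_same; congr (_ * _ - _); apply: eq_bigr => l il; by rewrite upd_neq// gtn_eqF.
Qed.

Lemma ymeas_gfac i : ymeas (gfac i).
Proof.
apply: ymeasM; first by move=> d T g mg; apply: measurable_pbox; exact: mg.
apply: ymeasM; first by apply: ymeas_pow; exact: ymeas_coord.
apply: ymeas_prod => l _; apply: ymeas_pow; apply: ymeas_norm; apply: ymeasB; exact: ymeas_coord.
Qed.

Lemma ymeas_gden k : ymeas (gden k).
Proof. by apply: ymeas_prod => i _; exact: ymeas_gfac. Qed.

Lemma cmeas_W d (T : measurableType d) (g : T -> nat -> R) k i l :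
  (forall a, measurable_fun setT (fun y => g y a)) -> cmeas (fun y => W k (g y) i l).
Proof.
move=> mg; apply: cmeasM.
  apply: cmeas_real; apply: measurable_funM => //.
  by case: (l < k)%N.
apply: cmeas_expi; apply: measurable_funB; last exact: measurable_funM.
by case: (l < k)%N => //; exact: measurable_funM.
Qed.

Lemma cmeas_circ d (T : measurableType d) (g : T -> nat -> R) k i :
  (forall a, measurable_fun setT (fun y => g y a)) -> cmeas (fun y => circ k i (g y)).
Proof.
move=> mg; apply: cmeasM.
  by apply: cmeas_expi; apply: measurable_funM => //; exact: measurable_funM.
by apply: cmeas_prod => l _; apply: cmeas_ppow; apply: cmeas_1B; exact: cmeas_W.
Qed.

Lemma cmeas_Phi d (T : measurableType d) (g : T -> nat -> R) k :
  (forall a, measurable_fun setT (fun y => g y a)) -> cmeas (fun y => Phi k (g y)).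
Proof.
move=> mg; apply: cmeas_prod => j _; case: (k <= j)%N; last exact: cmeas_circ.
by apply: cmeasM; [apply: cmeas_real; exact: ymeas_gfac|exact: cmeas_phz].
Qed.

Lemma cymeas_Phi k : cymeas (Phi k).
Proof. by split=> d T g mg; have [] := cmeas_Phi k mg. Qed.

(* Uniform lower bound for the mass of the factor of z_i when the later variables lie
   in their segments: integrability can be pushed down to the factors of the later ones. *)
Lemma gfac_mass i : exists2 c, 0 < c & forall z, gden i.+1 z != 0 ->
  (c%:E <= \int[unif]_t (gfac i (upd z i t))%:E)%E.
Proof.
(* From the midpoint [a] of the gap up to [rho i], the distance to every later variable is at least
   [e], as these are at most [rho i.+1]. *)
pose a := (rho i + rho i.+1) / 2; pose e := (rho i - rho i.+1) / 2.
have rr : rho i.+1 < rho i by exact: rho_mono.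
have r1 := rho_le1 i; have rS0 := rho_gt0 i.+1.
have a0 : 0 < a by rewrite /a; lra.
have e0 : 0 < e by rewrite /e; lra.
have ar : a < rho i by rewrite /a; lra.
pose c := (a `^ (- m i) + 1 `^ (- m i))^-1 *
  \prod_(l < n | (i < l)%N) (e `^ (- mm i l) + 1 `^ (- mm i l))^-1.
have c0 : 0 < c.
  rewrite mulr_gt0 ?invr_gt0 ?addr_gt0 ?powR_gt0//; apply: prodr_gt0 => l _.
  by rewrite invr_gt0 addr_gt0// powR_gt0.
exists (c * (rho i - a)); first by rewrite mulr_gt0// subr_gt0.
move=> z /gden_neq0 hz.
have mb : measurable_fun setT (fun t : measurableTypeR R => box a (rho i) t * 1).
  by apply: measurable_funM => //; apply: measurable_box; exact: measurable_id.
have ib : unif.-integrable setT (EFin \o (fun t : measurableTypeR R => box a (rho i) t * 1)).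
  apply: (integrable_dom (h' := cst 1)) => //; first exact: prob_integrable_cst.
  by move=> t; rewrite mulr1 box_le1.
have := @unif_FTC R (fun t => t) (fun=> 1) a (rho i) (ltW a0) ar r1 _ _ _.
move=> I; have {}I := I (fun t _ _ => is_derive_id t 1) _ (measurable_cst _).
have {}I : \int[unif]_t (box a (rho i) t * 1) = rho i - a.
  by apply: I => t _ _; exact: cst_continuous.
have -> : (c * (rho i - a))%:E = (\int[unif]_t (c * (box a (rho i) t * 1))%:E)%E.
  rewrite -I -RintegralZl// /Rintegral fineK//.
  by apply: integrable_fin_num => //; exact: integrable_scale.
apply: ge0_le_integral => //.
- by move=> t _; rewrite lee_fin mulr_ge0 ?(ltW c0)// mulr1 /box; case: (_ && _).
- by apply/measurable_EFinP; exact: measurable_funM.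
- apply/measurable_EFinP.
  by apply: ymeas_gfac => j; exact: measurable_upd1.
move=> t _; rewrite lee_fin mulr1 /box.
case: (boolP ((a <= t) && (t <= rho i))) => [/andP[h1 h2]|_]; last by rewrite mulr0 gfac_ge0.
rewrite mulr1 /gfac upd_same /pbox (lt_le_trans a0 h1) h2 mul1r /kden.
apply: ler_pM.
- by rewrite invr_ge0 addr_ge0 ?powR_ge0.
- by rewrite prodr_ge0// => l _; rewrite invr_ge0 addr_ge0 ?powR_ge0.
- by apply: powR_lower => //; exact: le_trans r1.
apply: ler_prod => l il; rewrite invr_ge0 addr_ge0 ?powR_ge0//= upd_neq ?gtn_eqF//.
have [z0 zl] := hz l il.
have rl : rho l <= rho i.+1 by rewrite /rho ler_iXn2l.
have eg : a - rho i.+1 = e by rewrite /a /e; field.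
rewrite ger0_norm; first by apply: powR_lower => //; lra.
lra.
Qed.

Section rep.
Context (d : measure_display) (X : measurableType d).
Variables (mu : probability X R) (Z : X -> nat -> R).
Hypothesis rep : cube_rep (iota 0 n) mu Z.
Hypothesis den_int : mu.-integrable [set: X] (fun y => (den m mm (Z y))%:E).

Let mZ := rep_meas rep.

(** By Tonelli the integral of [gden k] is at least [c] times that of [gden k.+1], so finiteness
    passes to the product with one factor less. *)
Lemma gden_int k : (k <= n)%N -> mu.-integrable [set: X] (fun y => (gden k (Z y))%:E).
Proof.
elim: k => [_|k IH kn].
  apply: (@integrable_dom _ _ _ mu (fun y => gden 0 (Z y)) (fun y => den m mm (Z y))) => //.
    exact: ymeas_gden.
  move=> y; rewrite ger0_norm ?gden_ge0// /gden /den.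
  rewrite [leLHS](eq_bigl xpredT)//; apply: ler_prod => j _; rewrite gfac_ge0 /= /gfac /kden.
  apply: ler_piMl; last by rewrite /pbox; case: (_ && _).
  by rewrite mulr_ge0 ?powR_ge0// prodr_ge0// => l _; exact: powR_ge0.
have {}IH := IH (ltnW kn); pose i := Ordinal kn.
have [c c0 hc] := gfac_mass i.
apply/integrableP; split; first by apply/measurable_EFinP; exact: ymeas_gden.
under eq_integral do rewrite gee0_abs ?lee_fin ?gden_ge0//.
have low : (\int[mu]_y (c%:E * (gden k.+1 (Z y))%:E) <= \int[mu]_y (gden k (Z y))%:E)%E.
  rewrite (rep_resample rep (F := fun z => (gden k z)%:E) _ _ (iota_ord i)); first last.
  - by apply: ymeas_EFin; exact: ymeas_gden.
  - by move=> z; rewrite lee_fin gden_ge0.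
  apply: ge0_le_integral => //.
  - by move=> y _; rewrite mule_ge0// lee_fin ?gden_ge0 ?(ltW c0).
  - by apply: emeasurable_funM => //; apply/measurable_EFinP; exact: ymeas_gden.
  - apply: (@II_meas R [:: i : nat] (fun z => (gden k z)%:E)) => //.
      by move=> z; rewrite lee_fin gden_ge0.
    by apply: ymeas_EFin; exact: ymeas_gden.
  move=> y _; under eq_integral do rewrite (gden_recl i) gden_upd mulrC EFinM.
  rewrite ge0_integralZl//; first last.
  - by rewrite lee_fin gden_ge0.
  - by move=> t _; rewrite lee_fin gfac_ge0.
  - apply/measurable_EFinP.
    by apply: ymeas_gfac => j; exact: measurable_upd1.
  have [->|g0] := eqVneq (gden k.+1 (Z y)) 0; first by rewrite mule0 mul0e.
  by rewrite muleC lee_wpmul2l ?lee_fin ?gden_ge0// hc.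
have fin : (\int[mu]_y (gden k (Z y))%:E < +oo)%E.
  have /integrableP[_] := IH; congr (_ < _)%E; apply: eq_integral => y _.
  by rewrite gee0_abs ?lee_fin ?gden_ge0.
rewrite ge0_integralZl// in low; first last.
- by rewrite lee_fin ltW.
- by move=> y _; rewrite lee_fin gden_ge0.
- by apply/measurable_EFinP; exact: ymeas_gden.
rewrite ltNge leye_eq; apply/negP => /eqP e.
by move: (le_lt_trans low fin); rewrite e gt0_muley ?lte_fin// ltxx.
Qed.

Lemma Phi_int k : (k <= n)%N -> cintegrable mu (fun y => Phi k (Z y)).
Proof.
move=> kn; apply: (cintegrable_dom _ _ (fun y => Phi_bound k (Z y))).
  exact: cmeas_Phi.
by apply: integrable_scale; exact: gden_int.
Qed.

(** [2 pi i rho] comes from [dz] on the circle, and the power of the radius is the one omitted in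
    [circ]. *)
Definition circfac i : R[i] := twopii * (rho i)%:C * (rho i `^ alm i)%:C.

(** The keyhole identity on almost every fibre. Its hypotheses are recovered from the fibre:
    integrability from that of [gden i], the bound on the exponent from [kden_exponent], distinct
    inner points from almost sure distinctness. *)
Lemma Cint_stage i : Cint mu (fun y => Phi i (Z y)) = circfac i * Cint mu (fun y => Phi i.+1 (Z y)).
Proof.
have si := iota_ord i.
have PS := Phi_int (ltn_ord i); have P0 := Phi_int (ltnW (ltn_ord i)).
rewrite -CintZ//.
apply: (@rep_Cint_eq R _ _ _ _ _ rep i _ (fun z => circfac i * Phi i.+1 z) (cymeas_Phi i) _ si P0 (cintegrableZ (circfac i) PS)).
  by split=> d' T g mg; have [] := cmeasM (cmeas_cst _ (circfac i)) (cmeas_Phi i.+1 mg).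
have gi := gden_int (ltnW (ltn_ord i)).
have gS := rep_ae_integrable rep (ymeas_gden i) si gi.
have AP := rep_ae_cintegrable rep (cymeas_Phi i) si P0.
have APS := rep_ae_cintegrable rep (cymeas_Phi i.+1) si PS.
apply: filterS (filterI (filterI AP APS) (filterI gS (rep_ae_distinct rep))).
move=> y [[h1 h2] [h3 dist]].
set z := Z y in h1 h2 h3 dist *.
(* If the common factor vanishes, both fibres are zero. Otherwise no later density vanishes, which
   puts the later variables on their segments. *)
have [r0|r0] := eqVneq (Rest i z) 0.
  transitivity (Cint unif (fun=> 0 : R[i])); [apply: eq_Cint => t|apply/esym; apply: eq_Cint => t].
  - by rewrite kden_Phi r0 mul0r.
  - by rewrite key_Phi r0 mulr0 mul0r mulr0.
have g0 : gden i.+1 z != 0.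
  apply/prodf_neq0 => j ij; apply: contraNneq r0 => gj.
  rewrite /Rest (bigD1 j) /=; last by rewrite -(inj_eq val_inj) /= gtn_eqF.
  by rewrite ij gj mul0r mul0r.
have hz := gden_neq0 g0.
(* The fibre of [gden i] is this density times the nonzero constant [gden i.+1 z], which is divided
   out. *)
have ki : unif.-integrable setT (fun t => (pbox (rho i) t *
    kden (fun l : 'I_n => (i < l)%N) (fun l : 'I_n => z l) (mm i) (m i) t)%:E).
  have := integrable_scale (gden i.+1 z)^-1 h3; congr (_.-integrable _ _); apply/funext => t /=.
  rewrite gden_recl gden_upd mulrC mulfK// /gfac upd_same; congr ((_ * (_ * _))%:E).
  by apply: eq_bigr => l il; rewrite upd_neq// gtn_eqF.
have pg0 l : (i < l)%N -> 0 < z l by move=> /hz[].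
have m1 := kden_exponent (rho_gt0 i) (rho_le1 i) pg0 ki.
have plt l : (i < l)%N -> z l < rho i.
  by move=> il; have [_ h] := hz l il; exact: le_lt_trans h (rho_mono il).
have pinj l l' : (i < l)%N -> (i < l')%N -> l != l' -> z l != z l'.
  by move=> _ _; have /forallP/(_ l)/forallP/(_ l')/implyP := dist.
have cge o : (o < i)%N -> 0 <= (rho o)^-1 by move=> _; rewrite invr_ge0 ltW// rho_gt0.
have clt o : (o < i)%N -> (rho o)^-1 * rho i < 1 by move=> oi; exact: le_lt_trans (rho_lt oi) x1.
have := keyhole (fun o : 'I_n => 2 * pi * z o) (fun o : 'I_n => mm o i) (rho_gt0 i) (rho_le1 i)
  m1 pg0 plt pinj cge clt (erefl (alm i)) ki.
set A := (fun t : measurableTypeR R => _); set B := (fun t : R => key _ _ _ _ _ _ _ _ _ t) => AB.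
have rn : ((rho i `^ alm i)%:C)^-1 != 0.
  by rewrite invr_eq0 -cn_eq0 cn_real normr_eq0 gt_eqF// powR_gt0 ?rho_gt0.
have EA t : Phi i (upd z i t) = Rest i z * A t by exact: kden_Phi.
have EB t : Phi i.+1 (upd z i t) = ((rho i `^ alm i)%:C)^-1 * Rest i z * B t by exact: key_Phi.
have iA : cintegrable unif A.
  have := cintegrableZ (Rest i z)^-1 h1; congr (cintegrable _ _); apply/funext => t.
  by rewrite EA mulKf.
have iB : cintegrable unif B.
  have := cintegrableZ (((rho i `^ alm i)%:C)^-1 * Rest i z)^-1 h2; congr (cintegrable _ _); apply/funext => t.
  by rewrite EB mulKf// mulf_neq0.
transitivity (Rest i z * Cint unif A); first by rewrite -CintZ//; exact: eq_Cint.
rewrite AB.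
transitivity (circfac i * ((rho i `^ alm i)%:C)^-1 * Rest i z * Cint unif B); last first.
  by rewrite -CintZ//; apply: eq_Cint => t; rewrite EB !mulrA.
rewrite /circfac; rewrite -[X in _ = X * _ * _]mulrA mulfV ?mulr1; last by rewrite -invr_eq0.
by rewrite mulrA [Rest i z * _]mulrC.
Qed.

Lemma Cint_contour : Cint mu (fun y => Phi 0 (Z y)) = (\prod_(i < n) circfac i) * Cint mu (fun y => Phi n (Z y)).
Proof.
have : forall k, (k <= n)%N -> Cint mu (fun y => Phi 0 (Z y)) =
    (\prod_(i < n | (i < k)%N) circfac i) * Cint mu (fun y => Phi k (Z y)).
  elim=> [_|k IH kn]; first by rewrite big_pred0 ?mul1r.
  rewrite (IH (ltnW kn)) (Cint_stage (Ordinal kn)) mulrA; congr (_ * _).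
  rewrite [RHS](bigD1 (Ordinal kn))//= mulrC; congr (_ * _); apply: eq_bigl => j.
  by rewrite -(inj_eq val_inj) /= ltnS ltn_neqAle andbC.
move=> /(_ n (leqnn n)) ->; congr (_ * _); apply: eq_bigl => j; by rewrite ltn_ord.
Qed.

End rep.

End contour_shift.

(** * Residues as means over the circle *)

Section residues.
Context {R : realType}.
Local Notation unif := (@unif R).

Lemma Cint_cst d (X : measurableType d) (mu : probability X R) (c : R[i]) : Cint mu (fun=> c) = c.
Proof.
have mu1 : mu setT = 1%E by exact: probability_setT.
by apply: complex_ReIm => /=; rewrite /Rintegral integral_cst// [X in (_ * X)%E]mu1 mule1.
Qed.

Lemma twopii_neq0 : twopii != 0 :> R[i].
Proof. by rewrite eq_complex /= eqxx /= mulf_neq0// gt_eqF// pi_gt0. Qed.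

Lemma resid_Cint (a : R) : resid a = Cint unif (fun t => expi ((a + 1) * (2 * pi * t))).
Proof.
rewrite /resid; case: eqVneq => [->|an1].
  under eq_Cint do rewrite addNr mul0r expi0; by rewrite Cint_cst.
have a1 : a + 1 != 0 by rewrite -(opprK 1) subr_eq0.
have k0 : twopii * (a + 1)%:C != 0 :> R[i].
  by rewrite mulf_neq0 ?twopii_neq0// -cn_eq0 cn_real normr_eq0.
(* A primitive of the integrand, available because [a + 1] is nonzero; for an integer [a] it takes
   the same value at both ends. *)
pose f (t : R) : R[i] := (twopii * (a + 1)%:C)^-1 * expi ((a + 1) * (2 * pi * t)).
have fd (t : R) : cder f t (expi ((a + 1) * (2 * pi * t))).
  have id : is_derive t 1 (fun t : R => (a + 1) * (2 * pi * t)) ((a + 1) * (2 * pi)).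
    rewrite [X in is_derive _ _ X _](_ : _ = fun t : R => (a + 1) * (2 * pi) * t + 0).
      exact: is_derive_scale.
    by apply/funext => u; rewrite addr0 mulrA.
  have := cderM (cder_cst (twopii * (a + 1)%:C)^-1 t) (cder_expi id).
  congr (cder _ _ _); rewrite mul0r add0r mulrA.
  rewrite (_ : 0 +i* _ = twopii * (a + 1)%:C) ?mulVf ?mul1r//.
  by apply: complex_ReIm; rewrite ?cReM ?cImM /=; ring.
have fc (t : R) : ccvg (nbhs t) (fun u => expi ((a + 1) * (2 * pi * u))) (expi ((a + 1) * (2 * pi * t))).
  apply: ccvg_expi; apply: cvgM; first exact: cvg_cst.
  by apply: cvgM; [exact: cvg_cst|exact: cvg_id].
have fm : cmeas (fun t : measurableTypeR R => expi ((a + 1) * (2 * pi * t))).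
  by apply: cmeas_expi; apply: measurable_funM => //; apply: measurable_funM => //; exact: measurable_id.
have := @unif_CFTC R f _ 0 1 (lexx _) ltr01 (lexx _) (fun t _ _ => fd t) (fun t _ _ => fc t) fm.
rewrite (_ : Cint unif _ = Cint unif (fun t => expi ((a + 1) * (2 * pi * t)))); last first.
  apply: ae_eq_Cint => //.
    by apply: cmeasM => //; apply: cmeas_real; apply: measurable_box; exact: measurable_id.
  by apply: filterS unif_ae01 => t /andP[t0 t1]; rewrite /box !ltW// mul1r.
move=> ->; rewrite /f !mulr0 expi0 -mulrBr mulr1 mulrC (mulrC (a + 1)).
case: asboolP => // -[z az].
suff -> : expi (2 * pi * (a + 1)) = 1 :> R[i] by rewrite subrr mulr0.
rewrite az; case: z {az} => k.
  by rewrite (_ : k%:~R + 1 = k.+1%:R) ?expi_2pi_nat// -natr1 -pmulrn.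
(* [Negz k] stands for [- k.+1], so [a + 1] is [- k]. *)
rewrite (_ : (Negz k)%:~R + 1 = - k%:R) ?mulrN ?expiN ?expi_2pi_nat ?invr1//.
by rewrite NegzE mulrNz -pmulrn -natr1 opprD subrK.
Qed.

End residues.

(** * Products over pairs of indices *)

Section upairs.
Context (n : nat).

Lemma big_upairs (V : Type) (idx : V) (op : Monoid.com_law idx) (G : 'I_n -> 'I_n -> V) :
  \big[op/idx]_(p : upairs n) G (val p).1 (val p).2 =
  \big[op/idx]_(i < n) \big[op/idx]_(j < n | (i < j)%N) G i j.
Proof.
rewrite pair_big_dep /=.
exact: (esym (big_sub [pred p : 'I_n * 'I_n | (p.1 < p.2)%N] (fun p => G p.1 p.2))).
Qed.

Lemma kvalE (k : {ffun upairs n -> nat}) (p : upairs n) : kval k (val p).1 (val p).2 = k p.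
Proof.
by rewrite /kval -surjective_pairing valK.
Qed.

End upairs.

(** * Truncated series as integrals over the circles *)

Section box_sums.
Context {R : realType} (n : nat) (m : 'I_n -> R) (mm : 'I_n -> 'I_n -> R).
Implicit Types (z : nat -> R) (k : {ffun upairs n -> nat}).
Local Notation unif := (@unif R).
Local Notation alm := (al m mm).

Definition expo k (i : 'I_n) : R :=
  m i + \sum_(j < n | (i < j)%N) (mm i j - (kval k i j)%:R) + \sum_(j < n | (j < i)%N) (kval k j i)%:R.

Lemma expo_al k i : expo k i = alm i + (\sum_(j < n | (j < i)%N) (kval k j i)%:R - \sum_(j < n | (i < j)%N) (kval k i j)%:R).
Proof. by rewrite /expo sumrB /al; ring. Qed.

(** Each factor [(z_j / z_i) ^ k_ij] moves [k_ij] from the exponent of [z_i] to that of [z_j]; this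
    is the origin of the arguments of the residues. *)
Lemma expi_expo k z :
  (\prod_(i < n) expi ((alm i + 1) * (2 * pi * z i))) *
  \prod_(p : upairs n) expi (2 * pi * z (val p).2 - 2 * pi * z (val p).1) ^+ k p =
  \prod_(i < n) expi ((expo k i + 1) * (2 * pi * z i)).
Proof.
under [X in _ * X]eq_bigr do rewrite expiX -kvalE.
rewrite (big_upairs _ (fun i j : 'I_n => expi ((kval k i j)%:R * (2 * pi * z j - 2 * pi * z i)))).
under [X in _ * X]eq_bigr do rewrite -expi_sum.
rewrite -!expi_sum -expiD; congr expi.
have e : \sum_(i < n) \sum_(j < n | (i < j)%N) (kval k i j)%:R * (2 * pi * z j - 2 * pi * z i) =
   \sum_(i < n) ((\sum_(j < n | (j < i)%N) (kval k j i)%:R - \sum_(j < n | (i < j)%N) (kval k i j)%:R) * (2 * pi * z i)).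
  under eq_bigr do under eq_bigr do rewrite mulrBr.
  under eq_bigr do rewrite sumrB.
  under [RHS]eq_bigr do rewrite mulrBl !mulr_suml.
  rewrite !sumrB; congr (_ - _).
  by rewrite (exchange_big_dep xpredT).
rewrite e -big_split /=; apply: eq_bigr => i _; rewrite expo_al; ring.
Qed.

Definition rpair (x : R) (p : upairs n) : R := (rho x (val p).1)^-1 * rho x (val p).2.

(** This is [x] to the sum of [(j - i) k_ij]. The radii are recorded here, so that only angles
    remain to be integrated. *)
Definition wt (x : R) k : R := \prod_(p : upairs n) rpair x p ^+ k p.

Section rep.
Context (d : measure_display) (X : measurableType d).
Variables (mu : probability X R) (Z : X -> nat -> R).
Hypothesis rep : cube_rep (iota 0 n) mu Z.

Let mZ := rep_meas rep.

Lemma prob_cintegrable (f : X -> R[i]) (C : R) : cmeas f -> (forall y, cn (f y) <= C) -> cintegrable mu f.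
Proof. by move=> mf fC; apply: (cintegrable_dom mf _ fC); exact: prob_integrable_cst. Qed.

(** Independence of the coordinates. [Q j] interpolates between the two sides, with the coordinates
    below [j] already replaced by their means. *)
Lemma Cint_expi_prod (c : 'I_n -> R) : Cint mu (fun y => \prod_(i < n) expi (c i * (2 * pi * Z y i))) =
  \prod_(i < n) Cint unif (fun t => expi (c i * (2 * pi * t))).
Proof.
pose Q j z := (\prod_(i < n | (i < j)%N) Cint unif (fun t => expi (c i * (2 * pi * t)))) *
  \prod_(i < n | (j <= i)%N) expi (c i * (2 * pi * z i)).
have mQ j d' (T : measurableType d') (g : T -> nat -> R) :
    (forall i, measurable_fun setT (fun y => g y i)) -> cmeas (fun y => Q j (g y)).
  move=> mg; apply: cmeasM; first exact: cmeas_cst.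
  by apply: cmeas_prod => i _; apply: cmeas_expi; apply: measurable_funM => //; exact: measurable_funM.
have cQ j : cymeas (Q j) by split=> d' T g mg; have [] := mQ j _ _ _ mg.
have iQ j : cintegrable mu (fun y => Q j (Z y)).
  apply: cintegrableZ; apply: (@prob_cintegrable _ 1).
    by apply: cmeas_prod => i _; apply: cmeas_expi; apply: measurable_funM => //; exact: measurable_funM.
  by move=> y; rewrite cn_prod big1// => i _; rewrite cn_expi.
have st (i : 'I_n) : Cint mu (fun y => Q i (Z y)) = Cint mu (fun y => Q i.+1 (Z y)).
  apply: (@rep_Cint_eq R _ _ _ _ _ rep i (Q i) (Q i.+1)) => //; first exact: iota_ord.
  apply: nearW => y; pose K := (\prod_(j < n | (j < i)%N) Cint unif (fun t => expi (c j * (2 * pi * t)))) *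
    \prod_(j < n | (i < j)%N) expi (c j * (2 * pi * Z y j)).
  have e1 t : Q i (upd (Z y) i t) = K * expi (c i * (2 * pi * t)).
    rewrite /Q /K -[RHS]mulrA; congr (_ * _); rewrite (bigD1 i)//= upd_same mulrC; congr (_ * _).
    rewrite (eq_bigl (fun j : 'I_n => (i < j)%N)).
      by apply: eq_bigr => j ij; rewrite upd_neq// gtn_eqF.
    by move=> j; rewrite ltn_neqAle eq_sym andbC.
  have e2 t : Q i.+1 (upd (Z y) i t) = K * Cint unif (fun t => expi (c i * (2 * pi * t))).
    rewrite /Q /K [RHS]mulrAC; congr (_ * _); last first.
      by apply: eq_bigr => j ij; rewrite upd_neq// gtn_eqF.
    rewrite (bigD1 i)//= mulrC; congr (_ * _); apply: eq_bigl => j.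
    by rewrite ltnS ltn_neqAle -(inj_eq val_inj) andbC.
  transitivity (K * Cint unif (fun t => expi (c i * (2 * pi * t)))); last first.
    by rewrite -[LHS](Cint_cst unif); apply: eq_Cint => t; rewrite e2.
  rewrite -CintZ; first by apply: eq_Cint => t; rewrite e1.
  apply: (@cintegrable_dom R _ (measurableTypeR R) unif _ (cst 1)).
  - apply: cmeas_expi; apply: measurable_funM => //; apply: measurable_funM => //; exact: measurable_id.
  - exact: prob_integrable_cst.
  - by move=> t; rewrite cn_expi.
have al j : (j <= n)%N -> Cint mu (fun y => Q 0 (Z y)) = Cint mu (fun y => Q j (Z y)).
  by elim: j => [//|j IH jn]; rewrite (IH (ltnW jn)) (st (Ordinal jn)).
have := al n (leqnn n).
rewrite (_ : (fun y => Q n (Z y)) = fun=> \prod_(i < n) Cint unif (fun t => expi (c i * (2 * pi * t)))); last first.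
  apply/funext => y; rewrite /Q [X in _ * X]big_pred0 ?mulr1; last by move=> j; rewrite leqNgt ltn_ord.
  by apply: eq_bigl => j; rewrite ltn_ord.
rewrite Cint_cst => <-; apply: eq_Cint => y; rewrite /Q [X in _ = X * _]big_pred0// mul1r; exact: eq_bigl.
Qed.

Lemma Cint_Fterm (x : R) k :
  Cint mu (fun y => (\prod_(i < n) expi ((alm i + 1) * (2 * pi * Z y i))) *
     \prod_(p : upairs n) ((bcoef (mm (val p).1 (val p).2) (k p))%:C *
        ((rpair x p)%:C * expi (2 * pi * Z y (val p).2 - 2 * pi * Z y (val p).1)) ^+ k p)) =
  (wt x k)%:C * Fterm m mm k.
Proof.
pose c := (wt x k)%:C * \prod_(p : upairs n) (bcoef (mm (val p).1 (val p).2) (k p))%:C.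
rewrite (eq_Cint _ (g := fun y => c * \prod_(i < n) expi ((expo k i + 1) * (2 * pi * Z y i)))).
  rewrite CintZ; last first.
    apply: (@prob_cintegrable _ 1).
      by apply: cmeas_prod => i _; apply: cmeas_expi; apply: measurable_funM => //; exact: measurable_funM.
    by move=> y; rewrite cn_prod big1// => i _; rewrite cn_expi.
  rewrite Cint_expi_prod /c /Fterm -mulrA; congr (_ * _); rewrite mulrC; congr (_ * _).
  by apply: eq_bigr => i _; rewrite resid_Cint.
move=> y; rewrite -expi_expo mulrCA; congr (_ * _).
rewrite /c /wt rmorph_prod -mulrA -!big_split /=; apply: eq_bigr => p _.
by rewrite exprMn rmorphXn /= mulrCA mulrA.
Qed.

Definition box_emb N (k : {ffun upairs n -> 'I_N}) : {ffun upairs n -> nat} := [ffun p => val (k p)].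

Lemma Cint_box (x : R) N :
  Cint mu (fun y => (\prod_(i < n) expi ((alm i + 1) * (2 * pi * Z y i))) *
     \prod_(p : upairs n) \sum_(a < N) (bcoef (mm (val p).1 (val p).2) a)%:C *
        ((rpair x p)%:C * expi (2 * pi * Z y (val p).2 - 2 * pi * Z y (val p).1)) ^+ a) =
  \sum_(k : {ffun upairs n -> 'I_N}) (wt x (box_emb k))%:C * Fterm m mm (box_emb k).
Proof.
under eq_Cint do rewrite bigA_distr_bigA mulr_sumr.
rewrite Cint_sum.
  apply: eq_bigr => k _; rewrite -Cint_Fterm; apply: eq_Cint => y; congr (_ * _).
  by apply: eq_bigr => p _; rewrite ffunE.
move=> k _; apply: (@prob_cintegrable _ (\prod_(p : upairs n) (`|bcoef (mm (val p).1 (val p).2) (k p)| * `|rpair x p| ^+ k p))).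
  apply: cmeasM.
    by apply: cmeas_prod => i _; apply: cmeas_expi; apply: measurable_funM => //; exact: measurable_funM.
  apply: cmeas_prod => p _; apply: cmeasM; first exact: cmeas_cst.
  under eq_fun do rewrite exprMn expiX; apply: cmeasM; first exact: cmeas_cst.
  apply: cmeas_expi; apply: measurable_funM => //; apply: measurable_funB; exact: measurable_funM.
move=> y; rewrite cnM !cn_prod big1 ?mul1r; last by move=> i _; rewrite cn_expi.
by apply: ler_prod => p _; rewrite cn_ge0 /= cnM cnX cnM cn_expi mulr1 !cn_real lexx.
Qed.

Lemma rpair_bound x p : 0 < x -> x < 1 -> 0 <= rpair x p <= x.
Proof.
move=> x0 x1; rewrite mulr_ge0 ?invr_ge0 ?(ltW (rho_gt0 x0 _))//=.
by apply: (rho_lt x0 x1); exact: valP p.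
Qed.

Lemma Phi_full x z : Phi m mm x n z = (\prod_(i < n) expi ((alm i + 1) * (2 * pi * z i))) *
  \prod_(p : upairs n) ppow (mm (val p).1 (val p).2)
     (1 - (rpair x p)%:C * expi (2 * pi * z (val p).2 - 2 * pi * z (val p).1)).
Proof.
rewrite (big_upairs _ (fun i j : 'I_n => ppow (mm i j) (1 - ((rho x i)^-1 * rho x j)%:C * expi (2 * pi * z j - 2 * pi * z i)))).
rewrite -big_split /=; apply: eq_bigr => i _; rewrite leqNgt ltn_ord /= /circ; congr (_ * _).
by apply: eq_bigr => l il; rewrite /W /Wr /Wp ltn_ord.
Qed.

(** Truncating every [k_ij] below [N] makes the sum over the box a product of partial sums. These
    are bounded uniformly in [N] because the ratios of radii are at most [x]. *)
Lemma box_limit x : 0 < x -> x < 1 ->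
  ccvg \oo (fun N => \sum_(k : {ffun upairs n -> 'I_N}) (wt x (box_emb k))%:C * Fterm m mm (box_emb k))
    (Cint mu (fun y => Phi m mm x n (Z y))).
Proof.
move=> x0 x1.
have [M hM] := boolp.choice (fun p : upairs n =>
  bcoef_sum_bound (mm (val p).1 (val p).2) (ltW x0) x1).
under eq_fun do rewrite -Cint_box.
under [X in ccvg _ _ (Cint _ X)]eq_fun do rewrite Phi_full.
have mE : cmeas (fun y => \prod_(i < n) expi ((alm i + 1) * (2 * pi * Z y i))).
  by apply: cmeas_prod => i _; apply: cmeas_expi; apply: measurable_funM => //; exact: measurable_funM.
have mu1 (p : upairs n) : cmeas (fun y => (rpair x p)%:C * expi (2 * pi * Z y (val p).2 - 2 * pi * Z y (val p).1)).
  apply: cmeasM; first exact: cmeas_cst.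
  by apply: cmeas_expi; apply: measurable_funB; exact: measurable_funM.
have cu (p : upairs n) y : cn ((rpair x p)%:C * expi (2 * pi * Z y (val p).2 - 2 * pi * Z y (val p).1)) <= x.
  by have /andP[r0 r1] := rpair_bound p x0 x1; rewrite cnM cn_expi mulr1 cn_real ger0_norm.
apply: (@Cdominated R _ X mu _ _ (cst (\prod_(p : upairs n) M p))).
- move=> N; apply: cmeasM => //; apply: cmeas_prod => p _; apply: cmeas_sum => a _.
  apply: cmeasM; first exact: cmeas_cst.
  elim: (val a) => [|b IH]; first by under eq_fun do rewrite expr0; exact: cmeas_cst.
  by under eq_fun do rewrite exprS; exact: cmeasM.
- apply: cmeasM => //; apply: cmeas_prod => p _; apply: cmeas_ppow; exact: cmeas_1B.
- apply: nearW => y; apply: ccvgM; first exact: ccvg_cst.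
  apply: ccvg_prod => p _; have /andP[r0 r1] := rpair_bound p x0 x1.
  by apply: cbinomial_series => //; exact: le_lt_trans x1.
- exact: prob_integrable_cst.
- apply: nearW => y N; rewrite cnM !cn_prod big1 ?mul1r; last by move=> i _; rewrite cn_expi.
  by apply: ler_prod => p _; rewrite cn_ge0 /=; have [_] := hM p; apply.
Qed.

End rep.

End box_sums.

(** * Abel summation for unordered sums *)

Section abel.
Context {R : realType} {T : choiceType}.

Lemma sum_weighted_abs (s : seq T) (P : pred T) (t w : T -> R) :
  (forall i, 0 <= w i <= 1) -> (forall i, P i -> 0 <= t i) \/ (forall i, P i -> t i <= 0) ->
  `|\sum_(i <- s | P i) w i * t i| <= `|\sum_(i <- s | P i) t i|.
Proof.
move=> w01 [t0|t0].
  rewrite !ger0_norm ?sumr_ge0//; last by move=> i Pi; have /andP[? _] := w01 i; rewrite mulr_ge0 ?t0.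
  by apply: ler_sum => i Pi; have /andP[_ ?] := w01 i; rewrite ler_piMl ?t0.
rewrite !ler0_norm ?sumr_le0//; last by move=> i Pi; have /andP[? _] := w01 i; rewrite mulr_ge0_le0 ?t0.
by rewrite lerN2; apply: ler_sum => i Pi; have /andP[_ ?] := w01 i; rewrite ler_niMl ?t0.
Qed.

Variables (t : T -> R) (L : R).
Hypothesis tL : (fun A : {fset T} => \sum_(i <- A) t i) @ totally --> L.

Lemma totally_sum_near e : 0 < e -> exists A0 : {fset T}, forall B : {fset T}, (A0 `<=` B)%fset ->
  `|\sum_(i <- B) t i - L| < e.
Proof.
move=> e0; move/cvgrPdist_lt : tL => /(_ e e0)[A _ h]; exists A => B AB.
by rewrite distrC; exact: h.
Qed.

(* The net of finite partial sums is Cauchy, so the terms outside A0 with a given sign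
   have a small sum; weights in [0, 1] cannot increase it. *)
Lemma weighted_sum_near e : 0 < e -> exists A0 : {fset T}, forall (w : T -> R) (B : {fset T}),
  (forall i, 0 <= w i <= 1) -> (A0 `<=` B)%fset ->
  `|\sum_(i <- B) w i * t i - L| <= 5 * e + \sum_(i <- A0) (1 - w i) * `|t i|.
Proof.
move=> e0; have [A0 hA] := totally_sum_near e0; exists A0 => w B w01 AB.
have near (P : pred T) : (forall i, i \in A0 -> P i) -> `|\sum_(i <- B | P i) t i - L| < e.
  move=> hP; rewrite big_fset_condE; apply: hA; apply/fsubsetP => i iA.
  by rewrite !inE /= (fsubsetP AB) ?hP.
have n0 := near [pred i | i \in A0] (fun _ => id).
(* Adding to [A0] only terms of one sign shows that the positive and the negative tail are small
   separately, without cancellation. *)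
have np := near [pred i | (i \in A0) || (0 <= t i)] (fun i h => introT orP (or_introl h)).
have nn := near [pred i | (i \in A0) || (t i < 0)] (fun i h => introT orP (or_introl h)).
have split_or (P : pred T) : \sum_(i <- B | (i \in A0) || P i) t i =
    \sum_(i <- B | i \in A0) t i + \sum_(i <- B | (i \notin A0) && P i) t i.
  rewrite (bigID (fun i => i \in A0)) /=; congr (_ + _); apply: eq_bigl => i.
    by case: (i \in A0); rewrite ?andbT ?andbF.
  by case: (i \in A0); rewrite ?andbT ?andbF.
rewrite /= in n0 np nn; rewrite split_or in np; rewrite split_or in nn.
have sA (f : T -> R) : \sum_(i <- B | i \in A0) f i = \sum_(i <- A0) f i.
  rewrite big_fset_condE; congr (\sum_(i <- enum_fset _) _); apply/fsetP => i.
  by rewrite !inE /= andbC; case: (boolP (i \in A0)) => //= iA; exact: (fsubsetP AB).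
have e1 : \sum_(i <- B) w i * t i = \sum_(i <- B | i \in A0) w i * t i +
    (\sum_(i <- B | (i \notin A0) && (0 <= t i)) w i * t i +
     \sum_(i <- B | (i \notin A0) && (t i < 0)) w i * t i).
  rewrite (bigID (fun i => i \in A0)) /=; congr (_ + _).
  rewrite (bigID (fun i => 0 <= t i)) /=; congr (_ + _).
  by apply: eq_bigl => i; rewrite -ltNge.
have e2 : \sum_(i <- B | i \in A0) w i * t i =
    \sum_(i <- B | i \in A0) t i - \sum_(i <- A0) (1 - w i) * t i.
  by rewrite -sA -sumrB; apply: eq_bigr => i _; ring.
have b2 : `|\sum_(i <- A0) (1 - w i) * t i| <= \sum_(i <- A0) (1 - w i) * `|t i|.
  apply: (le_trans (ler_norm_sum _ _ _)); apply: ler_sum => i _; rewrite normrM ger0_norm//.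
  by have /andP[_ ?] := w01 i; rewrite subr_ge0.
have bp := @sum_weighted_abs B (fun i => (i \notin A0) && (0 <= t i)) t w w01
  (or_introl (fun i h => proj2 (andP h))).
have bn := @sum_weighted_abs B (fun i => (i \notin A0) && (t i < 0)) t w w01
  (or_intror (fun i h => ltW (proj2 (andP h)))).
rewrite e1 e2.
move: bp bn n0 np nn b2.
set u := \sum_(i <- B | i \in A0) t i; set v := \sum_(i <- A0) (1 - w i) * t i.
set sp := \sum_(i <- B | _) t i; set sn := \sum_(i <- B | (i \notin A0) && (t i < 0)) t i.
set wp := \sum_(i <- B | _) w i * t i; set wn := \sum_(i <- B | (i \notin A0) && (t i < 0)) w i * t i.
set S := \sum_(i <- A0) _ => bp bn n0 np nn b2.
(* Each tail is a difference of two sums within [e] of [L]; the two tails and [u - L] make up the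
   [5 * e]. *)
have sp2 : `|sp| <= 2 * e.
  rewrite (_ : sp = (u + sp - L) - (u - L)); last ring.
  by apply: le_trans (ler_normB _ _) _; move: n0 np; lra.
have sn2 : `|sn| <= 2 * e.
  rewrite (_ : sn = (u + sn - L) - (u - L)); last ring.
  by apply: le_trans (ler_normB _ _) _; move: n0 nn; lra.
rewrite (_ : u - v + (wp + wn) - L = (u - L) - v + (wp + wn)); last ring.
apply: le_trans (ler_normD _ _) _; apply: (@le_trans _ _ (`|u - L| + `|v| + (`|wp| + `|wn|))).
  by apply: lerD; [exact: ler_normB|exact: ler_normD].
by move: bp bn n0 sp2 sn2 b2; lra.
Qed.

(** The estimate on finite sums is uniform in the weights, so [N] can tend to infinity before [M]
    does. Only the sum over the fixed finite set [A0] then depends on [M], and there the weights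
    tend to 1. *)
Lemma abel_summation (w : nat -> T -> R) (B : nat -> {fset T}) (V : nat -> R) :
  (forall M i, 0 <= w M i <= 1) -> (forall i, w M i @[M --> \oo] --> (1 : R)) ->
  (forall A : {fset T}, \forall N \near \oo, (A `<=` B N)%fset) ->
  (forall M, \sum_(i <- B N) w M i * t i @[N --> \oo] --> V M) -> V M @[M --> \oo] --> L.
Proof.
move=> w01 w1 BT BV; apply/cvgrPdist_le => e e0.
have e60 : 0 < e / 6 by rewrite divr_gt0.
have [A0 hA] := weighted_sum_near e60.
have sm : \sum_(i <- A0) (1 - w M i) * `|t i| @[M --> \oo] --> (0 : R).
  have : \sum_(i <- A0) (1 - w M i) * `|t i| @[M --> \oo] --> \sum_(i <- A0) (1 - 1) * `|t i|.
    elim: (enum_fset A0) => [|i s IH].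
      by rewrite big_nil; under eq_cvg do rewrite big_nil; exact: cvg_cst.
    rewrite big_cons; under eq_cvg do rewrite big_cons.
    by apply: cvgD => //; apply: cvgM; [apply: cvgB; [exact: cvg_cst|exact: w1]|exact: cvg_cst].
  by rewrite [X in _ --> X]big1// => i _; rewrite subrr mul0r.
move/cvgrPdist_le : sm => /(_ _ e60); apply: filterS => M; rewrite sub0r normrN => hM.
have cl : `|L - (\sum_(i <- B N) w M i * t i)| @[N --> \oo] --> `|L - V M|.
  by apply: cvg_norm; apply: cvgB; [exact: cvg_cst|exact: BV].
rewrite -(cvg_lim _ cl)//; apply: limr_le; first by apply: cvgP cl.
apply: filterS (BT A0) => N AN; rewrite distrC; apply: (le_trans (hA (w M) (B N) (w01 M) AN)).
apply: (@le_trans _ _ (5 * (e / 6) + e / 6)); last by lra.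
by rewrite lerD2l; exact: le_trans (ler_norm _) hM.
Qed.

End abel.

(** * Radii tending to 1 and the conclusion *)

Section main.
Context {R : realType} (n : nat) (m : 'I_n -> R) (mm : 'I_n -> 'I_n -> R).
Implicit Types (z : nat -> R) (k : {ffun upairs n -> nat}).

(** The shift by 2 keeps the first value away from 0. *)
Definition xseq (M : nat) : R := 1 - (M.+2)%:R^-1.

Lemma xseq_gt0 M : 0 < xseq M.
Proof. by rewrite subr_gt0 invf_lt1 ?ltr1n ?ltr0n. Qed.

Lemma xseq_lt1 M : xseq M < 1.
Proof. by rewrite ltrBlDr ltrDl invr_gt0 ltr0n. Qed.

Lemma xseq_cvg : xseq M @[M --> \oo] --> (1 : R).
Proof.
rewrite -[X in _ --> X]subr0; apply: cvgB; first exact: cvg_cst.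
have h := @cvg_harmonic R.
rewrite -(cvg_shiftS (fun M => M.+1%:R^-1 : R)) in h.
exact: h.
Qed.

Lemma rho_cvg (i : nat) : rho (xseq M) i @[M --> \oo] --> (1 : R).
Proof.
rewrite /rho -(expr1n _ i); elim: i => [|i IH].
  by under eq_cvg do rewrite expr0; rewrite expr0; exact: cvg_cst.
rewrite exprS; under eq_cvg do rewrite exprS; apply: cvgM => //; exact: xseq_cvg.
Qed.

Lemma wt_cvg k : wt (xseq M) k @[M --> \oo] --> (1 : R).
Proof.
have rp p : rpair (xseq M) p @[M --> \oo] --> (1 : R).
  rewrite -[X in _ --> X]mulr1 -{1}invr1; apply: cvgM; last exact: rho_cvg.
  by apply: cvgV; [exact: oner_neq0|exact: rho_cvg].
have : ccvg \oo (fun M => \prod_(p : upairs n) (rpair (xseq M) p ^+ k p)%:C) (\prod_(p : upairs n) (1 : R)%:C).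
  apply: ccvg_prod => p _; apply: ccvg_real; rewrite -(expr1n _ (k p)).
  elim: (k p) => [|a IH]; first by under eq_cvg do rewrite expr0; rewrite expr0; exact: cvg_cst.
  by rewrite exprS; under eq_cvg do rewrite exprS; exact: cvgM.
move=> [+ _]; rewrite -rmorph_prod big1_eq /=.
by under eq_cvg do rewrite -rmorph_prod /=.
Qed.

Lemma wt_01 M k : 0 <= wt (xseq M) k <= 1.
Proof.
have rp p := @rpair_bound R n (xseq M) p (xseq_gt0 M) (xseq_lt1 M).
apply/andP; split; first by apply: prodr_ge0 => p _; have /andP[? _] := rp p; exact: exprn_ge0.
apply: prodr_ile1 => p _; have /andP[r0 r1] := rp p.
by rewrite exprn_ge0//= exprn_ile1// (le_trans r1)// ltW// xseq_lt1.
Qed.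

Definition boxset N : {fset {ffun upairs n -> nat}} :=
  [fset @box_emb n N k | k : {ffun upairs n -> 'I_N}]%fset.

Lemma box_emb_inj N : injective (@box_emb n N).
Proof.
by move=> k k' /ffunP h; apply/ffunP => p; apply: val_inj; have := h p; rewrite !ffunE.
Qed.

Lemma sum_boxset (V : nmodType) N (F : {ffun upairs n -> nat} -> V) :
  \sum_(k <- boxset N) F k = \sum_(k : {ffun upairs n -> 'I_N}) F (box_emb k).
Proof.
rewrite big_imfset /=; last by move=> k k' _ _; exact: box_emb_inj.
by rewrite big_enum.
Qed.

Lemma boxset_exhaust (A : {fset {ffun upairs n -> nat}}) : \forall N \near \oo, (A `<=` boxset N)%fset.
Proof.
(* One more than the largest entry of the finitely many families in [A]. *)
exists (\max_(k <- A) \max_(p : upairs n) (k p)).+1 => // N /= hN.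
apply/fsubsetP => k kA.
have kN p : (k p < N)%N.
  apply: leq_trans hN; rewrite ltnS; apply: leq_trans (leq_bigmax_seq _ kA isT).
  exact: (leq_bigmax p).
apply/imfsetP; exists [ffun p => Ordinal (kN p)] => //.
by apply/ffunP => p; rewrite !ffunE.
Qed.

Section rep.
Context (d : measure_display) (X : measurableType d).
Variables (mu : probability X R) (Z : X -> nat -> R).
Hypothesis rep : cube_rep (iota 0 n) mu Z.
Hypothesis den_int : mu.-integrable [set: X] (fun y => (den m mm (Z y))%:E).

Let mZ := rep_meas rep.

(** Abel summation separates terms by sign, so it is applied to real and imaginary parts. *)
Lemma Phi_n_cvg L : series_to (Fterm m mm) L ->
  ccvg \oo (fun M => Cint mu (fun y => Phi m mm (xseq M) n (Z y))) L.
Proof.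
move=> [tR tI]; split.
- apply: (@abel_summation R _ (fun k => Re (Fterm m mm k)) (Re L) _ (fun M k => wt (xseq M) k) boxset).
  + by under eq_cvg do rewrite -Re_sum.
  + exact: wt_01.
  + exact: wt_cvg.
  + exact: boxset_exhaust.
  + move=> M; have [+ _] := box_limit m mm rep (xseq_gt0 M) (xseq_lt1 M).
    apply: cvg_trans; apply: near_eq_cvg; apply: nearW => N; rewrite sum_boxset Re_sum.
    by apply: eq_bigr => k _; rewrite cReM /= mul0r subr0.
- apply: (@abel_summation R _ (fun k => Im (Fterm m mm k)) (Im L) _ (fun M k => wt (xseq M) k) boxset).
  + by under eq_cvg do rewrite -Im_sum.
  + exact: wt_01.
  + exact: wt_cvg.
  + exact: boxset_exhaust.
  + move=> M; have [_ +] := box_limit m mm rep (xseq_gt0 M) (xseq_lt1 M).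
    apply: cvg_trans; apply: near_eq_cvg; apply: nearW => N; rewrite sum_boxset Im_sum.
    by apply: eq_bigr => k _; rewrite cImM /= mul0r addr0.
Qed.

(** As [x] tends to 1 the segments grow to [[0, 1]]: almost every point lies in all of them
    eventually, and until then the indicators only decrease the integrand. *)
Lemma Phi_0_cvg : ccvg \oo (fun M => Cint mu (fun y => Phi m mm (xseq M) 0 (Z y)))
  (Cint mu (fun y => (den m mm (Z y))%:C * \prod_(i < n) phz m mm i (Z y))).
Proof.
apply: (@Cdominated R _ X mu _ _ (fun y => 2 ^+ n * den m mm (Z y))).
- by move=> M; exact: cmeas_Phi.
- apply: cmeasM; first by apply: cmeas_real; exact: ymeas_den.
  by apply: cmeas_prod => i _; exact: cmeas_phz.
- apply: filterS (rep_ae01 rep) => y z01.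
  rewrite /den rmorph_prod -big_split /=; apply: ccvg_prod => j _.
  apply: ccvg_eq (ccvg_cst _); have /andP[z0 z1] := z01 j.
  have h : \forall M \near \oo, Z y j < rho (xseq M) j.
    exact: (cvgr_gt _ (rho_cvg j) _ z1).
  apply: filterS h => M hM.
  by rewrite /gfac /pbox z0 (ltW hM) mul1r.
- by apply: integrable_scale; exact: den_int.
- apply: nearW => y M; rewrite /Phi cn_prod /den.
  rewrite (_ : 2 ^+ n = \prod_(i < n) 2 :> R); last by rewrite prodr_const card_ord.
  rewrite -big_split /=; apply: ler_prod => j _; rewrite cn_ge0 /= cnM cn_real ger0_norm ?gfac_ge0//.
  rewrite mulrC; apply: ler_pM; rewrite ?cn_ge0 ?gfac_ge0 ?cn_phz//.
  rewrite /gfac; apply: ler_piMl; last by rewrite /pbox; case: (_ && _).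
  by rewrite mulr_ge0 ?powR_ge0// prodr_ge0// => l _; exact: powR_ge0.
Qed.

Lemma circfac_cvg i : ccvg \oo (fun M => circfac m mm (xseq M) i) (twopii : R[i]).
Proof.
have -> : twopii = twopii * (1 : R)%:C * ((1 : R) `^ al m mm i)%:C :> R[i] by rewrite powR1 !mulr1.
apply: ccvgM.
  by apply: ccvgM; [exact: ccvg_cst|apply: ccvg_real; exact: rho_cvg].
apply: ccvg_real.
have [/derivable1_diffP/differentiable_continuous h _] := is_derive1_powR (al m mm i) (@ltr01 R).
exact: (cvg_comp _ _ (rho_cvg i) h).
Qed.

(** Passage to the limit in the contour identity, where each of the [n] factors [circfac] tends to
    [2 pi i]. *)
Lemma series_value L : series_to (Fterm m mm) L ->
  twopii ^+ n * L = Cint mu (fun y => (den m mm (Z y))%:C * \prod_(i < n) phz m mm i (Z y)).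
Proof.
move=> /Phi_n_cvg cL; apply: (ccvg_unique _ Phi_0_cvg).
under eq_fun do rewrite (Cint_contour (xseq_gt0 _) (xseq_lt1 _) rep den_int).
apply: ccvgM => //; rewrite -[X in _ ^+ X](card_ord n) -prodr_const.
by apply: ccvg_prod => i _; exact: circfac_cvg.
Qed.

End rep.

End main.

Theorem theorem5p11 (R : realType) (n : nat) (m : 'I_n -> R)
    (mm : 'I_n -> 'I_n -> R) (q : {perm 'I_n} -> R[i]) :
  (0 < n)%N ->
  (forall i j, mm i j = mm j i) ->
  is_braiding_factor mm q ->
  (exists L, series_to (Fterm m mm) L) ->
  (forall (sigma : {perm 'I_n}) (k : 'I_n.+1) (eta : {perm 'I_n}),
     shuffle k eta ->
     (Sel_eta (fun i => m ((sigma^-1)%g i))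
              (fun i j => mm ((sigma^-1)%g i) ((sigma^-1)%g j)) eta
       < +oo)%E) ->
  series_to (Fterm m mm)
    (\sum_(sigma : {perm 'I_n})
       q sigma * Ftilde (fun i => m ((sigma^-1)%g i))
                        (fun i j => mm ((sigma^-1)%g i) ((sigma^-1)%g j))).
Proof.
move=> _ mmC qb [L tL] selfin.
have Selfin tau : (Sel_eta m mm tau < +oo)%E.
  (* The identity is a shuffle for [k = n]; taken with [sigma = tau] it brings every chamber
     integral under the hypothesis. *)
  have sh : shuffle (@ord_max n) (1%g : {perm 'I_n}).
    apply/andP; split; apply/forallP => i; apply/forallP => j; apply/implyP => /andP[h1 h2].
      by rewrite !perm1.
    by move: h1; rewrite leqNgt ltn_ord.
  have := selfin tau ord_max 1%g sh; congr (_ < _)%E; rewrite /Sel_eta invg1.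
  by congr Sel; apply/funext => i; [rewrite perm1|apply/funext => j; rewrite !perm1].
have [d [X [mu [Z rep]]]] := @cube_rep_ex R (iota 0 n).
have den_int := den_int mmC rep Selfin.
have := series_value rep den_int tL; rewrite (Cint_chambers mmC rep Selfin) => e.
rewrite (reduced_sumE _ mmC qb) -e mulKf//.
by rewrite expf_neq0// twopii_neq0.
Qed.
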